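(* Let $n\in\mathbb{N}_0$, let $a\in\mathbb{C}$ with $\Re(a)>0$ and let $s\in\mathbb{C}$ with $0\le 2n<\Re(s)$. Define $$SH_n(a,s):=\int_{0}^{\infty}\frac{t^{2n}\sin\!\big(s\tan^{-1}(t/a)\big)}{(a^2+t^2)^{s/2}\,\sinh(\pi t)}\,dt.$$ Then $$SH_n(a,s)=\frac{1}{2}\sum_{m=0}^{2n}(-1)^{m+n}\binom{2n}{m}a^{m}\,P_2(a,m+s-2n),$$ where $$P_2(a,s)=2^{2-s}\zeta(s,a/2)-2\zeta(s,a)-a^{-s}.$$
   Context: $\zeta(s,a)=\sum_{k\ge 0}(a+k)^{-s}$ denotes the Hurwitz zeta function, extended by analytic continuation to $s\neq 1$. Powers and $\tan^{-1}$ of complex arguments are taken with their principal branches.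
   Formalization: When s = 2n+1 the term m = 0 involves P_2(a,1), which is undefined because ζ(s,a) has a pole at s = 1; there P_2(a,1) is read as the limit of P_2(a,s) as s → 1 (a removable singularity). *)

(* Defs.v *)
From Stdlib Require Import Reals.
From Coquelicot Require Import Coquelicot.

Local Open Scope C_scope.

Definition Cexp (z : C) : C :=
  (exp (Re z) * cos (Im z), exp (Re z) * sin (Im z))%R.

(* Values in (-PI, PI], with argument PI on the negative real axis;
   the value at 0 is irrelevant. *)
Definition Carg (z : C) : R :=
  if Rle_dec 0 (Im z) then acos (Re z / Cmod z)
  else (- acos (Re z / Cmod z))%R.

Definition Clog (z : C) : C := (ln (Cmod z), Carg z).

Definition Cpower (z w : C) : C := Cexp (w * Clog z).

Definition Csin (z : C) : C := (Cexp (Ci * z) - Cexp (- (Ci * z))) / (2 * Ci).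

(* The cuts are the two half-lines {i y : |y| >= 1} of the imaginary axis. *)
Definition Catan (z : C) : C := (Clog (1 + Ci * z) - Clog (1 - Ci * z)) / (2 * Ci).

Definition analytic_at (f : C -> C) (z0 : C) : Prop :=
  exists (c : nat -> C) (r : R), (0 < r)%R /\
    forall z : C, (Cmod (z - z0) < r)%R ->
      @is_pseries C_AbsRing C_NormedModule c (z - z0) (f z).

(* [zeta s a] is the Hurwitz zeta function on the half-plane Re a > 0: for each
   fixed a, the analytic continuation in s of the Dirichlet series to C \ {1}.
   By the identity theorem this determines [zeta s a] for Re a > 0 and s <> 1;
   nothing is said about the value at the pole s = 1. *)
Definition is_hurwitz_zeta (zeta : C -> C -> C) : Prop :=
  forall a : C, (0 < Re a)%R ->
    (forall s : C, (1 < Re s)%R ->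
       @is_series C_AbsRing C_NormedModule
         (fun k : nat => Cpower (a + INR k) (- s)) (zeta s a)) /\
    (forall s : C, s <> 1 -> analytic_at (fun w : C => zeta w a) s).

Definition P2_formula (zeta : C -> C -> C) (a s : C) : C :=
  Cpower 2 (2 - s) * zeta s (a / 2) - 2 * zeta s a - Cpower a (- s).

(* At s = 1 the poles of the two zeta terms cancel, so that the singularity of
   P2 is removable: its value there is the limit. This value does occur in the
   sum for SH_n, in the term m = 0 when s = 2n + 1. *)
Definition P2 (zeta : C -> C -> C) (a s : C) : C :=
  if Ceq_dec s 1 then C_lim (P2_formula zeta a) 1 else P2_formula zeta a s.

Definition SH_integrand (n : nat) (a s : C) (t : R) : C :=
  RtoC (t ^ (2 * n)) * Csin (s * Catan (t / a)) /
  (Cpower (a * a + t * t) (s / 2) * RtoC (sinh (PI * t))).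

Definition ex_SH (n : nat) (a s : C) : Prop :=
  @ex_RInt_gen C_R_NormedModule (SH_integrand n a s)
    (at_right 0) (Rbar_locally p_infty).

Definition SH (n : nat) (a s : C) : C :=
  @RInt_gen C_R_CompleteNormedModule (SH_integrand n a s)
    (at_right 0) (Rbar_locally p_infty).

(* Main.v *)
(** Put f_s(z) = (a+z)^(-s).  Since sin(s atan(t/a)) (a^2+t^2)^(-s/2) is
    (f_s(-it) - f_s(it)) / 2i, the integral SH_n is a linear functional Lambda applied to
    t^(2n) f_s(it) = (-1)^n (it)^(2n) f_s(it), and expanding (it)^(2n) = ((a+it) - a)^(2n)
    reduces the theorem to n = 0, i.e. to 2 Lambda(f_s) = P_2(a,s) for Re s > 0.

    Cauchy's theorem for f_s(z) / sin(pi z) on rectangles with sides on Re z = 0 and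
    Re z = 1/2, cut off at distance d from the real axis, and the same for f_s(1-z), gives
    as d -> 0 the functional equation 2 Lambda_a + 2 Lambda_(a+1) = a^(-s) - (a+1)^(-s).
    Iterating it, for Re s > 1 one finds
    2 Lambda_a = 2 sum (-1)^k (a+k)^(-s) - a^(-s), which is P_2(a,s).

    Lambda is bounded by the supremum of the derivative, so Lambda(f_s) has a power series
    in s, obtained from that of the exponential.  Both sides being analytic along a ray from
    s into Re s > 1 that avoids 1, they agree for Re s > 0, s <> 1, and at s = 1 by
    continuity. *)
Require Import Defs.
From Stdlib Require Import Reals Lra Lia Psatz Factorial.
From Coquelicot Require Import Coquelicot.

Local Open Scope C_scope.

(** * Exponential, logarithm and powers *)

(** The pole of 1 / sin (pi z) at 0 lies on a side of the strip, so it contributes only half a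
    residue; this produces the terms a^(-s) and (a+1)^(-s) of the functional equation. The
    reflection z -> 1 - z preserves sin (pi z) and merely exchanges y and -y on Re z = 1/2: the two
    applications of Cauchy's theorem share one integral there, which drops out of their difference.

    The integrand of Lambda is a difference divided by sinh (pi t), singular at 0, so the size of a
    test function has to be measured by its derivative. This choice pays twice more. The derivative
    of (b+it)^(-s) carries a factor 1/(b+it), which makes Lambda_(a+k) tend to 0 as k grows.
    Expanding in s brings in powers of log (a+it), unbounded on the line; the factor 1/(a+it) of the
    derivative absorbs their growth.

    The functional equation holds for Re s > 0, but its iterates are compared with Dirichlet series
    that converge only for Re s > 1; hence the continuation in s. *)

Lemma C_ext (z w : C) : Re z = Re w -> Im z = Im w -> z = w.
Proof. destruct z, w; simpl; intros -> ->; reflexivity. Qed.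

Lemma norm_C_R (z : C) : @norm R_AbsRing C_R_NormedModule z = Cmod z.
Proof.
  change (sqrt (Rabs (fst z) ^ 2 + Rabs (snd z) ^ 2) = sqrt (fst z ^ 2 + snd z ^ 2))%R.
  now rewrite !pow2_abs.
Qed.

Lemma Cmod_Ci : Cmod Ci = 1%R.
Proof. unfold Cmod; simpl; transitivity (sqrt 1); [f_equal; ring|apply sqrt_1]. Qed.

Lemma Cmod_le_abs (z : C) : (Cmod z <= Rabs (Re z) + Rabs (Im z))%R.
Proof.
  replace z with (RtoC (Re z) + Ci * RtoC (Im z)) at 1
    by (apply C_ext; simpl; ring).
  eapply Rle_trans; [apply Cmod_triangle|].
  rewrite Cmod_mult, !Cmod_R.
  rewrite Cmod_Ci; lra.
Qed.

Lemma Re_le_Cmod (z : C) : (Rabs (Re z) <= Cmod z)%R.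
Proof. apply (Rle_trans _ _ _ (Rmax_l _ _) (Rmax_Cmod z)). Qed.

Lemma Im_le_Cmod (z : C) : (Rabs (Im z) <= Cmod z)%R.
Proof. apply (Rle_trans _ _ _ (Rmax_r _ _) (Rmax_Cmod z)). Qed.

Lemma Cmod_sqr (z : C) : (Cmod z ^ 2 = Re z ^ 2 + Im z ^ 2)%R.
Proof. unfold Cmod; rewrite pow2_sqrt; [reflexivity|nra]. Qed.

Lemma Re_pos_neq_0 (z : C) : (0 < Re z)%R -> z <> 0.
Proof. intros H E; rewrite E in H; simpl in H; lra. Qed.

Lemma Cexp_plus (z w : C) : Cexp (z + w) = Cexp z * Cexp w.
Proof.
  destruct z, w; apply C_ext; unfold Cexp; simpl;
    rewrite exp_plus, ?cos_plus, ?sin_plus; ring.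
Qed.

Lemma Cexp_0 : Cexp 0 = 1.
Proof. unfold Cexp; simpl; rewrite exp_0, cos_0, sin_0; apply C_ext; simpl; ring. Qed.

Lemma Cmod_Cexp (z : C) : Cmod (Cexp z) = exp (Re z).
Proof.
  unfold Cmod, Cexp; simpl.
  replace (_ + _)%R with (exp (Re z) * exp (Re z))%R.
  - apply sqrt_square, Rlt_le, exp_pos.
  - generalize (sin2_cos2 (Im z)); unfold Rsqr; intros H.
    transitivity (exp (Re z) * exp (Re z) * (sin (Im z) * sin (Im z) + cos (Im z) * cos (Im z)))%R;
      [rewrite H|]; ring.
Qed.

Lemma Cexp_neq_0 (z : C) : Cexp z <> 0.
Proof.
  intros H; apply (f_equal Cmod) in H; rewrite Cmod_Cexp, Cmod_0 in H.
  generalize (exp_pos (Re z)); lra.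
Qed.

Lemma Cexp_opp (z : C) : Cexp (- z) = / Cexp z.
Proof.
  assert (H : Cexp z * Cexp (- z) = 1)
    by (rewrite <- Cexp_plus, <- Cexp_0; f_equal; ring).
  transitivity (/ Cexp z * (Cexp z * Cexp (- z))); [field; apply Cexp_neq_0|].
  rewrite H; ring.
Qed.

(** The half-open strip is the range of [Carg]: the sign of sin (Im w), which [Carg] tests, tells on
    which side of 0 the angle lies, and [acos] recovers it up to that sign. *)
Lemma Clog_Cexp (w : C) : (- PI < Im w <= PI)%R -> Clog (Cexp w) = w.
Proof.
  intros H; unfold Clog; rewrite Cmod_Cexp, ln_exp; unfold Carg.
  rewrite Cmod_Cexp; unfold Cexp; simpl.
  generalize (exp_pos (Re w)); intros He.
  replace (exp (Re w) * cos (Im w) / exp (Re w))%R with (cos (Im w)) by (field; lra).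
  apply C_ext; simpl; [reflexivity|].
  destruct (Rle_dec 0 _) as [Hs|Hs].
  - apply acos_cos; split; [|lra].
    destruct (Rle_lt_dec 0 (Im w)); [lra|].
    assert (sin (Im w) < 0)%R by (apply sin_lt_0_var; lra). nra.
  - rewrite <- (cos_neg (Im w)), acos_cos; [ring|].
    split; [|lra].
    destruct (Rle_lt_dec (Im w) 0); [lra|].
    assert (0 <= sin (Im w))%R by (apply sin_ge_0; lra). nra.
Qed.

Lemma Cexp_ln_atan (z : C) : (0 < Re z)%R ->
  Cexp (ln (Cmod z), atan (Im z / Re z)) = z.
Proof.
  intros H.
  assert (Hm : (0 < Cmod z)%R) by (apply Cmod_gt_0, Re_pos_neq_0, H).
  assert (E : (sqrt (1 + (Im z / Re z)²) = Cmod z / Re z)%R).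
  { replace (1 + (Im z / Re z)²)%R with ((Cmod z / Re z) * (Cmod z / Re z))%R.
    - apply sqrt_square, Rlt_le, Rdiv_lt_0_compat; assumption.
    - generalize (Cmod_sqr z); unfold Rsqr; intros H2.
      transitivity (Cmod z ^ 2 / (Re z * Re z))%R; [|rewrite H2]; field; apply Rgt_not_eq, H. }
  unfold Cexp; simpl; rewrite exp_ln, cos_atan, sin_atan, E by assumption.
  apply C_ext; simpl; field; lra.
Qed.

(** On the right half-plane the case split and the [acos] of [Carg] give way to one smooth formula;
    differentiability and continuity of [Clog] are proved from it. *)
Lemma Clog_Re_pos (z : C) : (0 < Re z)%R ->
  Clog z = (ln (Cmod z), atan (Im z / Re z)).
Proof.
  intros H; rewrite <- (Cexp_ln_atan z H) at 1; apply Clog_Cexp; simpl.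
  generalize (atan_bound (Im z / Re z)) PI_RGT_0; lra.
Qed.

Lemma Cexp_Clog (z : C) : (0 < Re z)%R -> Cexp (Clog z) = z.
Proof. intros H; rewrite Clog_Re_pos by assumption; now apply Cexp_ln_atan. Qed.

Lemma Im_Clog_bound (z : C) : (0 < Re z)%R -> (- PI / 2 < Im (Clog z) < PI / 2)%R.
Proof. intros H; rewrite Clog_Re_pos by assumption; apply atan_bound. Qed.

(** Both arguments lie in (-pi/2, pi/2), so their sum stays within the principal branch, even when
    the product leaves the right half-plane. *)
Lemma Clog_mult (z w : C) : (0 < Re z)%R -> (0 < Re w)%R ->
  Clog (z * w) = Clog z + Clog w.
Proof.
  intros Hz Hw.
  rewrite <- (Cexp_Clog z Hz), <- (Cexp_Clog w Hw) at 1.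
  rewrite <- Cexp_plus; apply Clog_Cexp.
  change (- PI < Im (Clog z) + Im (Clog w) <= PI)%R.
  generalize (Im_Clog_bound z Hz) (Im_Clog_bound w Hw); lra.
Qed.

Lemma Clog_div (z w : C) : (0 < Re z)%R -> (0 < Re w)%R ->
  Clog (z / w) = Clog z - Clog w.
Proof.
  intros Hz Hw.
  rewrite <- (Cexp_Clog z Hz), <- (Cexp_Clog w Hw) at 1; unfold Cdiv.
  rewrite <- Cexp_opp, <- Cexp_plus; apply Clog_Cexp.
  change (- PI < Im (Clog z) - Im (Clog w) <= PI)%R.
  generalize (Im_Clog_bound z Hz) (Im_Clog_bound w Hw); lra.
Qed.

Lemma Cpower_plus (z w1 w2 : C) : Cpower z (w1 + w2) = Cpower z w1 * Cpower z w2.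
Proof. unfold Cpower; rewrite <- Cexp_plus; f_equal; ring. Qed.

Lemma Cpower_INR (z : C) (n : nat) : (0 < Re z)%R -> Cpower z (RtoC (INR n)) = z ^ n.
Proof.
  intros H; induction n as [|n IH].
  - unfold Cpower; simpl Cpow; rewrite <- Cexp_0; f_equal; simpl; ring.
  - rewrite S_INR, RtoC_plus, Cpower_plus, IH; simpl Cpow.
    rewrite Cmult_comm; f_equal; unfold Cpower.
    rewrite Cmult_1_l; now apply Cexp_Clog.
Qed.

Lemma Cmod_Cpower (z w : C) :
  Cmod (Cpower z w) = exp (Re w * Re (Clog z) - Im w * Im (Clog z)).
Proof. unfold Cpower; rewrite Cmod_Cexp; reflexivity. Qed.

(** * Complex differentiability *)

Definition path_derive (f : R -> C) (t : R) (d : C) : Prop :=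
  is_derive (fun x => Re (f x)) t (Re d) /\ is_derive (fun x => Im (f x)) t (Im d).

(* Complex differentiability, tested along differentiable paths. *)
Definition holo (phi : C -> C) (z d : C) : Prop :=
  forall (g : R -> C) (t : R) (g' : C),
    path_derive g t g' -> g t = z -> path_derive (fun x => phi (g x)) t (d * g').

Lemma path_derive_eq (f : R -> C) (t : R) (d d' : C) :
  path_derive f t d -> d = d' -> path_derive f t d'.
Proof. now intros H <-. Qed.

Lemma path_derive_ext (f g : R -> C) (t : R) (d : C) :
  (forall x, f x = g x) -> path_derive f t d -> path_derive g t d.
Proof.
  intros E [H1 H2]; split;
    [apply is_derive_ext with (2 := H1)|apply is_derive_ext with (2 := H2)];
    intros x; now rewrite E.
Qed.

Lemma path_derive_const (c : C) (t : R) : path_derive (fun _ => c) t 0.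
Proof. split; simpl; auto_derive; auto. Qed.

Lemma path_derive_plus (f g : R -> C) (t : R) (f' g' : C) :
  path_derive f t f' -> path_derive g t g' ->
  path_derive (fun x => f x + g x) t (f' + g').
Proof.
  intros [F1 F2] [G1 G2]; split; simpl.
  - exact (is_derive_plus _ _ _ _ _ F1 G1).
  - exact (is_derive_plus _ _ _ _ _ F2 G2).
Qed.

Lemma path_derive_opp (f : R -> C) (t : R) (f' : C) :
  path_derive f t f' -> path_derive (fun x => - f x) t (- f').
Proof.
  intros [F1 F2]; split; simpl.
  - exact (is_derive_opp _ _ _ F1).
  - exact (is_derive_opp _ _ _ F2).
Qed.

Lemma path_derive_mult (f g : R -> C) (t : R) (f' g' : C) :
  path_derive f t f' -> path_derive g t g' ->
  path_derive (fun x => f x * g x) t (f' * g t + f t * g').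
Proof.
  intros [F1 F2] [G1 G2].
  assert (M : forall a b a' b', is_derive a t a' -> is_derive b t b' ->
            is_derive (fun x => a x * b x)%R t (a' * b t + a t * b')%R)
    by (intros a b a' b' Ha Hb; exact (is_derive_mult a b t a' b' Ha Hb Rmult_comm)).
  split; simpl.
  - evar_last; [apply @is_derive_minus; apply M; [exact F1|exact G1|exact F2|exact G2]|].
    unfold minus, plus, opp; simpl; unfold Re, Im; ring.
  - evar_last; [apply @is_derive_plus; apply M; [exact F1|exact G2|exact F2|exact G1]|].
    unfold plus; simpl; unfold Re, Im; ring.
Qed.

Lemma path_derive_affine (a b : C) (t : R) : path_derive (fun x => a + RtoC x * b) t b.
Proof. split; simpl; auto_derive; auto; unfold Re, Im; ring. Qed.

Lemma holo_eq (phi : C -> C) (z d d' : C) : holo phi z d -> d = d' -> holo phi z d'.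
Proof. now intros H <-. Qed.

Lemma holo_ext (phi psi : C -> C) (z d : C) :
  (forall w, phi w = psi w) -> holo phi z d -> holo psi z d.
Proof.
  intros E H g t g' Hg Hz; apply path_derive_ext with (2 := H g t g' Hg Hz).
  intros x; apply E.
Qed.

Lemma holo_const (c z : C) : holo (fun _ => c) z 0.
Proof. intros g t g' _ _; apply path_derive_eq with (1 := path_derive_const c t); ring. Qed.

Lemma holo_id (z : C) : holo (fun w => w) z 1.
Proof. intros g t g' H _; apply path_derive_eq with (1 := H); ring. Qed.

Lemma holo_plus (phi psi : C -> C) (z d e : C) :
  holo phi z d -> holo psi z e -> holo (fun w => phi w + psi w) z (d + e).
Proof.
  intros H K g t g' Hg Hz.
  apply path_derive_eq with (1 := path_derive_plus _ _ _ _ _ (H g t g' Hg Hz) (K g t g' Hg Hz)).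
  ring.
Qed.

Lemma holo_opp (phi : C -> C) (z d : C) : holo phi z d -> holo (fun w => - phi w) z (- d).
Proof.
  intros H g t g' Hg Hz.
  apply path_derive_eq with (1 := path_derive_opp _ _ _ (H g t g' Hg Hz)); ring.
Qed.

Lemma holo_mult (phi psi : C -> C) (z d e : C) :
  holo phi z d -> holo psi z e ->
  holo (fun w => phi w * psi w) z (d * psi z + phi z * e).
Proof.
  intros H K g t g' Hg Hz.
  apply path_derive_eq with (1 := path_derive_mult _ _ _ _ _ (H g t g' Hg Hz) (K g t g' Hg Hz)).
  rewrite Hz; ring.
Qed.

Lemma holo_scal (c : C) (phi : C -> C) (z d : C) :
  holo phi z d -> holo (fun w => c * phi w) z (c * d).
Proof.
  intros H; apply holo_eq with (1 := holo_mult _ _ _ _ _ (holo_const c z) H); ring.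
Qed.

Lemma holo_comp (phi psi : C -> C) (z d e : C) :
  holo psi z e -> holo phi (psi z) d -> holo (fun w => phi (psi w)) z (d * e).
Proof.
  intros K H g t g' Hg Hz.
  apply path_derive_eq with (d := d * (e * g')); [|ring].
  apply (H (fun x => psi (g x)) t).
  - now apply K.
  - now rewrite Hz.
Qed.

Lemma holo_Cexp (z : C) : holo Cexp z (Cexp z).
Proof.
  intros g t g' [H1 H2] <-; unfold Cexp.
  set (p := fun x => Re (g x)); set (q := fun x => Im (g x)).
  change (is_derive p t (Re g')) in H1; change (is_derive q t (Im g')) in H2.
  split.
  - apply is_derive_ext with (f := fun x => (exp (p x) * cos (q x))%R); [reflexivity|].
    auto_derive; [repeat split; eexists; eassumption|].
    replace (Derive (fun x : R => p x) t) with (Re g') by (symmetry; now apply is_derive_unique).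
    replace (Derive (fun x : R => q x) t) with (Im g') by (symmetry; now apply is_derive_unique).
    simpl; fold (p t) (q t); unfold p, q, Re, Im; ring.
  - apply is_derive_ext with (f := fun x => (exp (p x) * sin (q x))%R); [reflexivity|].
    auto_derive; [repeat split; eexists; eassumption|].
    replace (Derive (fun x : R => p x) t) with (Re g') by (symmetry; now apply is_derive_unique).
    replace (Derive (fun x : R => q x) t) with (Im g') by (symmetry; now apply is_derive_unique).
    simpl; fold (p t) (q t); unfold p, q, Re, Im; ring.
Qed.

Lemma sqr_sum_neq_0 (z : C) : z <> 0 -> (Re z ^ 2 + Im z ^ 2 <> 0)%R.
Proof.
  intros H E; apply H; apply Cmod_eq_0.
  generalize (Cmod_sqr z) (Cmod_ge_0 z); intros; nra.
Qed.

Lemma holo_Cinv (z : C) : z <> 0 -> holo Cinv z (- / (z * z)).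
Proof.
  intros Hz g t g' [H1 H2] E.
  assert (N := sqr_sum_neq_0 z Hz).
  set (p := fun x => Re (g x)); set (q := fun x => Im (g x)).
  change (is_derive p t (Re g')) in H1; change (is_derive q t (Im g')) in H2.
  assert (Ep : p t = Re z) by (unfold p; now rewrite E).
  assert (Eq : q t = Im z) by (unfold q; now rewrite E).
  rewrite <- Ep, <- Eq in N.
  assert (Ez : z = (p t, q t)) by (apply C_ext; simpl; auto).
  assert (N' : (p t * p t + q t * q t <> 0)%R) by (intros K; apply N; rewrite <- K; ring).
  split.
  - apply is_derive_ext with (f := fun x => (p x / (p x ^ 2 + q x ^ 2))%R); [reflexivity|].
    auto_derive; [repeat split; try (eexists; eassumption); simpl in *; rewrite ?Rmult_1_r in *; assumption|].
    replace (Derive (fun x : R => p x) t) with (Re g') by (symmetry; now apply is_derive_unique).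
    replace (Derive (fun x : R => q x) t) with (Im g') by (symmetry; now apply is_derive_unique).
    rewrite Ez; unfold Cinv; simpl; fold (p t) (q t); unfold Re, Im.
    generalize dependent (p t); intros a **; generalize dependent (q t); intros b **.
    field; repeat split; try (intros K; apply N'; nra).
  - apply is_derive_ext with (f := fun x => (- q x / (p x ^ 2 + q x ^ 2))%R); [reflexivity|].
    auto_derive; [repeat split; try (eexists; eassumption); simpl in *; rewrite ?Rmult_1_r in *; assumption|].
    replace (Derive (fun x : R => p x) t) with (Re g') by (symmetry; now apply is_derive_unique).
    replace (Derive (fun x : R => q x) t) with (Im g') by (symmetry; now apply is_derive_unique).
    rewrite Ez; unfold Cinv; simpl; fold (p t) (q t); unfold Re, Im.
    generalize dependent (p t); intros a **; generalize dependent (q t); intros b **.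
    field; repeat split; try (intros K; apply N'; nra).
Qed.

Lemma path_derive_Re_pos (g : R -> C) (t : R) (g' : C) :
  path_derive g t g' -> (0 < Re (g t))%R -> locally t (fun x => (0 < Re (g x))%R).
Proof.
  intros [H _] Hp.
  assert (K : continuous (fun x => Re (g x)) t)
    by (apply @ex_derive_continuous; eexists; exact H).
  apply (K (fun y => (0 < y)%R)).
  exact (open_gt 0 _ Hp).
Qed.

Lemma holo_Clog (z : C) : (0 < Re z)%R -> holo Clog z (/ z).
Proof.
  intros Hz g t g' Hg E.
  assert (L : locally t (fun x => (0 < Re (g x))%R))
    by (apply path_derive_Re_pos with (1 := Hg); now rewrite E).
  destruct Hg as [H1 H2].
  set (p := fun x => Re (g x)); set (q := fun x => Im (g x)).
  change (is_derive p t (Re g')) in H1; change (is_derive q t (Im g')) in H2.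
  assert (Ep : p t = Re z) by (unfold p; now rewrite E).
  assert (Eq : q t = Im z) by (unfold q; now rewrite E).
  rewrite <- Ep in Hz.
  assert (Ez : z = (p t, q t)) by (apply C_ext; simpl; auto).
  split.
  - apply is_derive_ext_loc with (f := fun x => ln (sqrt (p x ^ 2 + q x ^ 2))).
    + apply filter_imp with (2 := L); intros x Hx; rewrite Clog_Re_pos by assumption.
      reflexivity.
    + assert (N : (0 < p t ^ 2 + q t ^ 2)%R) by nra.
      assert (N' : (0 < sqrt (p t ^ 2 + q t ^ 2))%R) by now apply sqrt_lt_R0.
      auto_derive; simpl in *; rewrite ?Rmult_1_r in *;
        [repeat split; try (eexists; eassumption); assumption|].
      replace (Derive (fun x : R => p x) t) with (Re g') by (symmetry; now apply is_derive_unique).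
      replace (Derive (fun x : R => q x) t) with (Im g') by (symmetry; now apply is_derive_unique).
      rewrite Ez; unfold Cinv; simpl; fold (p t) (q t); unfold Re, Im.
      rewrite ?Rmult_1_r.
      generalize (sqrt_sqrt (p t * p t + q t * q t) (Rlt_le _ _ N)); intros Hs.
      generalize dependent (sqrt (p t * p t + q t * q t)); intros r N' Hs.
      generalize dependent (p t); intros a **; generalize dependent (q t); intros b **.
      (* Multiplying by r^2 clears the square root, because r * r = a^2 + b^2 is at hand. *)
      apply Rmult_eq_reg_r with (r * r)%R; [|nra].
      transitivity (a * fst g' + b * snd g')%R; [field; lra|].
      rewrite Hs; field; nra.
  - apply is_derive_ext_loc with (f := fun x => atan (q x / p x)).
    + apply filter_imp with (2 := L); intros x Hx; rewrite Clog_Re_pos by assumption.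
      reflexivity.
    + auto_derive; [repeat split; try (eexists; eassumption); lra|].
      replace (Derive (fun x : R => p x) t) with (Re g') by (symmetry; now apply is_derive_unique).
      replace (Derive (fun x : R => q x) t) with (Im g') by (symmetry; now apply is_derive_unique).
      rewrite Ez; unfold Cinv; simpl; fold (p t) (q t); unfold Re, Im, Rsqr.
      generalize dependent (p t); intros a **; generalize dependent (q t); intros b **.
      field; repeat split; nra.
Qed.

Lemma holo_Cpower (w z : C) : (0 < Re z)%R ->
  holo (fun y => Cpower y w) z (w * / z * Cpower z w).
Proof.
  intros Hz; unfold Cpower.
  apply holo_eq with (1 := holo_comp Cexp (fun y => w * Clog y) z _ _
    (holo_scal w _ _ _ (holo_Clog z Hz)) (holo_Cexp _)).
  ring.
Qed.

(** The source is an arbitrary uniform space, so the same rules serve continuity in a real parameter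
    and joint continuity on the plane. *)
Definition contC {U : UniformSpace} (f : U -> C) (x : U) : Prop :=
  continuous (fun y => Re (f y)) x /\ continuous (fun y => Im (f y)) x.

Lemma path_derive_contC (f : R -> C) (t : R) (d : C) : path_derive f t d -> contC f t.
Proof.
  intros [H1 H2]; split; apply @ex_derive_continuous; eexists; eassumption.
Qed.

Lemma contC_const {U : UniformSpace} (c : C) (x : U) : contC (fun _ => c) x.
Proof. split; apply continuous_const. Qed.

(* Seeing C as R * R makes continuity in z the joint continuity in (Re z, Im z). *)
Lemma contC_id (z : C) : @contC (prod_UniformSpace R_UniformSpace R_UniformSpace) (fun w => w) z.
Proof. destruct z; split; [apply continuous_fst|apply continuous_snd]. Qed.

Lemma contC_plus {U : UniformSpace} (f g : U -> C) (x : U) :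
  contC f x -> contC g x -> contC (fun y => f y + g y) x.
Proof.
  intros [F1 F2] [G1 G2]; split.
  - exact (@continuous_plus U R_AbsRing R_NormedModule _ _ x F1 G1).
  - exact (@continuous_plus U R_AbsRing R_NormedModule _ _ x F2 G2).
Qed.

Lemma contC_opp {U : UniformSpace} (f : U -> C) (x : U) :
  contC f x -> contC (fun y => - f y) x.
Proof.
  intros [F1 F2]; split.
  - exact (@continuous_opp U R_AbsRing R_NormedModule _ x F1).
  - exact (@continuous_opp U R_AbsRing R_NormedModule _ x F2).
Qed.

Lemma continuous_Rmult {U : UniformSpace} (f g : U -> R) (x : U) :
  continuous f x -> continuous g x -> continuous (fun y => f y * g y)%R x.
Proof. exact (@continuous_mult U R_AbsRing f g x). Qed.

Lemma continuous_sqr_sum {U : UniformSpace} (f g : U -> R) (x : U) :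
  continuous f x -> continuous g x -> continuous (fun y => f y ^ 2 + g y ^ 2)%R x.
Proof.
  intros F G.
  apply continuous_ext with (f := fun y => (f y * f y + g y * g y)%R);
    [intros y; simpl; ring|].
  exact (@continuous_plus U R_AbsRing R_NormedModule _ _ x
    (continuous_Rmult _ _ x F F) (continuous_Rmult _ _ x G G)).
Qed.

Lemma contC_mult {U : UniformSpace} (f g : U -> C) (x : U) :
  contC f x -> contC g x -> contC (fun y => f y * g y) x.
Proof.
  intros [F1 F2] [G1 G2]; split.
  - exact (@continuous_minus U R_AbsRing R_NormedModule _ _ x
      (continuous_Rmult _ _ x F1 G1) (continuous_Rmult _ _ x F2 G2)).
  - exact (@continuous_plus U R_AbsRing R_NormedModule _ _ x
      (continuous_Rmult _ _ x F1 G2) (continuous_Rmult _ _ x F2 G1)).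
Qed.

Lemma continuous_comp_derive {U : UniformSpace} (f : U -> R) (g : R -> R) (x : U) :
  continuous f x -> ex_derive g (f x) -> continuous (fun y => g (f y)) x.
Proof.
  intros Hf Hg; apply (continuous_comp f g x Hf), @ex_derive_continuous, Hg.
Qed.

Lemma contC_Cinv {U : UniformSpace} (f : U -> C) (x : U) :
  contC f x -> f x <> 0 -> contC (fun y => / f y) x.
Proof.
  intros [F1 F2] N.
  assert (D : continuous (fun y => / (Re (f y) ^ 2 + Im (f y) ^ 2))%R x).
  { apply (continuous_comp_derive (fun y => (Re (f y) ^ 2 + Im (f y) ^ 2)%R)).
    - now apply continuous_sqr_sum.
    - auto_derive; now apply sqr_sum_neq_0. }
  split.
  - exact (continuous_Rmult _ _ x F1 D).
  - exact (continuous_Rmult _ _ x (@continuous_opp U R_AbsRing R_NormedModule _ x F2) D).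
Qed.

Lemma contC_Cexp {U : UniformSpace} (f : U -> C) (x : U) :
  contC f x -> contC (fun y => Cexp (f y)) x.
Proof.
  intros [F1 F2].
  split; apply continuous_Rmult;
    [apply (continuous_comp_derive _ exp x F1)|apply (continuous_comp_derive _ cos x F2)
    |apply (continuous_comp_derive _ exp x F1)|apply (continuous_comp_derive _ sin x F2)];
    auto_derive; auto.
Qed.

Lemma contC_Clog {U : UniformSpace} (f : U -> C) (x : U) :
  contC f x -> (0 < Re (f x))%R -> contC (fun y => Clog (f y)) x.
Proof.
  intros [F1 F2] P.
  assert (L : locally x (fun y => (0 < Re (f y))%R))
    by (apply (F1 (fun y => (0 < y)%R)), (open_gt 0 _ P)).
  assert (N : f x <> 0) by (now apply Re_pos_neq_0).
  split.
  - apply continuous_ext_loc with (g := fun y => ln (sqrt (Re (f y) ^ 2 + Im (f y) ^ 2))).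
    + apply filter_imp with (2 := L); intros y Hy; now rewrite Clog_Re_pos.
    + apply (continuous_comp_derive
              (fun y => (Re (f y) ^ 2 + Im (f y) ^ 2)%R) (fun r => ln (sqrt r))).
      * now apply continuous_sqr_sum.
      * assert (0 < Re (f x) ^ 2 + Im (f x) ^ 2)%R by nra.
        auto_derive; repeat split; auto using sqrt_lt_R0.
  - apply continuous_ext_loc with (g := fun y => atan (Im (f y) * / Re (f y))).
    + apply filter_imp with (2 := L); intros y Hy; now rewrite Clog_Re_pos.
    + apply (continuous_comp_derive (fun y => (Im (f y) * / Re (f y))%R) atan).
      * apply continuous_Rmult; [assumption|].
        apply (continuous_comp_derive _ Rinv x F1); auto_derive; lra.
      * auto_derive; auto.
Qed.

Lemma contC_Cpower {U : UniformSpace} (f : U -> C) (w : C) (x : U) :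
  contC f x -> (0 < Re (f x))%R -> contC (fun y => Cpower (f y) w) x.
Proof.
  intros H P; apply contC_Cexp, contC_mult; [apply contC_const|now apply contC_Clog].
Qed.

(** * Cauchy's theorem for rectangles *)

(** Both sides are the double integral of A over the rectangle: the x-derivative of the integral of
    f over y is the integral of A over y, for which B is a primitive. This is one real component of
    Cauchy's theorem. The margin [eps] makes differentiation possible at the edges. *)
Lemma RInt_param_swap (f A B : R -> R -> R) (x1 x2 y1 y2 eps : R) :
  (0 < eps)%R -> (x1 <= x2)%R -> (y1 <= y2)%R ->
  (forall x y, (x1 - eps < x < x2 + eps)%R -> (y1 - eps < y < y2 + eps)%R ->
     is_derive (fun u => f u y) x (A x y) /\ is_derive (fun v => B x v) y (A x y) /\
     continuity_2d_pt A x y /\ continuity_2d_pt B x y /\ continuity_2d_pt f x y) ->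
  (RInt (fun y => f x2 y) y1 y2 - RInt (fun y => f x1 y) y1 y2 =
   RInt (fun x => B x y2 - B x y1) x1 x2)%R.
Proof.
  intros He Hx Hy H.
  assert (slice_y : forall g x y, continuity_2d_pt g x y -> continuous (fun v => g x v) y).
  { intros g x y K; apply continuity_2d_pt_filterlim in K.
    apply (continuous_comp_2 (fun _ => x) (fun v => v) g y);
      [apply continuous_const|apply continuous_id|exact K]. }
  assert (slice_x : forall g x y, continuity_2d_pt g x y -> continuous (fun u => g u y) x).
  { intros g x y K; apply continuity_2d_pt_filterlim in K.
    apply (continuous_comp_2 (fun u => u) (fun _ => y) g x);
      [apply continuous_id|apply continuous_const|exact K]. }
  assert (D : forall x, (x1 - eps < x < x2 + eps)%R ->
    is_derive (fun x0 => RInt (fun y => f x0 y) y1 y2) x (B x y2 - B x y1)%R).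
  { intros x Ix.
    assert (Lx : locally x (fun u => (x1 - eps < u < x2 + eps)%R)).
    { apply filter_and; [apply (open_gt (x1 - eps))|apply (open_lt (x2 + eps))]; apply Ix. }
    assert (Ly : forall y, (y1 <= y <= y2)%R -> locally y (fun u => (y1 - eps < u < y2 + eps)%R)).
    { intros y Iy; apply filter_and; [apply (open_gt (y1 - eps))|apply (open_lt (y2 + eps))]; lra. }
    evar_last.
    - apply is_derive_RInt_param; rewrite ?Rmin_left, ?Rmax_right by assumption.
      + apply filter_imp with (2 := Lx); intros u Iu y Iy.
        exists (A u y); apply H; lra.
      + intros y Iy; apply continuity_2d_pt_ext_loc with (f := A); [|apply H; lra].
        destruct Lx as [d1 L1]; destruct (Ly y Iy) as [d2 L2].
        assert (Hd : (0 < Rmin d1 d2)%R) by (apply Rmin_pos; apply cond_pos).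
        exists (mkposreal _ Hd); simpl; intros u v Hu Hv.
        symmetry; apply is_derive_unique, H.
        * apply L1; change (Rabs (u - x) < d1)%R; eapply Rlt_le_trans; [apply Hu|apply Rmin_l].
        * apply L2; change (Rabs (v - y) < d2)%R; eapply Rlt_le_trans; [apply Hv|apply Rmin_r].
      + apply filter_imp with (2 := Lx); intros u Iu.
        apply @ex_RInt_continuous; rewrite ?Rmin_left, ?Rmax_right by assumption.
        intros y Iy; apply slice_y, H; lra.
    (* The integral of A over y is evaluated through its primitive B. *)
    - rewrite (RInt_ext _ (fun t => A x t)).
      + apply is_RInt_unique, (is_RInt_derive (fun v => B x v) (fun v => A x v));
          rewrite ?Rmin_left, ?Rmax_right by assumption; intros y Iy;
          [|apply slice_y]; apply H; lra.
      + rewrite ?Rmin_left, ?Rmax_right by assumption; intros y Iy.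
        apply is_derive_unique, H; lra. }
  symmetry; apply is_RInt_unique.
  apply (is_RInt_derive (fun x0 => RInt (fun y => f x0 y) y1 y2));
    rewrite ?Rmin_left, ?Rmax_right by assumption; intros x Ix; [apply D; lra|].
  apply (@continuous_minus _ R_AbsRing R_NormedModule (fun u => B u y2) (fun u => B u y1));
    apply slice_x, H; lra.
Qed.

(** * Integrals of complex-valued functions of a real variable *)

Definition CInt (f : R -> C) (a b : R) : C :=
  @RInt C_R_CompleteNormedModule f a b.

Definition is_CInt (f : R -> C) (a b : R) (l : C) : Prop :=
  @is_RInt C_R_NormedModule f a b l.

Lemma is_CInt_unique (f : R -> C) (a b : R) (l : C) : is_CInt f a b l -> CInt f a b = l.
Proof. exact (@is_RInt_unique C_R_CompleteNormedModule f a b l). Qed.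

Lemma is_CInt_Re_Im (f : R -> C) (a b u v : R) :
  is_RInt (fun t => Re (f t)) a b u -> is_RInt (fun t => Im (f t)) a b v ->
  is_CInt f a b (u, v).
Proof. exact (@is_RInt_fct_extend_pair R_NormedModule R_NormedModule f a b u v). Qed.

Lemma is_CInt_Re (f : R -> C) (a b : R) (l : C) :
  is_CInt f a b l -> is_RInt (fun t => Re (f t)) a b (Re l).
Proof. exact (@is_RInt_fct_extend_fst R_NormedModule R_NormedModule f a b l). Qed.

Lemma is_CInt_Im (f : R -> C) (a b : R) (l : C) :
  is_CInt f a b l -> is_RInt (fun t => Im (f t)) a b (Im l).
Proof. exact (@is_RInt_fct_extend_snd R_NormedModule R_NormedModule f a b l). Qed.

Lemma is_CInt_CInt (f : R -> C) (a b : R) :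
  (forall t, (Rmin a b <= t <= Rmax a b)%R -> contC f t) -> is_CInt f a b (CInt f a b).
Proof.
  intros H; apply (@RInt_correct C_R_CompleteNormedModule).
  destruct (ex_RInt_continuous (fun t => Re (f t)) a b) as [u Hu];
    [intros t Ht; apply (H t Ht)|].
  destruct (ex_RInt_continuous (fun t => Im (f t)) a b) as [v Hv];
    [intros t Ht; apply (H t Ht)|].
  exists (u, v); now apply is_CInt_Re_Im.
Qed.

(** The scalar is complex while the integral lives in a real normed module, so linearity is
    assembled from the components. *)
Lemma is_CInt_mult (c : C) (f : R -> C) (a b : R) (l : C) :
  is_CInt f a b l -> is_CInt (fun t => c * f t) a b (c * l).
Proof.
  intros H; assert (H1 := is_CInt_Re _ _ _ _ H); assert (H2 := is_CInt_Im _ _ _ _ H).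
  apply is_CInt_Re_Im.
  - exact (is_RInt_minus _ _ _ _ _ _ (is_RInt_scal _ _ _ (Re c) _ H1)
                                     (is_RInt_scal _ _ _ (Im c) _ H2)).
  - exact (is_RInt_plus _ _ _ _ _ _ (is_RInt_scal _ _ _ (Re c) _ H2)
                                    (is_RInt_scal _ _ _ (Im c) _ H1)).
Qed.

Lemma is_CInt_plus (f g : R -> C) (a b : R) (l m : C) :
  is_CInt f a b l -> is_CInt g a b m -> is_CInt (fun t => f t + g t) a b (l + m).
Proof. exact (@is_RInt_plus C_R_NormedModule f g a b l m). Qed.

Lemma is_CInt_minus (f g : R -> C) (a b : R) (l m : C) :
  is_CInt f a b l -> is_CInt g a b m -> is_CInt (fun t => f t - g t) a b (l - m).
Proof. exact (@is_RInt_minus C_R_NormedModule f g a b l m). Qed.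

Lemma is_CInt_ext (f g : R -> C) (a b : R) (l : C) :
  (forall t, (Rmin a b < t < Rmax a b)%R -> f t = g t) ->
  is_CInt f a b l -> is_CInt g a b l.
Proof. exact (@is_RInt_ext C_R_NormedModule f g a b l). Qed.

Lemma Cmod_CInt_le (f : R -> C) (g : R -> R) (a b : R) (l : C) (m : R) :
  (a <= b)%R -> (forall t, (a <= t <= b)%R -> (Cmod (f t) <= g t)%R) ->
  is_CInt f a b l -> is_RInt g a b m -> (Cmod l <= m)%R.
Proof.
  intros Hab H Hf Hg; rewrite <- norm_C_R.
  apply (@norm_RInt_le C_R_NormedModule f g a b l m Hab); auto.
  intros t Ht; rewrite norm_C_R; now apply H.
Qed.

(** Horizontal and vertical lines as test paths yield the partial derivatives d and d * Ci, that is,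
    the Cauchy-Riemann equations. *)
Lemma holo_partial_x (F : C -> C) (x y : R) (d : C) :
  holo F (x, y) d -> path_derive (fun u => F (u, y)) x d.
Proof.
  intros H; apply path_derive_eq with (d := d * 1); [|ring].
  apply (H (fun u => (u, y))); [|reflexivity].
  split; simpl; auto_derive; auto.
Qed.

Lemma holo_partial_y (F : C -> C) (x y : R) (d : C) :
  holo F (x, y) d -> path_derive (fun v => F (x, v)) y (d * Ci).
Proof.
  intros H; apply (H (fun v => (x, v))); [|reflexivity].
  split; simpl; auto_derive; auto.
Qed.

(** Writing F = u + iv, the relation u_x = v_y feeds [RInt_param_swap] with (u, v) and v_x = - u_y
    feeds it with (v, -u); these are the two components of the identity. *)
Lemma cauchy_rectangle (F F' : C -> C) (x1 x2 y1 y2 eps : R) :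
  (0 < eps)%R -> (x1 <= x2)%R -> (y1 <= y2)%R ->
  (forall z, (x1 - eps < Re z < x2 + eps)%R -> (y1 - eps < Im z < y2 + eps)%R ->
     holo F z (F' z) /\
     @contC (prod_UniformSpace R_UniformSpace R_UniformSpace) F z /\
     @contC (prod_UniformSpace R_UniformSpace R_UniformSpace) F' z) ->
  Ci * (CInt (fun y => F (x2, y)) y1 y2 - CInt (fun y => F (x1, y)) y1 y2) =
  CInt (fun x => F (x, y2)) x1 x2 - CInt (fun x => F (x, y1)) x1 x2.
Proof.
  intros He Hx Hy H.
  assert (C2 : forall (G : C -> R) x y,
    @continuous (prod_UniformSpace R_UniformSpace R_UniformSpace) R_UniformSpace G (x, y) ->
    continuity_2d_pt (fun u v => G (u, v)) x y).
  { intros G x y K; apply continuity_2d_pt_filterlim.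
    apply filterlim_ext with (2 := K); intros [u v]; reflexivity. }
  assert (E1 := RInt_param_swap (fun x y => Re (F (x, y))) (fun x y => Re (F' (x, y)))
                 (fun x y => Im (F (x, y))) x1 x2 y1 y2 eps He Hx Hy).
  assert (E2 := RInt_param_swap (fun x y => Im (F (x, y))) (fun x y => Im (F' (x, y)))
                 (fun x y => - Re (F (x, y)))%R x1 x2 y1 y2 eps He Hx Hy).
  cbv beta in E1, E2.
  assert (cx : forall x y, (x1 <= x <= x2)%R -> (y1 <= y <= y2)%R ->
                 contC (fun u => F (u, y)) x /\ contC (fun v => F (x, v)) y).
  { intros x y Ix Iy; destruct (H (x, y)) as (Hh & _ & _); simpl; try lra.
    split; eapply path_derive_contC.
    - exact (holo_partial_x _ _ _ _ Hh).
    - exact (holo_partial_y _ _ _ _ Hh). }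
  assert (IX : forall y, (y1 <= y <= y2)%R ->
             is_CInt (fun x => F (x, y)) x1 x2 (CInt (fun x => F (x, y)) x1 x2)).
  { intros y Iy; apply is_CInt_CInt; rewrite Rmin_left, Rmax_right by assumption.
    intros x Ix; now apply cx. }
  assert (IY : forall x, (x1 <= x <= x2)%R ->
             is_CInt (fun y => F (x, y)) y1 y2 (CInt (fun y => F (x, y)) y1 y2)).
  { intros x Ix; apply is_CInt_CInt; rewrite Rmin_left, Rmax_right by assumption.
    intros y Iy; now apply cx. }
  assert (IX1 := IX y1 ltac:(lra)); assert (IX2 := IX y2 ltac:(lra)).
  assert (IY1 := IY x1 ltac:(lra)); assert (IY2 := IY x2 ltac:(lra)).
  rewrite (is_RInt_unique _ _ _ _ (is_CInt_Re _ _ _ _ IY1)),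
          (is_RInt_unique _ _ _ _ (is_CInt_Re _ _ _ _ IY2)) in E1.
  rewrite (is_RInt_unique _ _ _ _ (is_CInt_Im _ _ _ _ IY1)),
          (is_RInt_unique _ _ _ _ (is_CInt_Im _ _ _ _ IY2)) in E2.
  set (A1 := CInt (fun x => F (x, y1)) x1 x2) in *.
  set (A2 := CInt (fun x => F (x, y2)) x1 x2) in *.
  set (B1 := CInt (fun y => F (x1, y)) y1 y2) in *.
  set (B2 := CInt (fun y => F (x2, y)) y1 y2) in *.
  assert (J1 : RInt (fun x => Im (F (x, y2)) - Im (F (x, y1)))%R x1 x2 = (Im A2 - Im A1)%R)
    by exact (is_RInt_unique _ _ _ _ (is_RInt_minus _ _ _ _ _ _
                (is_CInt_Im _ _ _ _ IX2) (is_CInt_Im _ _ _ _ IX1))).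
  assert (J2 : RInt (fun x => - Re (F (x, y2)) - - Re (F (x, y1)))%R x1 x2
               = (- Re A2 - - Re A1)%R)
    by exact (is_RInt_unique _ _ _ _ (is_RInt_minus _ _ _ _ _ _
                (is_RInt_opp _ _ _ _ (is_CInt_Re _ _ _ _ IX2))
                (is_RInt_opp _ _ _ _ (is_CInt_Re _ _ _ _ IX1)))).
  rewrite J1 in E1; rewrite J2 in E2.
  assert (K1 : (Re B2 - Re B1 = Im A2 - Im A1)%R).
  { apply E1.
    intros x y Ix Iy; destruct (H (x, y)) as (Hh & [c1 c2] & [c3 c4]); simpl; try lra.
    refine (conj _ (conj _ (conj _ (conj _ _)))).
    - apply (holo_partial_x _ _ _ _ Hh).
    - replace (Re (F' (x, y))) with (Im (F' (x, y) * Ci)) by (simpl; unfold Re, Im; ring).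
      apply (holo_partial_y _ _ _ _ Hh).
    - now apply (C2 (fun z => Re (F' z))).
    - now apply (C2 (fun z => Im (F z))).
    - now apply (C2 (fun z => Re (F z))). }
  assert (K2 : (Im B2 - Im B1 = - Re A2 + Re A1)%R).
  { transitivity (- Re A2 - - Re A1)%R; [apply E2|ring].
    intros x y Ix Iy; destruct (H (x, y)) as (Hh & [c1 c2] & [c3 c4]); simpl; try lra.
    refine (conj _ (conj _ (conj _ (conj _ _)))).
    - apply (holo_partial_x _ _ _ _ Hh).
    - replace (Im (F' (x, y))) with (- Re (F' (x, y) * Ci))%R by (simpl; unfold Re, Im; ring).
      apply (@is_derive_opp R_AbsRing R_NormedModule (fun v => Re (F (x, v)))).
      apply (holo_partial_y _ _ _ _ Hh).
    - now apply (C2 (fun z => Im (F' z))).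
    - apply (C2 (fun z => - Re (F z))%R).
      now apply (@continuous_opp _ R_AbsRing R_NormedModule).
    - now apply (C2 (fun z => Im (F z))). }
  clearbody A1 A2 B1 B2; apply C_ext; simpl; unfold Re, Im in K1, K2; lra.
Qed.

(** * The half residue of phi(z) / sin(pi z) at 0 *)

Lemma MVT_nonneg (f df : R -> R) (a b : R) : (a <= b)%R ->
  (forall x, (a <= x <= b)%R -> is_derive f x (df x)) ->
  (forall x, (a <= x <= b)%R -> (0 <= df x)%R) -> (f a <= f b)%R.
Proof.
  intros Hab Hd Hp.
  destruct (MVT_gen f a b df) as (c & Ic & E);
    rewrite ?Rmin_left, ?Rmax_right by assumption.
  - intros x Hx; apply Hd; lra.
  - intros x Hx; apply continuity_pt_filterlim, @ex_derive_continuous.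
    exists (df x); now apply Hd.
  - rewrite Rmin_left, Rmax_right in Ic by assumption.
    specialize (Hp c Ic); nra.
Qed.

Lemma sinh_ge_id (x : R) : (0 <= x)%R -> (x <= sinh x)%R.
Proof.
  intros Hx.
  enough (0 - 0 <= sinh x - x)%R by lra.
  rewrite <- sinh_0 at 1.
  apply (MVT_nonneg (fun x => sinh x - x)%R (fun x => cosh x - 1)%R); [assumption| |].
  - intros y Hy; unfold sinh, cosh; auto_derive; [auto|field].
  - intros y Hy; unfold cosh; rewrite exp_Ropp.
    assert (E := exp_pos y).
    assert (K : (exp y + / exp y - 2 = (exp y - 1) ^ 2 / exp y)%R) by (field; lra).
    assert (0 <= (exp y - 1) ^ 2 / exp y)%R
      by (apply Rdiv_le_0_compat; [apply pow2_ge_0|assumption]).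
    lra.
Qed.

Lemma sinh_le_double (x : R) : (0 <= x <= 1)%R -> (sinh x <= 2 * x)%R.
Proof.
  intros Hx.
  enough (2 * 0 - sinh 0 <= 2 * x - sinh x)%R by (rewrite sinh_0 in *; lra).
  apply (MVT_nonneg (fun x => 2 * x - sinh x)%R (fun x => 2 - cosh x)%R); [apply Hx| |].
  - intros y Hy; unfold sinh, cosh; auto_derive; [auto|field].
  - intros y Hy; unfold cosh.
    assert (exp y <= 3)%R.
    { apply Rle_trans with (2 := exp_le_3).
      destruct (Req_dec y 1) as [->|]; [lra|left; apply exp_increasing; lra]. }
    assert (exp (- y) <= 1)%R.
    { rewrite <- exp_0. destruct (Req_dec y 0) as [->|].
      - rewrite Ropp_0; lra.
      - left; apply exp_increasing; lra. }
    lra.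
Qed.

Lemma sinh_incr (x y : R) : (x <= y)%R -> (sinh x <= sinh y)%R.
Proof. intros [H| ->]; [left; now apply sinh_lt|lra]. Qed.

Lemma PI_gt_3 : (3 < PI)%R.
Proof. generalize PI2_3_2; lra. Qed.

(** One bound for both ends of (0, oo): the factor t compensates a numerator vanishing at 0, and exp
    t gives decay at infinity. It follows from sinh (2t) = sinh t * (exp t + exp (-t)) and pi >=
    2. *)
Lemma sinh_PI_ge (t : R) : (0 <= t)%R -> (t * exp t <= sinh (PI * t))%R.
Proof.
  intros Ht.
  apply Rle_trans with (sinh (2 * t)); [|apply sinh_incr; generalize PI_gt_3; nra].
  assert (H := sinh_ge_id t Ht); assert (E := exp_pos t).
  replace (sinh (2 * t)) with (sinh t * (exp t + exp (- t)))%R.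
  - assert (0 < exp (- t))%R by apply exp_pos; nra.
  - unfold sinh; replace (2 * t)%R with (t + t)%R by ring.
    rewrite Ropp_plus_distr, !exp_plus, !exp_Ropp; field; lra.
Qed.

Lemma sin_PI_ge (u : R) : (0 <= u <= 1 / 2)%R -> (u <= sin (PI * u))%R.
Proof.
  intros Hu; assert (P3 := PI_gt_3); assert (P4 := PI_4).
  assert (B : (0 <= PI * u <= 2)%R) by nra.
  (* The Taylor bound sin x >= x - x^3/6 is at least x/3 for 0 <= x <= 2, and x/3 >= u because pi >
     3. *)
  destruct (pre_sin_bound (PI * u) 0) as [H _]; [lra|lra|].
  unfold sin_approx, sin_term in H; simpl in H.
  set (x := (PI * u)%R) in *.
  assert (K : (u <= x / 3)%R) by (unfold x; nra).
  apply Rle_trans with (1 := K); apply Rle_trans with (2 := H).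
  assert (x * x <= 4)%R by nra.
  field_simplify; nra.
Qed.

Lemma atan_le_id (x : R) : (0 <= x)%R -> (0 <= atan x <= x)%R.
Proof.
  intros Hx; split.
  - destruct Hx as [H| <-]; [|rewrite atan_0; lra].
    rewrite <- atan_0; left; now apply atan_increasing.
  - enough (0 - atan 0 <= x - atan x)%R by (rewrite atan_0 in *; lra).
    apply (MVT_nonneg (fun x => x - atan x)%R (fun x => 1 - / (1 + x ^ 2))%R); [assumption| |].
    + intros y Hy; auto_derive; [auto|]; unfold Rsqr; field; nra.
    + intros y Hy; assert (/ (1 + y ^ 2) <= / 1)%R by (apply Rinv_le_contravar; nra).
      lra.
Qed.

(* The real MVT is applied to the scalar product of [f] with its increment. *)
Lemma path_MVT_majorant (f f' : R -> C) (m m' : R -> R) (a b : R) : (a <= b)%R ->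
  (forall x, (a <= x <= b)%R -> path_derive f x (f' x)) ->
  (forall x, (a <= x <= b)%R -> is_derive m x (m' x)) ->
  (forall x, (a <= x <= b)%R -> (Cmod (f' x) <= m' x)%R) ->
  (Cmod (f b - f a) <= m b - m a)%R.
Proof.
  intros Hab Hd Hm HL.
  set (w := f b - f a).
  set (g := fun x => (Re w * Re (f x) + Im w * Im (f x))%R).
  assert (G : forall x, (a <= x <= b)%R ->
            is_derive g x (Re w * Re (f' x) + Im w * Im (f' x))%R).
  { intros x Hx; destruct (Hd x Hx) as [D1 D2].
    exact (is_derive_plus _ _ _ _ _ (is_derive_scal _ _ (Re w) _ D1)
                                    (is_derive_scal _ _ (Im w) _ D2)). }
  assert (E : (g b - g a = Cmod w ^ 2)%R).
  { rewrite Cmod_sqr; unfold g, w; simpl; unfold Re, Im; ring. }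
  (* By Cauchy-Schwarz the derivative of g is at most Cmod w * m', so Cmod w * m - g is
     nondecreasing. *)
  assert (B : (g b - g a <= Cmod w * (m b - m a))%R).
  { enough (Cmod w * m a - g a <= Cmod w * m b - g b)%R by lra.
    apply (MVT_nonneg (fun x => Cmod w * m x - g x)%R
             (fun x => Cmod w * m' x - (Re w * Re (f' x) + Im w * Im (f' x)))%R); [assumption| |].
    - intros x Hx.
      exact (is_derive_minus _ _ _ _ _ (is_derive_scal _ _ (Cmod w) _ (Hm x Hx)) (G x Hx)).
    - intros x Hx; specialize (HL x Hx).
      assert (Re w * Re (f' x) + Im w * Im (f' x) <= Cmod w * Cmod (f' x))%R.
      { apply Rle_trans with (Rabs (Re (Cconj w * f' x))).
        - apply Rle_trans with (2 := Rle_abs _); simpl; unfold Re, Im; right; ring.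
        - apply Rle_trans with (1 := Re_le_Cmod _).
          rewrite Cmod_mult, Cmod_conj; apply Rle_refl. }
      assert (0 <= Cmod w)%R by apply Cmod_ge_0; nra. }
  assert (N := Cmod_ge_0 w); destruct N as [N|N].
  - apply Rmult_le_reg_l with (Cmod w); nra.
  - rewrite <- N.
    enough (m a <= m b)%R by lra.
    apply (MVT_nonneg m m'); [assumption|exact Hm|].
    intros x Hx; apply Rle_trans with (2 := HL x Hx), Cmod_ge_0.
Qed.

Lemma path_MVT (f f' : R -> C) (a b L : R) : (a <= b)%R ->
  (forall x, (a <= x <= b)%R -> path_derive f x (f' x)) ->
  (forall x, (a <= x <= b)%R -> (Cmod (f' x) <= L)%R) ->
  (Cmod (f b - f a) <= L * (b - a))%R.
Proof.
  intros Hab Hd HL; rewrite Rmult_minus_distr_l.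
  apply (path_MVT_majorant f f' (fun x => L * x)%R (fun _ => L)); try assumption.
  intros x _; auto_derive; auto; ring.
Qed.

(** sin (pi z) split into components, which makes its modulus a real computation; the exponential
    form proved below serves for differentiation. *)
Definition Csin_pi (z : C) : C :=
  (sin (PI * Re z) * cosh (PI * Im z), cos (PI * Re z) * sinh (PI * Im z))%R.

Definition Ccos_pi (z : C) : C :=
  (cos (PI * Re z) * cosh (PI * Im z), - sin (PI * Re z) * sinh (PI * Im z))%R.

Lemma Cexp_Ci_PI (z : C) :
  Cexp (Ci * PI * z) = (exp (- (PI * Im z)) * cos (PI * Re z),
                        exp (- (PI * Im z)) * sin (PI * Re z))%R.
Proof.
  unfold Cexp.
  replace (Re (Ci * PI * z)) with (- (PI * Im z))%R by (simpl; unfold Re, Im; ring).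
  replace (Im (Ci * PI * z)) with (PI * Re z)%R by (simpl; unfold Re, Im; ring).
  reflexivity.
Qed.

Lemma Cexp_opp_Ci_PI (z : C) :
  Cexp (- (Ci * PI) * z) = (exp (PI * Im z) * cos (PI * Re z),
                            - (exp (PI * Im z) * sin (PI * Re z)))%R.
Proof.
  unfold Cexp.
  replace (Re (- (Ci * PI) * z)) with (PI * Im z)%R by (simpl; unfold Re, Im; ring).
  replace (Im (- (Ci * PI) * z)) with (- (PI * Re z))%R by (simpl; unfold Re, Im; ring).
  rewrite cos_neg, sin_neg; apply C_ext; simpl; ring.
Qed.

Lemma Csin_pi_Cexp (z : C) :
  Csin_pi z = (Cexp (Ci * PI * z) + - Cexp (- (Ci * PI) * z)) * / (2 * Ci).
Proof.
  rewrite Cexp_Ci_PI, Cexp_opp_Ci_PI.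
  replace (/ (2 * Ci)) with (0, - / 2)%R by (apply C_ext; simpl; field).
  unfold Csin_pi, sinh, cosh; apply C_ext; simpl; field.
Qed.

Lemma Ccos_pi_Cexp (z : C) :
  Ccos_pi z = (Cexp (Ci * PI * z) + Cexp (- (Ci * PI) * z)) * / 2.
Proof.
  rewrite Cexp_Ci_PI, Cexp_opp_Ci_PI.
  replace (/ 2) with (/ 2, 0)%R by (apply C_ext; simpl; field).
  unfold Ccos_pi, sinh, cosh; apply C_ext; simpl; field.
Qed.

Lemma holo_Cexp_scal (c z : C) : holo (fun w => Cexp (c * w)) z (c * Cexp (c * z)).
Proof.
  apply holo_eq with (1 := holo_comp Cexp (fun y => c * y) z _ _
    (holo_scal c _ _ _ (holo_id z)) (holo_Cexp _)).
  ring.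
Qed.

Lemma Ci_neq_0 : Ci <> 0.
Proof. intros H; apply (f_equal snd) in H; simpl in H; lra. Qed.

Lemma holo_Csin_pi (z : C) : holo Csin_pi z (PI * Ccos_pi z).
Proof.
  apply holo_ext with (phi := fun z => / (2 * Ci) *
    (Cexp (Ci * PI * z) + - Cexp (- (Ci * PI) * z))).
  { intros w; rewrite Csin_pi_Cexp; ring. }
  apply holo_eq with (1 := holo_scal _ _ _ _ (holo_plus _ _ _ _ _
    (holo_Cexp_scal _ z) (holo_opp _ _ _ (holo_Cexp_scal _ z)))).
  rewrite Ccos_pi_Cexp; field; apply Ci_neq_0.
Qed.

Lemma contC_ext {U : UniformSpace} (f g : U -> C) (x : U) :
  (forall y, f y = g y) -> contC f x -> contC g x.
Proof.
  intros E [F1 F2]; split;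
    [apply continuous_ext with (2 := F1)|apply continuous_ext with (2 := F2)];
    intros y; now rewrite E.
Qed.

Lemma contC_Csin_pi (z : C) :
  @contC (prod_UniformSpace R_UniformSpace R_UniformSpace) Csin_pi z.
Proof.
  eapply contC_ext; [intros y; symmetry; apply Csin_pi_Cexp|].
  apply contC_mult; [|apply contC_const].
  apply contC_plus; [|apply contC_opp]; apply contC_Cexp, contC_mult;
    first [apply contC_const|apply contC_id].
Qed.

Lemma contC_Ccos_pi (z : C) :
  @contC (prod_UniformSpace R_UniformSpace R_UniformSpace) Ccos_pi z.
Proof.
  eapply contC_ext; [intros y; symmetry; apply Ccos_pi_Cexp|].
  apply contC_mult; [|apply contC_const].
  apply contC_plus; apply contC_Cexp, contC_mult;
    first [apply contC_const|apply contC_id].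
Qed.

Lemma Cmod_Csin_pi_sqr (z : C) :
  (Cmod (Csin_pi z) ^ 2 = sin (PI * Re z) ^ 2 + sinh (PI * Im z) ^ 2)%R.
Proof.
  rewrite Cmod_sqr; unfold Csin_pi; simpl.
  assert (C1 : (cosh (PI * Im z) * cosh (PI * Im z) = 1 + sinh (PI * Im z) * sinh (PI * Im z))%R).
  { unfold cosh, sinh; rewrite exp_Ropp; field; apply Rgt_not_eq, exp_pos. }
  generalize (sin2_cos2 (PI * Re z)); unfold Rsqr; intros S.
  transitivity (sin (PI * Re z) * sin (PI * Re z) * (cosh (PI * Im z) * cosh (PI * Im z))
    + cos (PI * Re z) * cos (PI * Re z) * (sinh (PI * Im z) * sinh (PI * Im z)))%R; [ring|].
  rewrite C1.
  replace (cos (PI * Re z) * cos (PI * Re z))%R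
    with (1 - sin (PI * Re z) * sin (PI * Re z))%R by (rewrite <- S; ring).
  ring.
Qed.

Lemma Cmod_Csin_pi_ge (z : C) : (Rabs (sinh (PI * Im z)) <= Cmod (Csin_pi z))%R.
Proof.
  apply Rsqr_incr_0_var; [|apply Cmod_ge_0].
  rewrite <- Rsqr_abs; unfold Rsqr.
  generalize (Cmod_Csin_pi_sqr z); nra.
Qed.

Lemma Csin_pi_neq_0 (z : C) : Im z <> 0%R -> Csin_pi z <> 0.
Proof.
  intros H E; assert (K := Cmod_Csin_pi_ge z); rewrite E, Cmod_0 in K.
  enough (0 < Rabs (sinh (PI * Im z)))%R by lra.
  apply Rabs_pos_lt; intros S; apply H.
  rewrite <- sinh_0 in S.
  destruct (Rtotal_order (Im z) 0) as [I|[I|I]]; [|assumption|]; exfalso.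
  - assert (sinh (PI * Im z) < sinh 0)%R by (apply sinh_lt; generalize PI_RGT_0; nra); lra.
  - assert (sinh 0 < sinh (PI * Im z))%R by (apply sinh_lt; generalize PI_RGT_0; nra); lra.
Qed.

(** With [Cmod_Csin_pi_sqr], this bounds |sin (pi z)| below by a multiple of u + d, which is
    comparable to the distance to the pole. The two terms dominate u^2 and d^2, and u^2 + d^2 >= (u
    + d)^2 / 2. *)
Lemma Csin_pi_sqr_ge (u d : R) : (0 <= u <= 1 / 2)%R -> (0 < d)%R ->
  ((u + d) ^ 2 / 2 <= sin (PI * u) ^ 2 + sinh (PI * d) ^ 2)%R.
Proof.
  intros Hu Hd.
  assert (S1 := sin_PI_ge u Hu).
  assert (S2 : (d <= sinh (PI * d))%R).
  { apply Rle_trans with (PI * d)%R; [generalize PI_gt_3; nra|].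
    apply sinh_ge_id; generalize PI_gt_3; nra. }
  assert (u ^ 2 <= sin (PI * u) ^ 2)%R by (apply pow_incr; lra).
  assert (d ^ 2 <= sinh (PI * d) ^ 2)%R by (apply pow_incr; lra).
  generalize (pow2_ge_0 (u - d)); lra.
Qed.

(** The substitution v = sin (pi u) turns the integrand into a Poisson kernel in v, with primitive
    (2 / pi) atan (v / S). *)
Lemma is_RInt_Poisson (S : R) : (0 < S)%R ->
  is_RInt (fun u => 2 * cos (PI * u) * S / (sin (PI * u) ^ 2 + S ^ 2))%R 0 (1 / 2)
    (2 / PI * atan (/ S))%R.
Proof.
  intros HS.
  set (g := fun u => (2 / PI * atan (sin (PI * u) / S))%R).
  replace (2 / PI * atan (/ S))%R with (g (1 / 2) - g 0)%R.
  - apply (is_RInt_derive g).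
    + intros u _; unfold g.
      assert (0 <= sin (PI * u) ^ 2)%R by apply pow2_ge_0.
      auto_derive; [lra|]; unfold Rsqr; generalize PI_RGT_0; intros.
      field; repeat split; nra.
    + intros u _; apply @ex_derive_continuous; auto_derive.
      assert (0 <= sin (PI * u) ^ 2)%R by apply pow2_ge_0; nra.
  - unfold g; replace (PI * (1 / 2))%R with (PI / 2)%R by field.
    rewrite sin_PI2, Rmult_0_r, sin_0.
    replace (0 / S)%R with 0%R by (field; lra); rewrite atan_0.
    replace (1 / S)%R with (/ S)%R by (field; lra); ring.
Qed.

Lemma is_RInt_inv_sqrt (d c : R) : (0 < d)%R ->
  is_RInt (fun u => c / sqrt (u + d))%R 0 (1 / 2) (2 * c * (sqrt (1 / 2 + d) - sqrt d))%R.
Proof.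
  intros Hd.
  set (g := fun u => (2 * c * sqrt (u + d))%R).
  replace (2 * c * (sqrt (1 / 2 + d) - sqrt d))%R with (g (1 / 2) - g 0)%R
    by (unfold g; rewrite Rplus_0_l; ring).
  apply (is_RInt_derive g); rewrite ?Rmin_left, ?Rmax_right by lra; intros u Hu.
  - unfold g; assert (0 < sqrt (u + d))%R by (apply sqrt_lt_R0; lra).
    auto_derive; [lra|]; field; lra.
  - apply @ex_derive_continuous; auto_derive; split; [lra|split; [|auto]].
    apply Rgt_not_eq, sqrt_lt_R0; lra.
Qed.

(* The singular part of [1 / sin (pi z)] on the two sides of the real axis is a Poisson
   kernel of total mass 2 on the real line; only half of it is seen by [0, 1/2]. *)
Lemma half_residue (phi : C -> C) (L B d : R) (l : C) :
  (0 < d <= 1 / 4)%R ->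
  (forall u, (0 <= u <= 1 / 2)%R ->
     (Cmod (phi (u, d) - phi (u, - d)%R) <= L * (2 * d))%R /\
     (Cmod (phi (u, - d)%R - phi 0) <= L * (u + d))%R) ->
  (Cmod (phi 0) <= B)%R ->
  is_CInt (fun u => phi (u, d) * / Csin_pi (u, d)
                    - phi (u, - d)%R * / Csin_pi (u, - d)%R) 0 (1 / 2) l ->
  (Cmod (l + Ci * phi 0) <= (70 * L + 8 * B) * sqrt d)%R.
Proof.
  intros Hd HL HB Hl.
  set (S := sinh (PI * d)).
  assert (P3 := PI_gt_3); assert (P4 := PI_4).
  assert (HS1 : (d <= S)%R).
  { apply Rle_trans with (PI * d)%R; [nra|apply sinh_ge_id; nra]. }
  (* Since d <= 1/4 and pi <= 4, the argument pi d is at most 1, as [sinh_le_double] requires. *)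
  assert (HS2 : (S <= 8 * d)%R).
  { apply Rle_trans with (2 * (PI * d))%R; [apply sinh_le_double; nra|nra]. }
  assert (L0 : (0 <= L)%R).
  { destruct (HL 0%R ltac:(lra)) as [H _].
    assert (K := Cmod_ge_0 (phi (0%R, d) - phi (0%R, (- d)%R))); nra. }
  assert (B0 : (0 <= B)%R) by (apply Rle_trans with (2 := HB), Cmod_ge_0).
  set (r := sqrt d).
  assert (Hr : (0 < r)%R) by (apply sqrt_lt_R0; lra).
  assert (Hrr : (r * r = d)%R) by (apply sqrt_sqrt; lra).
  assert (Hr1 : (r <= 1)%R) by nra.
  (* The points u + id and u - id are conjugate, so the reciprocals of their sines differ by a
     purely imaginary number, which is the kernel of [is_RInt_Poisson]. *)
  set (k := fun u => 0 - Ci * RtoC (2 * cos (PI * u) * S / (sin (PI * u) ^ 2 + S ^ 2))).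
  assert (Hk : forall u, (0 <= u <= 1 / 2)%R ->
            / Csin_pi (u, d) - / Csin_pi (u, - d)%R = k u).
  { intros u Hu.
    assert (N1 := Cmod_Csin_pi_sqr (u, d)); assert (N2 := Cmod_Csin_pi_sqr (u, - d)%R).
    rewrite Cmod_sqr in N1, N2; simpl in N1, N2.
    replace (PI * - d)%R with (- (PI * d))%R in N2 by ring.
    assert (Q : (sinh (- (PI * d)) = - S)%R)
      by (unfold S, sinh; rewrite Ropp_involutive; field).
    assert (Q' : cosh (- (PI * d)) = cosh (PI * d))
      by (unfold cosh; rewrite Ropp_involutive; field).
    unfold Cinv, k, Csin_pi.
    apply C_ext; simpl; unfold Re, Im in *; simpl in *;
      replace (PI * - d)%R with (- (PI * d))%R in * by ring;
      rewrite ?N1, ?N2, ?Q, ?Q'; fold S.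
    - replace (- S * (- S * 1))%R with (S * (S * 1))%R by ring; unfold Rdiv; ring.
    - replace (- S * (- S * 1))%R with (S * (S * 1))%R by ring.
      unfold Rdiv; ring. }
  assert (Ik : is_CInt k 0 (1 / 2) (0 - Ci * RtoC (2 / PI * atan (/ S)))).
  { apply is_CInt_minus.
    - replace (RtoC 0) with ((0, 0)%R : C) by reflexivity.
      apply is_CInt_Re_Im; simpl; evar_last; try apply @is_RInt_const;
        unfold scal; simpl; unfold mult; simpl; ring.
    - apply is_CInt_mult, is_CInt_Re_Im; simpl.
      + apply is_RInt_Poisson; lra.
      + evar_last; [apply @is_RInt_const|]; unfold scal; simpl; unfold mult; simpl; ring. }
  assert (Il : is_CInt (fun u =>
     (phi (u, d) * / Csin_pi (u, d) - phi (u, - d)%R * / Csin_pi (u, - d)%R) - phi 0 * k u)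
     0 (1 / 2) (l - phi 0 * (0 - Ci * RtoC (2 / PI * atan (/ S)))))
    by (apply is_CInt_minus; [exact Hl|apply is_CInt_mult; exact Ik]).
  (* The integrand is at most 35 L d / (u + d): the variation of phi across the axis gives 2 * 3/2 =
     3, its variation from 0 against the kernel gives 32. Integrating c / sqrt (u + d) doubles 35 to
     70. *)
  assert (E1 : (Cmod (l - phi 0 * (0 - Ci * RtoC (2 / PI * atan (/ S)))) <= 70 * L * r)%R).
  { apply Rle_trans with (2 * (35 * L * r) * (sqrt (1 / 2 + d) - sqrt d))%R.
    - apply (Cmod_CInt_le _ (fun u => 35 * L * r / sqrt (u + d))%R 0 (1 / 2)) with (3 := Il);
        [lra| |apply is_RInt_inv_sqrt; lra].
      intros u Hu; rewrite <- (Hk u Hu).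
      destruct (HL u Hu) as [H1 H2].
      replace (_ - _ - _) with
        ((phi (u, d) - phi (u, - d)%R) * / Csin_pi (u, d)
         + (phi (u, - d)%R - phi 0) * (/ Csin_pi (u, d) - / Csin_pi (u, - d)%R)) by ring.
      assert (Dg := Csin_pi_sqr_ge u d Hu ltac:(lra)); fold S in Dg.
      assert (M1 : (Cmod (/ Csin_pi (u, d)) <= 3 / 2 / (u + d))%R).
      { rewrite Cmod_inv by (apply Csin_pi_neq_0; simpl; lra).
        assert (N1 := Cmod_Csin_pi_sqr (u, d)); simpl Re in N1; simpl Im in N1; fold S in N1.
        (* 2/3 is a rational lower bound for 1 / sqrt 2. *)
        assert (K : (2 / 3 * (u + d) <= Cmod (Csin_pi (u, d)))%R)
          by (apply Rsqr_incr_0_var; [unfold Rsqr; nra|apply Cmod_ge_0]).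
        replace (3 / 2 / (u + d))%R with (/ (2 / 3 * (u + d)))%R by (field; lra).
        apply Rinv_le_contravar; lra. }
      assert (M2 : (Cmod (/ Csin_pi (u, d) - / Csin_pi (u, - d)%R) <= 32 * d / (u + d) ^ 2)%R).
      { rewrite (Hk u Hu); unfold k.
        replace (0 - Ci * _) with (- (Ci * RtoC (2 * cos (PI * u) * S / (sin (PI * u) ^ 2 + S ^ 2))))
          by ring.
        rewrite Cmod_opp, Cmod_mult, Cmod_Ci, Cmod_R, Rmult_1_l.
        assert (D0 : (0 < (u + d) ^ 2 / 2)%R) by nra.
        unfold Rdiv at 1; rewrite Rabs_mult, (Rabs_pos_eq (/ _))
          by (left; apply Rinv_0_lt_compat; lra).
        apply Rle_trans with (16 * d * / ((u + d) ^ 2 / 2))%R; [|right; field; lra].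
        apply Rmult_le_compat; [apply Rabs_pos|left; apply Rinv_0_lt_compat; lra| |
          apply Rinv_le_contravar; lra].
        rewrite !Rabs_mult, (Rabs_pos_eq 2), (Rabs_pos_eq S) by lra.
        assert (Rabs (cos (PI * u)) <= 1)%R by (apply Rabs_le, COS_bound).
        assert (0 <= Rabs (cos (PI * u)))%R by apply Rabs_pos.
        nra. }
      eapply Rle_trans; [apply Cmod_triangle|]; rewrite !Cmod_mult.
      apply Rle_trans with (L * (2 * d) * (3 / 2 / (u + d)) + L * (u + d) * (32 * d / (u + d) ^ 2))%R.
      { apply Rplus_le_compat; apply Rmult_le_compat; auto using Cmod_ge_0. }
      replace (_ + _)%R with (35 * L * (d / (u + d)))%R by (field; lra).
      unfold Rdiv at 2; rewrite (Rmult_assoc (35 * L)); apply Rmult_le_compat_l; [nra|].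
      (* Weakening d / (u + d) to sqrt d / sqrt (u + d) avoids a logarithm in the integral and still
         leaves a factor that tends to 0 with d. *)
      set (q := sqrt (u + d)).
      assert (Hq : (r <= q)%R) by (apply sqrt_le_1_alt; lra).
      assert (Hqq : (q * q = u + d)%R) by (apply sqrt_sqrt; lra).
      rewrite <- Hqq, <- Hrr.
      replace (r * r / (q * q))%R with (r * / q * (r / q))%R by (field; lra).
      rewrite <- (Rmult_1_r (r * / q)) at 2.
      apply Rmult_le_compat_l.
      + left; apply Rmult_lt_0_compat; [assumption|apply Rinv_0_lt_compat; lra].
      + apply Rmult_le_reg_r with q; [lra|]; unfold Rdiv.
        rewrite Rmult_assoc, Rinv_l by lra; lra.
    - assert (sqrt (1 / 2 + d) <= 1)%R
        by (apply Rle_trans with (sqrt 1); [apply sqrt_le_1_alt|rewrite sqrt_1]; lra).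
      fold r; assert (0 <= 35 * L * r)%R by nra; nra. }
  (* The kernel has mass (2 / pi) atan (1 / S) = 1 - (2 / pi) atan S on [0, 1/2]. The defect is at
     most S <= 8 d <= 8 sqrt d, whence the term 8 B. *)
  replace (l + Ci * phi 0) with
    ((l - phi 0 * (0 - Ci * RtoC (2 / PI * atan (/ S)))) + Ci * phi 0 * RtoC (2 / PI * atan S)).
  - eapply Rle_trans; [apply Cmod_triangle|].
    rewrite Rmult_plus_distr_r; apply Rplus_le_compat; [exact E1|].
    rewrite !Cmod_mult, Cmod_Ci, Cmod_R, Rmult_1_l.
    destruct (atan_le_id S ltac:(lra)) as [A1 A2].
    assert (Q : (0 <= 2 / PI <= 1)%R).
    { split; [apply Rdiv_le_0_compat; lra|].
      apply Rmult_le_reg_r with PI; [lra|].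
      unfold Rdiv; rewrite Rmult_assoc, Rinv_l; lra. }
    rewrite Rabs_pos_eq by nra.
    assert (d <= r)%R by nra.
    apply Rle_trans with (B * (8 * r))%R; [|fold r; lra].
    assert (Q1 : (2 / PI * atan S <= 1 * (8 * r))%R)
      by (apply Rmult_le_compat; lra).
    apply Rmult_le_compat; [apply Cmod_ge_0|nra|assumption|lra].
  - rewrite atan_inv by lra.
    replace (2 / PI * atan S)%R with (1 - 2 / PI * (PI / 2 - atan S))%R by (field; lra).
    rewrite RtoC_minus; ring.
Qed.

(* For real a, s and psi t = (a + i t)^(-s) this is
   sin (s atan (t / a)) / ((a^2 + t^2)^(s / 2) sinh (pi t)). *)
Definition odd_kernel (psi : R -> C) (t : R) : C :=
  (psi (- t)%R - psi t) * / (2 * Ci * RtoC (sinh (PI * t))).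

(** * Cauchy's theorem on the truncated half strip *)

Lemma is_CInt_reflect (f : R -> C) (a b : R) (l : C) :
  is_CInt f (- b) (- a) l -> is_CInt (fun t => f (- t)%R) a b l.
Proof.
  intros H.
  apply (@is_RInt_swap C_R_NormedModule) in H.
  apply (@is_RInt_comp_opp C_R_NormedModule), (@is_RInt_opp C_R_NormedModule) in H.
  rewrite (@opp_opp C_R_NormedModule) in H.
  revert H; apply is_CInt_ext; intros t _.
  apply (@opp_opp C_R_NormedModule).
Qed.

Lemma sinh_pos (x : R) : (0 < x)%R -> (0 < sinh x)%R.
Proof. intros H; apply Rlt_le_trans with (1 := H), sinh_ge_id; lra. Qed.

Lemma sinh_opp (x : R) : sinh (- x) = (- sinh x)%R.
Proof. unfold sinh; rewrite Ropp_involutive; field. Qed.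

Lemma cosh_opp (x : R) : cosh (- x) = cosh x.
Proof. unfold cosh; rewrite Ropp_involutive; field. Qed.

Lemma Csin_pi_half (y : R) : Csin_pi ((1 / 2)%R, y) = RtoC (cosh (PI * y)).
Proof.
  unfold Csin_pi; simpl; replace (PI * (1 / 2))%R with (PI / 2)%R by field.
  rewrite sin_PI2, cos_PI2; apply C_ext; simpl; ring.
Qed.

Lemma Csin_pi_imaginary (y : R) : Csin_pi (0%R, y) = Ci * RtoC (sinh (PI * y)).
Proof.
  unfold Csin_pi; simpl; rewrite Rmult_0_r, sin_0, cos_0; apply C_ext; simpl; ring.
Qed.

(** Cauchy's theorem is applied above and below the real axis. The sine is cosh (pi y) on Re z = 1/2
    and i sinh (pi y) on Re z = 0, where the two pieces combine into the odd kernel. The sides at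
    height d and -d give the half residue, and those at T and -T are small because |sin (pi z)| >=
    exp T there. *)
Lemma half_strip (phi phi' : C -> C) (L B eps d T : R) :
  (0 < eps)%R ->
  (forall z, (- eps < Re z < 1 / 2 + eps)%R ->
     holo phi z (phi' z) /\
     @contC (prod_UniformSpace R_UniformSpace R_UniformSpace) phi z /\
     @contC (prod_UniformSpace R_UniformSpace R_UniformSpace) phi' z) ->
  (forall z, (0 <= Re z <= 1 / 2)%R -> (Cmod (phi z) <= B)%R /\ (Cmod (phi' z) <= L)%R) ->
  (0 < d <= 1 / 4)%R -> (1 <= T)%R ->
  (Cmod (CInt (fun y => ((phi ((1 / 2)%R, y) + phi ((1 / 2)%R, (- y)%R))
                        * / RtoC (cosh (PI * y)))%C) d T
         + 2 * CInt (odd_kernel (fun t => phi (0%R, t))) d T - phi 0)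
   <= (70 * L + 8 * B) * sqrt d + B * exp (- T))%R.
Proof.
  intros He Hphi Hb Hd HT.
  set (F := fun z => phi z * / Csin_pi z).
  set (F' := fun z => phi' z * / Csin_pi z
               + phi z * (- / (Csin_pi z * Csin_pi z) * (PI * Ccos_pi z))).
  assert (HF : forall z, (- eps < Re z < 1 / 2 + eps)%R -> Im z <> 0%R ->
     holo F z (F' z) /\
     @contC (prod_UniformSpace R_UniformSpace R_UniformSpace) F z /\
     @contC (prod_UniformSpace R_UniformSpace R_UniformSpace) F' z).
  { intros z Hz Iz; destruct (Hphi z Hz) as (H1 & H2 & H3).
    assert (N := Csin_pi_neq_0 z Iz).
    split; [|split].
    - apply (holo_mult phi (fun w => / Csin_pi w)); [assumption|].
      apply (holo_comp Cinv Csin_pi z _ _ (holo_Csin_pi z) (holo_Cinv _ N)).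
    - apply (contC_mult phi); [assumption|]; apply contC_Cinv; [apply contC_Csin_pi|assumption].
    - apply contC_plus; apply contC_mult; try assumption.
      + apply contC_Cinv; [apply contC_Csin_pi|assumption].
      + apply contC_mult.
        * apply contC_opp, contC_Cinv; [apply contC_mult; apply contC_Csin_pi|].
          now apply Cmult_neq_0.
        * apply contC_mult; [apply contC_const|apply contC_Ccos_pi]. }
  (* The cap d/2 keeps the enlarged rectangles away from the real axis, where the sine can
     vanish. *)
  set (e := Rmin eps (d / 2)).
  assert (e0 : (0 < e)%R) by (apply Rmin_pos; lra).
  assert (e1 : (e <= eps)%R) by apply Rmin_l.
  assert (e2 : (e <= d / 2)%R) by apply Rmin_r.
  assert (C1 := cauchy_rectangle F F' 0 (1 / 2) d T e e0 ltac:(lra) ltac:(lra)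
                  ltac:(intros z Z1 Z2; apply HF; lra)).
  assert (C2 := cauchy_rectangle F F' 0 (1 / 2) (- T) (- d) e e0 ltac:(lra) ltac:(lra)
                  ltac:(intros z Z1 Z2; apply HF; lra)).
  assert (IX : forall y, y <> 0%R ->
            is_CInt (fun x => F (x, y)) 0 (1 / 2) (CInt (fun x => F (x, y)) 0 (1 / 2))).
  { intros y Hy; apply is_CInt_CInt; rewrite Rmin_left, Rmax_right by lra; intros x Hx.
    apply path_derive_contC with (d := F' (x, y)), holo_partial_x, HF; simpl; lra. }
  assert (IY : forall x a b, (0 <= x <= 1 / 2)%R -> (a <= b)%R -> (0 < a \/ b < 0)%R ->
            is_CInt (fun y => F (x, y)) a b (CInt (fun y => F (x, y)) a b)).
  { intros x a b Hx Hab Hs; apply is_CInt_CInt; rewrite Rmin_left, Rmax_right by lra.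
    intros y Hy.
    apply path_derive_contC with (d := F' (x, y) * Ci), holo_partial_y, HF; simpl; lra. }
  assert (P2 := fun x Hx => is_CInt_plus _ _ _ _ _ _ (IY x d T Hx ltac:(lra) ltac:(lra))
      (is_CInt_reflect _ _ _ _ (IY x (- T) (- d) Hx ltac:(lra) ltac:(lra))%R)).
  assert (G1 : CInt (fun y => (phi ((1 / 2)%R, y) + phi ((1 / 2)%R, (- y)%R))
                        * / RtoC (cosh (PI * y))) d T
    = CInt (fun y => F ((1 / 2)%R, y)) d T + CInt (fun y => F ((1 / 2)%R, y)) (- T) (- d)).
  { apply is_CInt_unique.
    apply is_CInt_ext with (2 := P2 (1 / 2)%R ltac:(lra)).
    intros t Ht; unfold F; rewrite !Csin_pi_half.
    replace (PI * - t)%R with (- (PI * t))%R by ring; rewrite cosh_opp; ring. }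
  assert (G2 : 2 * CInt (odd_kernel (fun t => phi (0%R, t))) d T
    = - (CInt (fun y => F (0%R, y)) d T + CInt (fun y => F (0%R, y)) (- T) (- d))).
  { replace (CInt (odd_kernel _) d T) with
      (- / 2 * (CInt (fun y => F (0%R, y)) d T + CInt (fun y => F (0%R, y)) (- T) (- d)));
      [field|].
    symmetry; apply is_CInt_unique.
    apply is_CInt_ext with (2 := is_CInt_mult (- / 2) _ _ _ _ (P2 0%R ltac:(lra))).
    rewrite Rmin_left, Rmax_right by lra; intros t Ht.
    unfold F, odd_kernel; rewrite !Csin_pi_imaginary.
    replace (PI * - t)%R with (- (PI * t))%R by ring.
    rewrite sinh_opp, RtoC_opp.
    assert (RtoC (sinh (PI * t)) <> 0).
    { intros K; apply RtoC_inj in K.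
      assert (0 < sinh (PI * t))%R by (apply sinh_pos; generalize PI_RGT_0; nra); lra. }
    field; repeat split; auto using Ci_neq_0. }
  rewrite G1, G2.
  set (A1 := CInt (fun y => F ((1 / 2)%R, y)) d T) in *.
  set (A2 := CInt (fun y => F ((1 / 2)%R, y)) (- T) (- d)) in *.
  set (A3 := CInt (fun y => F (0%R, y)) d T) in *.
  set (A4 := CInt (fun y => F (0%R, y)) (- T) (- d)) in *.
  set (T1 := CInt (fun x => F (x, T)) 0 (1 / 2)) in *.
  set (T2 := CInt (fun x => F (x, (- T)%R)) 0 (1 / 2)) in *.
  set (D1 := CInt (fun x => F (x, d)) 0 (1 / 2)) in *.
  set (D2 := CInt (fun x => F (x, (- d)%R)) 0 (1 / 2)) in *.
  (* Multiplication by i leaves the modulus unchanged and brings the vertical integrals into the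
     form in which [C1] and [C2] replace them by horizontal ones. *)
  rewrite <- (Rmult_1_l (Cmod _)), <- Cmod_Ci, <- Cmod_mult.
  replace (Ci * _) with (T1 - T2 - (D1 - D2 + Ci * phi 0)).
  2:{ transitivity ((Ci * (A1 - A3) + Ci * (A2 - A4)) - Ci * phi 0); [rewrite C1, C2|]; ring. }
  assert (top : forall y, (y = T \/ y = - T)%R ->
     (Cmod (CInt (fun x => F (x, y)) 0 (1 / 2)) <= B * exp (- T) / 2)%R).
  { intros y Hy.
    apply (Cmod_CInt_le _ (fun _ => B * exp (- T))%R 0 (1 / 2) _ _) with (3 := IX y ltac:(lra));
      [lra| |evar_last; [apply @is_RInt_const|unfold scal; simpl; unfold mult; simpl; field]].
    intros x Hx; unfold F; rewrite Cmod_mult.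
    destruct (Hb (x, y) Hx) as [Hb1 _].
    rewrite Cmod_inv by (apply Csin_pi_neq_0; simpl; lra).
    assert (K := Cmod_Csin_pi_ge (x, y)); simpl Im in K.
    assert (K2 : (exp T <= Rabs (sinh (PI * y)))%R).
    { assert (K3 : (exp T <= sinh (PI * T))%R).
      { apply Rle_trans with (2 := sinh_PI_ge T ltac:(lra)); generalize (exp_pos T); nra. }
      apply Rle_trans with (1 := K3).
      destruct Hy as [-> | ->]; [apply Rle_abs|].
      replace (PI * - T)%R with (- (PI * T))%R by ring.
      rewrite sinh_opp, Rabs_Ropp; apply Rle_abs. }
    rewrite exp_Ropp.
    apply Rmult_le_compat; [apply Cmod_ge_0| |assumption|].
    - left; apply Rinv_0_lt_compat; generalize (exp_pos T); lra.
    - apply Rinv_le_contravar; [apply exp_pos|lra]. }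
  assert (R1 : (Cmod (D1 - D2 + Ci * phi 0) <= (70 * L + 8 * B) * sqrt d)%R).
  { apply half_residue; [assumption| | |].
    - intros u Hu; split.
      + replace (2 * d)%R with (d - - d)%R by ring.
        apply (path_MVT (fun y => phi (u, y)) (fun y => phi' (u, y) * Ci)); [lra| |].
        * intros y Hy; apply holo_partial_y, Hphi; simpl; lra.
        * intros y Hy; rewrite Cmod_mult, Cmod_Ci, Rmult_1_r; apply Hb; simpl; lra.
      (* From 0 to u - id the path goes down to -id and then right, so its length is d + u. *)
      + replace (phi (u, (- d)%R) - phi 0) with
          (- ((phi 0 - phi (0%R, (- d)%R)) - (phi (u, (- d)%R) - phi (0%R, (- d)%R)))) by ring.
        rewrite Cmod_opp; eapply Rle_trans; [apply Cmod_triangle|]; rewrite Cmod_opp.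
        rewrite Rmult_plus_distr_l, Rplus_comm; apply Rplus_le_compat.
        * replace u with (u - 0)%R at 2 by ring.
          apply (path_MVT (fun x => phi (x, (- d)%R)) (fun x => phi' (x, (- d)%R))); [lra| |].
          -- intros x Hx; apply holo_partial_x, Hphi; simpl; lra.
          -- intros x Hx; apply Hb; simpl; lra.
        * replace d with (0 - - d)%R at 2 by ring.
          apply (path_MVT (fun y => phi (0%R, y)) (fun y => phi' (0%R, y) * Ci)); [lra| |].
          -- intros y Hy; apply holo_partial_y, Hphi; simpl; lra.
          -- intros y Hy; rewrite Cmod_mult, Cmod_Ci, Rmult_1_r; apply Hb; simpl; lra.
    - apply Hb; simpl; lra.
    - apply (is_CInt_minus _ _ _ _ _ _ (IX d ltac:(lra)) (IX (- d)%R ltac:(lra))). }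
  assert (t1 := top T ltac:(now left)); assert (t2 := top (- T)%R ltac:(now right)).
  fold T1 in t1; fold T2 in t2.
  unfold Cminus; eapply Rle_trans; [apply Cmod_triangle|]; rewrite Cmod_opp.
  assert (t3 : (Cmod (T1 + - T2) <= B * exp (- T))%R)
    by (eapply Rle_trans; [apply Cmod_triangle|]; rewrite Cmod_opp; lra).
  unfold Cminus in R1; lra.
Qed.

(** * The functional Lambda *)

(** The seminorm for which Lambda is continuous. Only a bound on the derivative is asked for, since
    the kernel sees differences of values and constants do not contribute. *)
Definition bounded_slope (psi : R -> C) (L : R) : Prop :=
  exists psi' : R -> C, forall t, path_derive psi t (psi' t) /\ (Cmod (psi' t) <= L)%R.

Lemma bounded_slope_plus (psi1 psi2 : R -> C) (L1 L2 : R) :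
  bounded_slope psi1 L1 -> bounded_slope psi2 L2 ->
  bounded_slope (fun t => psi1 t + psi2 t) (L1 + L2).
Proof.
  intros [p1 H1] [p2 H2]; exists (fun t => p1 t + p2 t); intros t.
  destruct (H1 t), (H2 t); split; [now apply path_derive_plus|].
  eapply Rle_trans; [apply Cmod_triangle|lra].
Qed.

Lemma bounded_slope_scal (c : C) (psi : R -> C) (L : R) :
  bounded_slope psi L -> bounded_slope (fun t => c * psi t) (Cmod c * L).
Proof.
  intros [p H]; exists (fun t => c * p t); intros t; destruct (H t) as [H1 H2]; split.
  - apply path_derive_eq with (1 := path_derive_mult _ _ _ _ _ (path_derive_const c t) H1).
    ring.
  - rewrite Cmod_mult; apply Rmult_le_compat_l; [apply Cmod_ge_0|assumption].
Qed.

Lemma bounded_slope_ext (psi1 psi2 : R -> C) (L : R) :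
  (forall t, psi1 t = psi2 t) -> bounded_slope psi1 L -> bounded_slope psi2 L.
Proof.
  intros E [p H]; exists p; intros t; destruct (H t); split; [|assumption].
  now apply path_derive_ext with (1 := E).
Qed.

(** The mean value inequality on [-t, t] bounds the numerator by 2 t L, and [sinh_PI_ge] bounds the
    modulus of the denominator below by 2 t exp t. *)
Lemma odd_kernel_bound (psi : R -> C) (L t : R) :
  bounded_slope psi L -> (0 < t)%R -> (Cmod (odd_kernel psi t) <= L * exp (- t))%R.
Proof.
  intros [p H] Ht.
  assert (M : (Cmod (psi t - psi (- t)%R) <= L * (t - - t))%R)
    by (apply path_MVT with (f' := p); [lra| |]; intros x _; apply H).
  assert (S := sinh_PI_ge t ltac:(lra)); assert (E := exp_pos t).
  assert (S0 : (0 < t * exp t)%R) by nra.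
  assert (N : 2 * Ci * RtoC (sinh (PI * t)) <> 0).
  { apply Cmult_neq_0; [apply Cmult_neq_0; [|apply Ci_neq_0]|];
      intros K; apply RtoC_inj in K; lra. }
  unfold odd_kernel; rewrite Cmod_mult, Cmod_inv by assumption.
  replace (psi (- t)%R - psi t) with (- (psi t - psi (- t)%R)) by ring.
  rewrite Cmod_opp, !Cmod_mult, Cmod_Ci, !Cmod_R, (Rabs_pos_eq 2),
    (Rabs_pos_eq (sinh _)) by lra.
  apply Rle_trans with (L * (t - - t) * / (2 * (t * exp t)))%R.
  - apply Rmult_le_compat; [apply Cmod_ge_0| |assumption|].
    + left; apply Rinv_0_lt_compat; lra.
    + apply Rinv_le_contravar; lra.
  - rewrite exp_Ropp; right; field; lra.
Qed.

Lemma odd_kernel_contC (psi : R -> C) (L t : R) :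
  bounded_slope psi L -> (0 < t)%R -> contC (odd_kernel psi) t.
Proof.
  intros [p H] Ht; unfold odd_kernel.
  assert (D1 := path_derive_contC _ _ _ (proj1 (H t))).
  destruct (path_derive_contC _ _ _ (proj1 (H (- t)%R))) as [D2 D3].
  assert (O : continuous (fun t => - t)%R t)
    by (apply @ex_derive_continuous; auto_derive; auto).
  apply contC_mult.
  - apply contC_plus; [|now apply contC_opp].
    split; [apply (continuous_comp (fun t => - t)%R (fun x => Re (psi x)) t O D2)
           |apply (continuous_comp (fun t => - t)%R (fun x => Im (psi x)) t O D3)].
  - apply contC_Cinv.
    + apply contC_mult; [apply contC_const|].
      split; simpl; [|apply continuous_const].
      apply @ex_derive_continuous; unfold sinh; auto_derive; auto.
    + apply Cmult_neq_0; [apply Cmult_neq_0; [|apply Ci_neq_0]|];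
        intros K; apply RtoC_inj in K; [lra|].
      assert (0 < sinh (PI * t))%R by (apply sinh_pos; generalize PI_RGT_0; nra); lra.
Qed.

Lemma odd_kernel_is_CInt (psi : R -> C) (L a b : R) :
  bounded_slope psi L -> (0 < a)%R -> (0 < b)%R ->
  is_CInt (odd_kernel psi) a b (CInt (odd_kernel psi) a b).
Proof.
  intros H Ha Hb; apply is_CInt_CInt; intros t Ht.
  apply odd_kernel_contC with (1 := H).
  apply Rlt_le_trans with (2 := proj1 Ht); now apply Rmin_pos.
Qed.

Lemma odd_kernel_CInt_bound (psi : R -> C) (L a b : R) :
  bounded_slope psi L -> (0 < a)%R -> (a <= b)%R ->
  (Cmod (CInt (odd_kernel psi) a b) <= L * (exp (- a) - exp (- b)))%R.
Proof.
  intros H Ha Hab.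
  apply (Cmod_CInt_le (odd_kernel psi) (fun t => L * exp (- t))%R a b _ _ Hab)
    with (2 := odd_kernel_is_CInt psi L a b H Ha ltac:(lra)).
  - intros t Ht; apply odd_kernel_bound; [assumption|lra].
  - replace (L * (exp (- a) - exp (- b)))%R with ((- L * exp (- b)) - (- L * exp (- a)))%R by ring.
    apply (is_RInt_derive (fun t => - L * exp (- t))%R).
    + intros t _; auto_derive; auto; ring.
    + intros t _; apply @ex_derive_continuous; auto_derive; auto.
Qed.

Lemma odd_kernel_CInt_diff (psi : R -> C) (L a b c d : R) :
  bounded_slope psi L -> (0 < a <= c)%R -> (c <= d)%R -> (d <= b)%R ->
  (Cmod (CInt (odd_kernel psi) a b - CInt (odd_kernel psi) c d) <=
   L * (exp (- a) - exp (- c)) + L * (exp (- d) - exp (- b)))%R.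
Proof.
  intros H Ha Hcd Hdb.
  assert (I := fun x y Hx Hy => odd_kernel_is_CInt psi L x y H Hx Hy).
  assert (E : CInt (odd_kernel psi) a b = CInt (odd_kernel psi) a c
              + (CInt (odd_kernel psi) c d + CInt (odd_kernel psi) d b)).
  { apply is_CInt_unique.
    apply (@is_RInt_Chasles C_R_NormedModule) with c; [apply I; lra|].
    apply (@is_RInt_Chasles C_R_NormedModule) with d; apply I; lra. }
  rewrite E; replace (_ - _) with (CInt (odd_kernel psi) a c + CInt (odd_kernel psi) d b) by ring.
  eapply Rle_trans; [apply Cmod_triangle|].
  apply Rplus_le_compat; apply odd_kernel_CInt_bound; try assumption; lra.
Qed.

Definition Lambda (psi : R -> C) : C :=
  @RInt_gen C_R_CompleteNormedModule (odd_kernel psi) (at_right 0) (Rbar_locally p_infty).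

Lemma exp_neg_le_1 (t : R) : (0 <= t)%R -> (exp (- t) <= 1)%R.
Proof.
  intros Ht; rewrite exp_Ropp, <- Rinv_1; apply Rinv_le_contravar; [lra|].
  generalize (exp_ineq1_le t); lra.
Qed.

Lemma exp_neg_small (eps : R) : (0 < eps)%R -> exists M, (0 < M)%R /\
  forall t, (M <= t)%R -> (exp (- t) <= eps)%R.
Proof.
  intros He; exists (/ eps)%R; split; [now apply Rinv_0_lt_compat|].
  intros t Ht; assert (0 < / eps)%R by now apply Rinv_0_lt_compat.
  rewrite exp_Ropp, <- (Rinv_inv eps).
  apply Rinv_le_contravar; [assumption|].
  generalize (exp_ineq1_le t); lra.
Qed.

Lemma filter_prod_small_large (d T : R) : (0 < d)%R ->
  filter_prod (at_right 0) (Rbar_locally p_infty)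
    (fun ab : R * R => (0 < fst ab <= d)%R /\ (T <= snd ab)%R).
Proof.
  intros Hd.
  apply Filter_prod with (Q := fun x => (0 < x <= d)%R) (R := fun y => (T <= y)%R).
  - exists (mkposreal d Hd); simpl; intros y Hy H0.
    change (Rabs (y - 0) < d)%R in Hy; rewrite Rminus_0_r in Hy.
    generalize (Rle_abs y); lra.
  - exists T; intros x Hx; lra.
  - auto.
Qed.

(** The integrable majorant L exp (-t) gives convergence, the bound L, and a rate explicit enough to
    pass identities between truncated integrals to the limit. *)
Lemma Lambda_spec (psi : R -> C) (L : R) : bounded_slope psi L ->
  @is_RInt_gen C_R_NormedModule (odd_kernel psi) (at_right 0) (Rbar_locally p_infty) (Lambda psi)
  /\ (Cmod (Lambda psi) <= L)%R
  /\ forall d T, (0 < d <= T)%R ->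
       (Cmod (Lambda psi - CInt (odd_kernel psi) d T) <= L * (d + exp (- T)))%R.
Proof.
  intros H.
  assert (L0 : (0 <= L)%R).
  { destruct H as [p Hp]; apply Rle_trans with (2 := proj2 (Hp 0%R)), Cmod_ge_0. }
  assert (ex : exists l : C, filterlim (fun ab : R * R => CInt (odd_kernel psi) (fst ab) (snd ab))
    (filter_prod (at_right 0) (Rbar_locally p_infty)) (@locally C_R_CompleteNormedModule l)).
  { apply (proj1 (@filterlim_locally_cauchy _ C_R_CompleteNormedModule _ filter_prod_proper
             (fun ab : R * R => CInt (odd_kernel psi) (fst ab) (snd ab)))); intros eps.
    (* Every integral with cutoffs beyond d and M is within 2 L e of the one over [d, M], so any two
       are within 4 L e < eps of each other; the summand 1 covers L = 0. *)
    assert (e0 : (0 < eps / (8 * (L + 1)))%R)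
      by (apply Rdiv_lt_0_compat; [apply cond_pos|lra]).
    set (e := (eps / (8 * (L + 1)))%R) in *.
    assert (He : (4 * L * e < eps)%R).
    { assert (8 * (L + 1) * e = eps)%R by (unfold e; field; lra).
      generalize (cond_pos eps); nra. }
    destruct (exp_neg_small e e0) as (M & M0 & HM).
    set (d := Rmin e M).
    assert (d0 : (0 < d)%R) by now apply Rmin_pos.
    assert (d1 : (d <= e)%R) by apply Rmin_l.
    assert (d2 : (d <= M)%R) by apply Rmin_r.
    exists (fun ab => (0 < fst ab <= d)%R /\ (M <= snd ab)%R); split;
      [now apply filter_prod_small_large|].
    assert (close : forall a b, (0 < a <= d)%R -> (M <= b)%R ->
      (Cmod (CInt (odd_kernel psi) a b - CInt (odd_kernel psi) d M) <= 2 * L * e)%R).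
    { intros a b Ha Hb.
      eapply Rle_trans; [apply odd_kernel_CInt_diff with (1 := H); lra|].
      assert (exp (- a) <= 1)%R by (apply exp_neg_le_1; lra).
      assert (1 - d <= exp (- d))%R by (generalize (exp_ineq1_le (- d)); lra).
      assert (0 < exp (- b))%R by apply exp_pos.
      assert (exp (- M) <= e)%R by (apply HM; lra).
      nra. }
    intros [a b] [a' b'] [Ha Hb] [Ha' Hb']; simpl in *.
    apply (@norm_compat1 R_AbsRing C_R_NormedModule); rewrite norm_C_R.
    change (Cmod (CInt (odd_kernel psi) a' b' - CInt (odd_kernel psi) a b) < eps)%R.
    replace (_ - _) with ((CInt (odd_kernel psi) a' b' - CInt (odd_kernel psi) d M)
      + - (CInt (odd_kernel psi) a b - CInt (odd_kernel psi) d M)) by ring.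
    eapply Rle_lt_trans; [apply Cmod_triangle|]; rewrite Cmod_opp.
    generalize (close a b Ha Hb) (close a' b' Ha' Hb'); lra. }
  destruct ex as [l Hl].
  assert (G : @is_RInt_gen C_R_NormedModule (odd_kernel psi) (at_right 0) (Rbar_locally p_infty) l).
  { intros P HP; specialize (Hl P HP); unfold filtermapi, filtermap in *.
    apply filter_imp with (2 := filter_and _ _ Hl (filter_prod_small_large 1 1 Rlt_0_1)).
    intros [a b] [K [Ha Hb]]; simpl in *; eexists; split; [|exact K].
    apply (odd_kernel_is_CInt psi L); [assumption|lra|lra]. }
  assert (E : Lambda psi = l)
    by (apply (@is_RInt_gen_unique C_R_CompleteNormedModule _ _ _ _ (odd_kernel psi)); exact G).
  rewrite E; split; [exact G|].
  (* The limit is approximated by integrals over intervals as wide as desired, so the bounds on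
     truncated integrals carry over to it. *)
  assert (near : forall eps d T, (0 < eps)%R -> (0 < d)%R -> exists a b,
     (0 < a <= d)%R /\ (T <= b)%R /\ (Cmod (l - CInt (odd_kernel psi) a b) <= eps)%R).
  { intros eps d T He Hd.
    assert (K := Hl _ (locally_ball_norm (V := C_R_NormedModule) l (mkposreal eps He))).
    unfold filtermap in K.
    destruct (filter_ex _ (filter_and _ _ K (filter_prod_small_large d T Hd)))
      as ([a b] & K1 & K2 & K3); simpl in *.
    exists a, b; split; [exact K2|split; [exact K3|]].
    unfold ball_norm in K1; rewrite norm_C_R in K1; simpl in K1.
    change (Cmod (CInt (odd_kernel psi) a b - l) < eps)%R in K1.
    replace (l - _) with (- (CInt (odd_kernel psi) a b - l)) by ring; rewrite Cmod_opp; lra. }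
  split.
  - apply le_epsilon; intros eps He.
    destruct (near eps 1%R 1%R He Rlt_0_1) as (a & b & Ha & Hb & K).
    replace l with (CInt (odd_kernel psi) a b + (l - CInt (odd_kernel psi) a b)) by ring.
    eapply Rle_trans; [apply Cmod_triangle|]; apply Rplus_le_compat; [|assumption].
    eapply Rle_trans; [apply odd_kernel_CInt_bound with (1 := H); lra|].
    assert (exp (- a) <= 1)%R by (apply exp_neg_le_1; lra).
    assert (0 < exp (- b))%R by apply exp_pos; nra.
  - intros d T Hd; apply le_epsilon; intros eps He.
    destruct (near eps d T He (proj1 Hd)) as (a & b & Ha & Hb & K).
    replace (l - _) with ((CInt (odd_kernel psi) a b - CInt (odd_kernel psi) d T)
      + (l - CInt (odd_kernel psi) a b)) by ring.
    eapply Rle_trans; [apply Cmod_triangle|]; apply Rplus_le_compat; [|assumption].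
    eapply Rle_trans; [apply odd_kernel_CInt_diff with (1 := H); lra|].
    assert (exp (- a) <= 1)%R by (apply exp_neg_le_1; lra).
    assert (1 - d <= exp (- d))%R by (generalize (exp_ineq1_le (- d)); lra).
    assert (0 < exp (- b))%R by apply exp_pos; nra.
Qed.

(** Passage to the limit in both cutoffs at once: d and T remain free, and the bound tends to 0 with
    them. *)
Lemma small_error (x K : R) :
  (forall d T, (0 < d <= 1 / 4)%R -> (1 <= T)%R -> (x <= K * (sqrt d + exp (- T)))%R) ->
  (x <= 0)%R.
Proof.
  intros H; apply le_epsilon; intros eps He; rewrite Rplus_0_l.
  assert (KK : (0 < 1 + Rabs K)%R) by (generalize (Rabs_pos K); lra).
  set (e := Rmin (1 / 2) (eps / (2 * (1 + Rabs K)))).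
  assert (e0 : (0 < e)%R) by (apply Rmin_pos; [lra|apply Rdiv_lt_0_compat; lra]).
  assert (e1 : (e <= 1 / 2)%R) by apply Rmin_l.
  assert (e2 : (e <= eps / (2 * (1 + Rabs K)))%R) by apply Rmin_r.
  destruct (exp_neg_small e e0) as (M & M0 & HM).
  assert (M1 := HM (M + 1)%R ltac:(lra)).
  (* With d = e^2 the square root is e, and e <= 1/2 gives d <= 1/4; adding 1 to M ensures T >=
     1. *)
  specialize (H (e * e)%R (M + 1)%R ltac:(nra) ltac:(lra)).
  rewrite sqrt_square in H by lra.
  assert (E : (0 < exp (- (M + 1)))%R) by apply exp_pos.
  apply Rle_trans with (1 := H).
  apply Rle_trans with (Rabs K * (e + exp (- (M + 1))))%R;
    [apply Rmult_le_compat_r; [lra|apply Rle_abs]|].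
  apply Rle_trans with ((1 + Rabs K) * (2 * e))%R;
    [apply Rmult_le_compat; try lra; apply Rabs_pos|].
  apply Rle_trans with ((1 + Rabs K) * (2 * (eps / (2 * (1 + Rabs K)))))%R;
    [apply Rmult_le_compat_l; lra|right; field; lra].
Qed.

Lemma le_sqrt_id (d : R) : (0 < d <= 1 / 4)%R -> (d <= sqrt d)%R.
Proof.
  intros Hd; assert (K := sqrt_sqrt d ltac:(lra)); assert (0 < sqrt d)%R by (apply sqrt_lt_R0; lra).
  nra.
Qed.

(** Any number approximated by the truncated integrals at the rate of [Lambda_spec] is the value of
    Lambda; linearity of Lambda thus reduces to that of [CInt]. *)
Lemma Lambda_unique (psi : R -> C) (L K : R) (l : C) :
  bounded_slope psi L ->
  (forall d T, (0 < d <= T)%R ->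
     (Cmod (l - CInt (odd_kernel psi) d T) <= K * (d + exp (- T)))%R) ->
  Lambda psi = l.
Proof.
  intros H Hl; destruct (Lambda_spec psi L H) as (_ & _ & S).
  enough (E : Cmod (Lambda psi - l) = 0%R).
  { apply Cmod_eq_0 in E; rewrite <- (Cplus_0_r l), <- E; ring. }
  apply Rle_antisym; [|apply Cmod_ge_0].
  apply small_error with (Rabs L + Rabs K)%R; intros d T Hd HT.
  specialize (S d T ltac:(lra)); specialize (Hl d T ltac:(lra)).
  replace (_ - _) with ((Lambda psi - CInt (odd_kernel psi) d T)
    + - (l - CInt (odd_kernel psi) d T)) by ring.
  eapply Rle_trans; [apply Cmod_triangle|]; rewrite Cmod_opp.
  assert (E := exp_pos (- T)); assert (D := le_sqrt_id d Hd).
  assert (L1 := Rle_abs L); assert (K1 := Rle_abs K).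
  apply Rle_trans with ((Rabs L + Rabs K) * (d + exp (- T)))%R; [nra|].
  apply Rmult_le_compat_l; [generalize (Rabs_pos L) (Rabs_pos K)|]; lra.
Qed.

Lemma Lambda_plus (psi1 psi2 : R -> C) (L1 L2 : R) :
  bounded_slope psi1 L1 -> bounded_slope psi2 L2 ->
  Lambda (fun t => psi1 t + psi2 t) = Lambda psi1 + Lambda psi2.
Proof.
  intros H1 H2.
  apply Lambda_unique with (1 := bounded_slope_plus _ _ _ _ H1 H2) (K := (L1 + L2)%R).
  intros d T Hd.
  destruct (Lambda_spec psi1 L1 H1) as (_ & _ & S1); specialize (S1 d T Hd).
  destruct (Lambda_spec psi2 L2 H2) as (_ & _ & S2); specialize (S2 d T Hd).
  replace (CInt (odd_kernel _) d T)
    with (CInt (odd_kernel psi1) d T + CInt (odd_kernel psi2) d T).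
  - replace (_ - _) with ((Lambda psi1 - CInt (odd_kernel psi1) d T)
      + (Lambda psi2 - CInt (odd_kernel psi2) d T)) by ring.
    eapply Rle_trans; [apply Cmod_triangle|lra].
  - symmetry; apply is_CInt_unique.
    eapply is_CInt_ext; [|apply is_CInt_plus;
      [apply (odd_kernel_is_CInt psi1 L1)|apply (odd_kernel_is_CInt psi2 L2)]; auto; lra].
    intros t _; unfold odd_kernel; ring.
Qed.

Lemma Lambda_scal (c : C) (psi : R -> C) (L : R) : bounded_slope psi L ->
  Lambda (fun t => c * psi t) = c * Lambda psi.
Proof.
  intros H.
  apply Lambda_unique with (1 := bounded_slope_scal c _ _ H) (K := (Cmod c * L)%R).
  intros d T Hd.
  destruct (Lambda_spec psi L H) as (_ & _ & S); specialize (S d T Hd).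
  replace (CInt (odd_kernel _) d T) with (c * CInt (odd_kernel psi) d T).
  - replace (_ - _) with (c * (Lambda psi - CInt (odd_kernel psi) d T)) by ring.
    rewrite Cmod_mult, Rmult_assoc; apply Rmult_le_compat_l; [apply Cmod_ge_0|assumption].
  - symmetry; apply is_CInt_unique.
    eapply is_CInt_ext; [|apply is_CInt_mult; apply (odd_kernel_is_CInt psi L); auto; lra].
    intros t _; unfold odd_kernel; ring.
Qed.

Lemma Lambda_ext (psi1 psi2 : R -> C) (L : R) : bounded_slope psi1 L ->
  (forall t, psi1 t = psi2 t) -> Lambda psi1 = Lambda psi2.
Proof.
  intros H E; symmetry.
  apply Lambda_unique with (1 := bounded_slope_ext _ _ _ E H) (K := L).
  intros d T Hd.
  replace (CInt (odd_kernel psi2) d T) with (CInt (odd_kernel psi1) d T);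
    [now apply (Lambda_spec psi1 L H)|].
  symmetry; apply is_CInt_unique.
  eapply is_CInt_ext; [|apply (odd_kernel_is_CInt psi1 L); auto; lra].
  intros t _; unfold odd_kernel; now rewrite !E.
Qed.

(** * Powers on vertical lines and the functional equation *)

Lemma exp_le_mono (x y : R) : (x <= y)%R -> (exp x <= exp y)%R.
Proof. intros [H| ->]; [left; now apply exp_increasing|lra]. Qed.

(** This is t |-> f_s(it) in the notation of the overview. *)
Definition vline (a s : C) (t : R) : C := Cpower (a + (0, t)%R) (- s).

Lemma ln_Cmod_ge (z : C) (rho : R) : (0 < rho <= Re z)%R -> (ln rho <= ln (Cmod z))%R.
Proof.
  intros H; apply ln_le; [lra|].
  apply Rle_trans with (2 := Re_le_Cmod z), Rle_trans with (2 := Rle_abs _); lra.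
Qed.

Lemma Re_Clog (z : C) : Re (Clog z) = ln (Cmod z).
Proof. reflexivity. Qed.

(** The modulus is exp (Re w ln |z| - Im w arg z). As Re w <= 0, ln |z| may be replaced by its lower
    bound ln rho, and 2 bounds |arg z| < pi/2. *)
Lemma Cmod_Cpower_le (z w : C) (rho : R) :
  (0 < rho <= Re z)%R -> (Re w <= 0)%R ->
  (Cmod (Cpower z w) <= exp (Re w * ln rho + 2 * Rabs (Im w)))%R.
Proof.
  intros Hz Hw; rewrite Cmod_Cpower, Re_Clog.
  assert (H1 := ln_Cmod_ge z rho Hz).
  destruct (Im_Clog_bound z ltac:(lra)) as [H2 H3].
  apply exp_le_mono.
  assert (H4 : (Rabs (Im (Clog z)) <= 2)%R) by (apply Rabs_le; generalize PI_4; lra).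
  assert (H5 : (- Im w * Im (Clog z) <= Rabs (Im w) * 2)%R).
  { apply Rle_trans with (1 := Rle_abs _); rewrite Rabs_mult, Rabs_Ropp.
    apply Rmult_le_compat_l; [apply Rabs_pos|assumption]. }
  nra.
Qed.

Lemma Cmod_inv_le (z : C) (rho : R) : (0 < rho <= Re z)%R -> (Cmod (/ z) <= / rho)%R.
Proof.
  intros Hz; rewrite Cmod_inv by (apply Re_pos_neq_0; lra).
  apply Rinv_le_contravar; [lra|].
  apply Rle_trans with (2 := Re_le_Cmod z), Rle_trans with (2 := Rle_abs _); lra.
Qed.

Definition Cpower_sup (s : C) (rho : R) : R := exp (- Re s * ln rho + 2 * Rabs (Im s)).

Lemma Cmod_Cpower_sup (z s : C) (rho : R) : (0 < rho <= Re z)%R -> (0 <= Re s)%R ->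
  (Cmod (Cpower z (- s)) <= Cpower_sup s rho)%R.
Proof.
  intros Hz Hs; unfold Cpower_sup; rewrite <- (Rabs_Ropp (Im s)).
  apply (Cmod_Cpower_le z (- s) rho Hz); simpl; unfold Re in Hs; lra.
Qed.

(** The power is estimated at a, uniformly for all b to its right, so that the dependence on b is
    only the factor 1 / Re b; it tends to 0 along b = a + k. *)
Lemma vline_bounded_slope (a b s : C) :
  (0 < Re a <= Re b)%R -> (0 <= Re s)%R ->
  bounded_slope (vline b s) (Cmod s * / Re b * Cpower_sup s (Re a)).
Proof.
  intros Hab Hs.
  exists (fun t => (- s * / (b + (0, t)%R) * Cpower (b + (0, t)%R) (- s)) * Ci).
  intros t.
  assert (P : Re (b + (0, t)%R) = Re b) by (simpl; unfold Re; ring).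
  split.
  - apply (holo_Cpower (- s) (b + (0, t)%R)); [lra| |reflexivity].
    split; simpl; auto_derive; auto.
  - rewrite !Cmod_mult, Cmod_Ci, Rmult_1_r, Cmod_opp.
    repeat apply Rmult_le_compat; auto using Cmod_ge_0.
    + apply Rmult_le_pos; apply Cmod_ge_0.
    + lra.
    + apply Cmod_inv_le; lra.
    + apply Cmod_Cpower_sup; [lra|assumption].
Qed.

Lemma contC_subst (F : C -> C) (g : C -> C) (z : C) :
  contC (U := prod_UniformSpace R_UniformSpace R_UniformSpace) g z ->
  contC (U := prod_UniformSpace R_UniformSpace R_UniformSpace) F (g z) ->
  contC (U := prod_UniformSpace R_UniformSpace R_UniformSpace) (fun w => F (g w)) z.
Proof.
  intros [G1 G2] [F1 F2].
  assert (G : @continuous (prod_UniformSpace R_UniformSpace R_UniformSpace)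
                (prod_UniformSpace R_UniformSpace R_UniformSpace) g z).
  { intros P [e He]; specialize (G1 _ (locally_ball (Re (g z)) e)).
    specialize (G2 _ (locally_ball (Im (g z)) e)); unfold filtermap in *.
    apply filter_imp with (2 := filter_and _ _ G1 G2); intros w [W1 W2].
    apply He; split; assumption. }
  split; [exact (continuous_comp g (fun w => Re (F w)) z G F1)
         |exact (continuous_comp g (fun w => Im (F w)) z G F2)].
Qed.

(** [half_strip] is applied to (a + z)^(-s) and to (a + 1 - z)^(-s). With the same integral G on Re
    z = 1/2, the limits read G + 2 Lambda_a = a^(-s) and G - 2 Lambda_(a+1) = (a+1)^(-s);
    subtract. *)
Lemma Lambda_vline_step (a s : C) : (0 < Re a)%R -> (0 < Re s)%R ->
  2 * Lambda (vline a s) + 2 * Lambda (vline (a + 1) s)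
  = Cpower a (- s) - Cpower (a + 1) (- s).
Proof.
  intros Ha Hs.
  assert (R1 : Re (a + 1) = (Re a + 1)%R) by reflexivity.
  set (f' := fun z => - s * / z * Cpower z (- s)).
  set (B := Cpower_sup s (Re a)).
  set (L := (Cmod s * / Re a * B)%R).
  assert (f'c : forall z, (0 < Re z)%R -> holo (fun w => Cpower w (- s)) z (f' z) /\
     contC (U := prod_UniformSpace R_UniformSpace R_UniformSpace) (fun w => Cpower w (- s)) z /\
     contC (U := prod_UniformSpace R_UniformSpace R_UniformSpace) f' z).
  { intros z Hz; split; [now apply holo_Cpower|split].
    - apply contC_Cpower; [apply contC_id|assumption].
    - apply contC_mult; [apply contC_mult; [apply contC_const|]|].
      + apply contC_Cinv; [apply contC_id|now apply Re_pos_neq_0].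
      + apply contC_Cpower; [apply contC_id|assumption]. }
  assert (f'b : forall z, (Re a <= Re z)%R -> (Cmod (Cpower z (- s)) <= B)%R /\ (Cmod (f' z) <= L)%R).
  { intros z Hz; assert (H := Cmod_Cpower_sup z s (Re a) ltac:(lra) ltac:(lra)).
    split; [exact H|].
    unfold f', L; rewrite !Cmod_mult, Cmod_opp.
    repeat apply Rmult_le_compat; auto using Cmod_ge_0.
    - apply Rmult_le_pos; apply Cmod_ge_0.
    - lra.
    - apply Cmod_inv_le; lra. }
  assert (b1 := vline_bounded_slope a a s ltac:(lra) ltac:(lra)).
  assert (b2 := vline_bounded_slope a (a + 1) s ltac:(lra) ltac:(lra)).
  destruct (Lambda_spec _ _ b1) as (_ & _ & S1).
  destruct (Lambda_spec _ _ b2) as (_ & _ & S2).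
  set (L2 := (Cmod s * / Re (a + 1) * Cpower_sup s (Re a))%R) in *.
  fold B L in S1, b1.
  enough (E : Cmod (2 * Lambda (vline a s) + 2 * Lambda (vline (a + 1) s)
              - (Cpower a (- s) - Cpower (a + 1) (- s))) = 0%R).
  { apply Cmod_eq_0 in E; rewrite <- (Cplus_0_r (_ - _)), <- E; ring. }
  apply Rle_antisym; [|apply Cmod_ge_0].
  assert (B0 : (0 < B)%R) by apply exp_pos.
  assert (L0 : (0 <= L)%R).
  { apply Rmult_le_pos; [apply Rmult_le_pos; [apply Cmod_ge_0|]|lra].
    left; now apply Rinv_0_lt_compat. }
  assert (L20 : (0 <= L2)%R).
  { apply Rmult_le_pos; [apply Rmult_le_pos; [apply Cmod_ge_0|]|fold B; lra].
    left; apply Rinv_0_lt_compat; lra. }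
  apply small_error with (2 * L + 2 * L2 + 2 * ((70 * L + 8 * B) + B))%R; intros d T Hd HT.
  specialize (S1 d T ltac:(lra)); specialize (S2 d T ltac:(lra)).
  (* The margin Re a / 2 keeps a + z and a + 1 - z in the right half-plane, where the power is
     holomorphic. *)
  assert (H1 := half_strip (fun z => Cpower (a + z) (- s)) (fun z => f' (a + z)) L B (Re a / 2) d T
     ltac:(lra)).
  assert (H2 := half_strip (fun z => Cpower (a + 1 - z) (- s)) (fun z => - f' (a + 1 - z))
     L B (Re a / 2) d T ltac:(lra)).
  cbv beta in H1, H2.
  assert (A1 : forall z, Re (a + z) = (Re a + Re z)%R) by reflexivity.
  assert (A2 : forall z, Re (a + 1 - z) = (Re a + 1 - Re z)%R) by reflexivity.
  assert (shift1 : forall z : C, holo (fun w => a + w) z 1).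
  { intros z; apply holo_eq with (1 := holo_plus _ _ _ _ _ (holo_const a z) (holo_id z)); ring. }
  assert (shift2 : forall z : C, holo (fun w => a + 1 - w) z (- (1))).
  { intros z; apply holo_eq with (1 := holo_plus _ _ _ _ _ (holo_const (a + 1) z)
      (holo_opp _ _ _ (holo_id z))); ring. }
  assert (cshift1 : forall z : C,
    contC (U := prod_UniformSpace R_UniformSpace R_UniformSpace) (fun w => a + w) z)
    by (intros z; apply contC_plus; [apply contC_const|apply contC_id]).
  assert (cshift2 : forall z : C,
    contC (U := prod_UniformSpace R_UniformSpace R_UniformSpace) (fun w => a + 1 - w) z)
    by (intros z; apply contC_plus; [apply contC_const|apply contC_opp, contC_id]).
  specialize (H1 ltac:(
    intros z Hz; destruct (f'c (a + z)) as (K1 & K2 & K3); [rewrite A1; lra|];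
    split; [apply holo_eq with (1 := holo_comp _ _ _ _ _ (shift1 z) K1); ring|];
    split; [exact (contC_subst _ _ _ (cshift1 z) K2)|exact (contC_subst _ _ _ (cshift1 z) K3)])
    ltac:(intros z Hz; apply f'b; rewrite A1; lra) Hd HT).
  specialize (H2 ltac:(
    intros z Hz; destruct (f'c (a + 1 - z)) as (K1 & K2 & K3); [rewrite A2; lra|];
    split; [apply holo_eq with (1 := holo_comp _ _ _ _ _ (shift2 z) K1); ring|];
    split; [exact (contC_subst _ _ _ (cshift2 z) K2)
           |apply contC_opp; exact (contC_subst _ _ _ (cshift2 z) K3)])
    ltac:(intros z Hz; rewrite Cmod_opp; apply f'b; rewrite A2; lra) Hd HT).
  (* On Re z = 1/2, a + 1 - z equals a + 1/2 - iy, so the reflection only swaps the two summands of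
     the integrand. *)
  set (G := CInt _ d T) in H1 at 1.
  replace (CInt (fun y => (Cpower (a + 1 - ((1 / 2)%R, y)) (- s)
     + Cpower (a + 1 - ((1 / 2)%R, (- y)%R)) (- s)) * / cosh (PI * y)) d T) with G in H2.
  2:{ unfold G, CInt; apply (@RInt_ext C_R_CompleteNormedModule); intros y _.
      replace (a + 1 - ((1 / 2)%R, y)) with (a + ((1 / 2)%R, (- y)%R))
        by (apply C_ext; simpl; field).
      replace (a + 1 - ((1 / 2)%R, (- y)%R)) with (a + ((1 / 2)%R, y))
        by (apply C_ext; simpl; field).
      change ((Cpower (a + ((1 / 2)%R, y)) (- s) + Cpower (a + ((1 / 2)%R, (- y)%R)) (- s))
        * / RtoC (cosh (PI * y)) = (Cpower (a + ((1 / 2)%R, (- y)%R)) (- s)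
        + Cpower (a + ((1 / 2)%R, y)) (- s)) * / RtoC (cosh (PI * y))).
      ring. }
  change (fun t => Cpower (a + (0%R, t)) (- s)) with (vline a s) in H1.
  (* On Re z = 0 the reflection exchanges t and -t, which changes the sign of the odd kernel. *)
  replace (CInt (odd_kernel (fun t => Cpower (a + 1 - (0%R, t)) (- s))) d T)
    with (- CInt (odd_kernel (vline (a + 1) s)) d T) in H2.
  2:{ symmetry; apply is_CInt_unique.
      replace (- CInt (odd_kernel (vline (a + 1) s)) d T)
        with (- (1) * CInt (odd_kernel (vline (a + 1) s)) d T) by ring.
      eapply is_CInt_ext; [|apply is_CInt_mult, (odd_kernel_is_CInt _ _ _ _ b2); lra].
      intros t _; unfold odd_kernel, vline.
      replace (a + 1 - (0%R, t)) with (a + 1 + (0, - t)%R) by (apply C_ext; simpl; ring).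
      replace (a + 1 - (0%R, (- t)%R)) with (a + 1 + (0, t)%R) by (apply C_ext; simpl; ring).
      ring. }
  rewrite Cplus_0_r in H1.
  replace (a + 1 - 0) with (a + 1) in H2 by ring.
  set (I1 := CInt (odd_kernel (vline a s)) d T) in *.
  set (I2 := CInt (odd_kernel (vline (a + 1) s)) d T) in *.
  replace (_ - _) with
    ((2 * (Lambda (vline a s) - I1) + 2 * (Lambda (vline (a + 1) s) - I2))
     + ((G + 2 * I1 - Cpower a (- s)) + - (G + 2 * - I2 - Cpower (a + 1) (- s)))) by ring.
  eapply Rle_trans; [apply Cmod_triangle|].
  assert (T1 := Cmod_triangle (2 * (Lambda (vline a s) - I1)) (2 * (Lambda (vline (a + 1) s) - I2))).
  rewrite !Cmod_mult, !Cmod_R, !Rabs_pos_eq in T1 by lra.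
  assert (T2 := Cmod_triangle (G + 2 * I1 - Cpower a (- s)) (- (G + 2 * - I2 - Cpower (a + 1) (- s)))).
  rewrite Cmod_opp in T2.
  assert (E := exp_pos (- T)); assert (D := le_sqrt_id d Hd).
  assert (D0 : (0 < sqrt d)%R) by (apply sqrt_lt_R0; lra).
  set (q := sqrt d) in *; set (x := exp (- T)) in *.
  apply Rle_trans with ((2 * L + 2 * L2) * (d + x) + 2 * ((70 * L + 8 * B) * q + B * x))%R;
    [lra|].
  assert (0 <= L * x)%R by nra. assert (0 <= B * x)%R by nra.
  assert (0 <= B * q)%R by nra.
  assert ((2 * L + 2 * L2) * (d + x) <= (2 * L + 2 * L2) * (q + x))%R
    by (apply Rmult_le_compat_l; lra).
  lra.
Qed.

(** * The case Re s > 1 *)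

Lemma is_series_C_eps (f : nat -> C) (l : C) :
  @is_series C_AbsRing C_NormedModule f l <->
  forall eps, (0 < eps)%R -> exists N, forall n, (N <= n)%nat ->
    (Cmod (@sum_n C_AbelianGroup f n - l) < eps)%R.
Proof.
  split.
  - intros H eps He.
    destruct (H _ (@locally_ball_norm C_AbsRing C_NormedModule l (mkposreal eps He))) as [N HN].
    exists N; intros n Hn; exact (HN n Hn).
  - intros H; unfold is_series.
    apply (proj2 (@filterlim_locally_ball_norm C_AbsRing nat C_NormedModule eventually _ _ _)).
    intros eps; destruct (H eps (cond_pos eps)) as [N HN].
    exists N; intros n Hn; exact (HN n Hn).
Qed.

Lemma sum_n_C_S (f : nat -> C) (n : nat) :
  @sum_n C_AbelianGroup f (S n) = @sum_n C_AbelianGroup f n + f (S n).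
Proof. exact (sum_Sn f n). Qed.

Lemma sum_n_C_0 (f : nat -> C) : @sum_n C_AbelianGroup f 0 = f 0%nat.
Proof. exact (sum_O f). Qed.

Lemma sum_n_C_mult (c : C) (f : nat -> C) (n : nat) :
  @sum_n C_AbelianGroup (fun k => c * f k) n = c * @sum_n C_AbelianGroup f n.
Proof. exact (@sum_n_mult_l C_Ring c f n). Qed.

(** The alternating sum is written as twice its even terms minus all terms, since these are the
    partial sums belonging to zeta(s, a/2) and zeta(s, a). Two consecutive steps share each interior
    term, whence the factor 2 and the corrections at both ends. *)
Lemma Lambda_alternating_sum (a s : C) (N : nat) : (0 < Re a)%R -> (0 < Re s)%R ->
  2 * Lambda (vline a s) =
    2 * (2 * @sum_n C_AbelianGroup (fun j => Cpower (a + INR (2 * j)) (- s)) N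
         - @sum_n C_AbelianGroup (fun k => Cpower (a + INR k) (- s)) (2 * N + 1))
    - Cpower a (- s) + Cpower (a + INR (2 * N + 2)) (- s)
    + 2 * Lambda (vline (a + INR (2 * N + 2)) s).
Proof.
  intros Ha Hs.
  set (f := fun k => Cpower (a + INR k) (- s)).
  set (l := fun k => 2 * Lambda (vline (a + INR k) s)).
  assert (step : forall k, l k = f k - f (S k) - l (S k)).
  { intros k; unfold l, f; rewrite S_INR, RtoC_plus, Cplus_assoc.
    rewrite <- Lambda_vline_step; [ring| |assumption].
    assert (K := pos_INR k); simpl; unfold Re in Ha; lra. }
  replace (2 * Lambda (vline a s)) with (l 0%nat)
    by (unfold l; do 3 f_equal; simpl; ring).
  replace (Cpower a (- s)) with (f 0%nat) by (unfold f; f_equal; simpl; ring).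
  change (Cpower (a + INR (2 * N + 2)) (- s)) with (f (2 * N + 2)%nat).
  change (2 * Lambda (vline (a + INR (2 * N + 2)) s)) with (l (2 * N + 2)%nat).
  change (fun k => Cpower (a + INR k) (- s)) with f.
  change (fun j => Cpower (a + INR (2 * j)) (- s)) with (fun j => f (2 * j)%nat).
  induction N as [|N IH].
  - rewrite !sum_n_C_0; simpl (2 * 0 + 1)%nat; simpl (2 * 0 + 2)%nat.
    rewrite sum_n_C_S, sum_n_C_0, (step 0%nat), (step 1%nat); simpl (2 * 0)%nat; ring.
  - rewrite IH.
    replace (2 * S N + 1)%nat with (S (S (2 * N + 1))) by lia.
    replace (2 * S N + 2)%nat with (S (S (2 * N + 2))) by lia.
    rewrite !sum_n_C_S, (step (2 * N + 2)%nat), (step (S (2 * N + 2))).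
    replace (2 * S N)%nat with (2 * N + 2)%nat by lia.
    replace (S (2 * N + 1)) with (2 * N + 2)%nat by lia.
    ring.
Qed.

Lemma Cpower_double (z w : C) : (0 < Re z)%R ->
  Cpower (2 * z) w = Cpower 2 w * Cpower z w.
Proof.
  intros Hz; unfold Cpower; rewrite <- Cexp_plus, Clog_mult by (simpl; lra || assumption).
  f_equal; ring.
Qed.

Lemma Cpower_2_minus (s : C) : Cpower 2 (2 - s) = 4 * Cpower 2 (- s).
Proof.
  unfold Cminus; rewrite Cpower_plus; f_equal.
  replace (RtoC 2) with (RtoC (INR 2)) at 2 by reflexivity.
  rewrite Cpower_INR by (simpl; lra); simpl Cpow; ring.
Qed.

Lemma P2_formula_eq_Lambda (zeta : C -> C -> C) (Hzeta : is_hurwitz_zeta zeta) (a s : C) :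
  (0 < Re a)%R -> (1 < Re s)%R -> P2_formula zeta a s = 2 * Lambda (vline a s).
Proof.
  intros Ha Hs.
  assert (Ha2 : (0 < Re (a / 2))%R)
    by (replace (Re (a / 2)) with (Re a / 2)%R by (simpl; unfold Re; field); lra).
  assert (Z1 := proj1 (is_series_C_eps _ _) (proj1 (Hzeta a Ha) s Hs)).
  assert (Z2 := proj1 (is_series_C_eps _ _) (proj1 (Hzeta (a / 2) Ha2) s Hs)).
  set (f := fun k : nat => Cpower (a + INR k) (- s)) in Z1.
  set (g := fun k : nat => Cpower (a / 2 + INR k) (- s)) in Z2.
  enough (E : Cmod (P2_formula zeta a s - 2 * Lambda (vline a s)) = 0%R).
  { apply Cmod_eq_0 in E; rewrite <- (Cplus_0_r (2 * _)), <- E; ring. }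
  apply Rle_antisym; [|apply Cmod_ge_0].
  apply le_epsilon; intros eps He; rewrite Rplus_0_l.
  set (c := Cmod (Cpower 2 (- s))).
  assert (c0 : (0 <= c)%R) by apply Cmod_ge_0.
  (* The error is 4 c from the series at a/2, 3 + 1 from two partial sums of the series at a, and 2
     from the remaining Lambda. *)
  set (e := (eps / (4 * c + 6))%R).
  assert (e0 : (0 < e)%R) by (apply Rdiv_lt_0_compat; lra).
  destruct (Z1 e e0) as [N1 H1]; destruct (Z2 e e0) as [N2 H2].
  set (K := (Cmod s * Cpower_sup s (Re a))%R).
  assert (K0 : (0 <= K)%R)
    by (apply Rmult_le_pos; [apply Cmod_ge_0|left; apply exp_pos]).
  destruct (nfloor_ex (K / e)) as [N3 H3];
    [apply Rdiv_le_0_compat; assumption|].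
  set (N := (N1 + N2 + N3 + 1)%nat).
  (* The end term is a difference of consecutive partial sums, so convergence of the series makes it
     small. *)
  assert (F : Cpower (a + INR (2 * N + 2)) (- s) = @sum_n C_AbelianGroup f (2 * N + 2)
     - @sum_n C_AbelianGroup f (2 * N + 1)).
  { replace (2 * N + 2)%nat with (S (2 * N + 1)) by lia; rewrite sum_n_C_S; unfold f; ring. }
  rewrite (Lambda_alternating_sum a s N) by lra.
  replace (@sum_n C_AbelianGroup (fun j => Cpower (a + INR (2 * j)) (- s)) N)
    with (Cpower 2 (- s) * @sum_n C_AbelianGroup g N).
  (* a + 2j = 2 (a/2 + j), so the even terms are 2^(-s) times those of the series at a/2. *)
  2:{ rewrite <- sum_n_C_mult; apply (@sum_n_ext C_AbelianGroup); intros j; unfold g.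
      rewrite <- Cpower_double.
      - f_equal; rewrite mult_INR, RtoC_mult; change (INR 2) with 2%R; field.
      - assert (Q := pos_INR j); simpl in *; unfold Re in *; simpl in *; lra. }
  unfold P2_formula; rewrite Cpower_2_minus, F.
  fold f.
  set (A := @sum_n C_AbelianGroup g N).
  set (B1 := @sum_n C_AbelianGroup f (2 * N + 1)).
  set (B2 := @sum_n C_AbelianGroup f (2 * N + 2)).
  set (l := Lambda _).
  assert (HA : (Cmod (A - zeta s (a / 2)%C) < e)%R) by (apply H2; lia).
  assert (HB1 : (Cmod (B1 - zeta s a) < e)%R) by (apply H1; lia).
  assert (HB2 : (Cmod (B2 - zeta s a) < e)%R) by (apply H1; lia).
  assert (Hl : (Cmod l <= e)%R).
  { assert (Ra : Re (a + INR (2 * N + 2)) = (Re a + INR (2 * N + 2))%R) by reflexivity.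
    assert (Q := pos_INR (2 * N + 2)).
    destruct (Lambda_spec _ _ (vline_bounded_slope a (a + INR (2 * N + 2)) s
      ltac:(lra) ltac:(lra))) as (_ & Hl & _).
    apply Rle_trans with (1 := Hl); rewrite Ra.
    replace (_ * _ * _)%R with (K * / (Re a + INR (2 * N + 2)))%R by (unfold K; ring).
    apply Rmult_le_reg_r with (Re a + INR (2 * N + 2))%R; [lra|].
    rewrite Rmult_assoc, Rinv_l, Rmult_1_r by lra.
    apply Rle_trans with (e * INR (N3 + 1))%R.
    - rewrite plus_INR; simpl (INR 1).
      apply Rle_trans with (e * (K / e))%R; [right; field; lra|].
      apply Rmult_le_compat_l; lra.
    - apply Rmult_le_compat_l; [lra|].
      assert (INR (N3 + 1) <= INR (2 * N + 2))%R by (apply le_INR; unfold N; lia).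
      lra. }
  replace (_ - _) with (- (4 * Cpower 2 (- s) * (A - zeta s (a / 2)))
     + (3 * (B1 - zeta s a) + (- (B2 - zeta s a) + - (2 * l)))) by ring.
  assert (T1 := Cmod_triangle (- (4 * Cpower 2 (- s) * (A - zeta s (a / 2))))
     (3 * (B1 - zeta s a) + (- (B2 - zeta s a) + - (2 * l)))).
  assert (T2 := Cmod_triangle (3 * (B1 - zeta s a)) (- (B2 - zeta s a) + - (2 * l))).
  assert (T3 := Cmod_triangle (- (B2 - zeta s a)) (- (2 * l))).
  rewrite ?Cmod_opp, ?Cmod_mult, ?Cmod_R, ?Rabs_pos_eq in * by lra.
  fold c in T1.
  assert (4 * c * Cmod (A - zeta s (a / 2)%C) <= 4 * c * e)%R
    by (apply Rmult_le_compat_l; lra).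
  assert ((4 * c + 6) * e = eps)%R by (unfold e; field; lra).
  lra.
Qed.

(** * Analytic continuation along a ray *)

(** Real power series in the ray parameter suffice for the continuation: they are used for the real
    and the imaginary part separately. *)
Definition analytic_0 (f : R -> R) : Prop :=
  exists (c : nat -> R) (r : R), (0 < r)%R /\
    forall x, (Rabs x < r)%R -> is_pseries c x (f x).

(** Otherwise the point halfway between |x| and r would lie strictly outside the disc of
    convergence, where the terms of the series cannot tend to 0. *)
Lemma CV_radius_ge (c : nat -> R) (r x : R) :
  (forall y, (Rabs y < r)%R -> ex_pseries c y) -> (Rabs x < r)%R ->
  Rbar_lt (Rabs x) (CV_radius c).
Proof.
  intros H Hx.
  destruct (Rbar_lt_dec (Rabs x) (CV_radius c)) as [L|L]; [exact L|exfalso].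
  apply Rbar_not_lt_le in L.
  set (y := ((Rabs x + r) / 2)%R).
  assert (A := Rabs_pos x).
  assert (Y : Rabs y = y) by (apply Rabs_pos_eq; unfold y; lra).
  apply (CV_disk_outside c y).
  - rewrite Y; apply Rbar_le_lt_trans with (1 := L); simpl; unfold y; lra.
  - destruct (H y) as [l Hl]; [rewrite Y; unfold y; lra|].
    apply is_pseries_R in Hl.
    exact (ex_series_lim_0 _ (ex_intro _ l Hl)).
Qed.

Lemma analytic_0_plus (f g : R -> R) :
  analytic_0 f -> analytic_0 g -> analytic_0 (fun x => f x + g x)%R.
Proof.
  intros (a & r & Hr & Ha) (b & q & Hq & Hb).
  exists (PS_plus a b), (Rmin r q); split; [now apply Rmin_pos|].
  intros x Hx; apply (@is_pseries_plus R_AbsRing R_NormedModule);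
    [apply Ha|apply Hb]; apply Rlt_le_trans with (1 := Hx); [apply Rmin_l|apply Rmin_r].
Qed.

Lemma analytic_0_opp (f : R -> R) : analytic_0 f -> analytic_0 (fun x => - f x)%R.
Proof.
  intros (a & r & Hr & Ha); exists (PS_opp a), r; split; [assumption|].
  intros x Hx; apply (@is_pseries_opp R_AbsRing R_NormedModule), Ha, Hx.
Qed.

Lemma analytic_0_mult (f g : R -> R) :
  analytic_0 f -> analytic_0 g -> analytic_0 (fun x => f x * g x)%R.
Proof.
  intros (a & r & Hr & Ha) (b & q & Hq & Hb).
  exists (PS_mult a b), (Rmin r q); split; [now apply Rmin_pos|].
  intros x Hx.
  assert (X1 : (Rabs x < r)%R) by (apply Rlt_le_trans with (1 := Hx), Rmin_l).
  assert (X2 : (Rabs x < q)%R) by (apply Rlt_le_trans with (1 := Hx), Rmin_r).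
  apply is_pseries_mult; auto.
  - apply (CV_radius_ge a r); [|assumption]; intros y Hy; eexists; apply Ha, Hy.
  - apply (CV_radius_ge b q); [|assumption]; intros y Hy; eexists; apply Hb, Hy.
Qed.

Lemma analytic_0_continuous (f : R -> R) : analytic_0 f -> continuous f 0%R.
Proof.
  intros (a & r & Hr & Ha).
  apply continuous_ext_loc with (g := PSeries a).
  - exists (mkposreal r Hr); intros x Hx.
    change (Rabs (x - 0) < r)%R in Hx; rewrite Rminus_0_r in Hx.
    apply is_pseries_unique, Ha, Hx.
  - apply continuity_pt_filterlim, PSeries_continuity, (CV_radius_ge a r);
      [intros y Hy; eexists; apply Ha, Hy|rewrite Rabs_R0; assumption].
Qed.

(** Continuity at 0 kills the constant coefficient; the series is then x times the shifted one,
    which vanishes on the same interval. The sequence is quantified after k because the induction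
    applies to the shift. *)
Lemma pseries_zero_right (r : R) (k : nat) : (0 < r)%R -> forall c : nat -> R,
  (forall x, (Rabs x < r)%R -> ex_pseries c x) ->
  (forall x, (0 < x < r)%R -> PSeries c x = 0%R) -> c k = 0%R.
Proof.
  intros Hr.
  assert (Z : forall c : nat -> R, (forall x, (Rabs x < r)%R -> ex_pseries c x) ->
    (forall x, (0 < x < r)%R -> PSeries c x = 0%R) -> c 0%nat = 0%R).
  { intros c Hc Hz.
    destruct (Req_dec (c 0%nat) 0) as [|N]; [assumption|exfalso].
    assert (K : continuous (PSeries c) 0%R).
    { apply continuity_pt_filterlim, PSeries_continuity, (CV_radius_ge c r); [assumption|].
      rewrite Rabs_R0; assumption. }
    assert (e0 : (0 < Rabs (c 0%nat))%R) by now apply Rabs_pos_lt.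
    destruct (K _ (locally_ball (PSeries c 0) (mkposreal _ e0))) as [d Hd].
    set (x := Rmin (d / 2) (r / 2)).
    assert (d0 := cond_pos d).
    assert (X0 : (0 < x)%R) by (apply Rmin_pos; lra).
    assert (X1 : (x <= d / 2)%R) by apply Rmin_l.
    assert (X2 : (x <= r / 2)%R) by apply Rmin_r.
    specialize (Hd x); rewrite (Hz x), PSeries_0 in Hd by lra.
    assert (B : ball 0%R d x).
    { change (Rabs (x - 0) < d)%R; rewrite Rminus_0_r, Rabs_pos_eq; lra. }
    specialize (Hd B); change (Rabs (0 - c 0%nat) < Rabs (c 0%nat))%R in Hd.
    unfold Rminus in Hd; rewrite Rplus_0_l, Rabs_Ropp in Hd; lra. }
  induction k as [|k IH]; intros c Hc Hz; [now apply Z|].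
  change (c (S k)) with (PS_decr_1 (K := R_AbsRing) (V := R_NormedModule) c k).
  apply IH.
  - intros x Hx; destruct (Req_dec x 0) as [-> |N].
    + exists (c 1%nat); apply (@is_pseries_0 R_AbsRing R_NormedModule (PS_decr_1 c)).
    + destruct (Hc x Hx) as [l Hl]; eexists.
      apply (@is_pseries_decr_1 R_AbsRing R_NormedModule c x (/ x)%R) with (2 := Hl).
      now apply Rinv_l.
  - intros x Hx.
    assert (E := PSeries_decr_1_aux c x (Z c Hc Hz)); rewrite Hz in E by assumption.
    apply Rmult_eq_reg_l with x; [rewrite <- E; ring|lra].
Qed.

(** Zeros to the right of 0 spread to its left; this is what moves the supremum in
    [analytic_continuation]. *)
Lemma analytic_0_zero_left (f : R -> R) (q : R) :
  analytic_0 f -> (0 < q)%R -> (forall x, (0 < x < q)%R -> f x = 0%R) ->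
  exists r, (0 < r)%R /\ forall x, (Rabs x < r)%R -> f x = 0%R.
Proof.
  intros (c & r & Hr & Hc) Hq Hf.
  exists r; split; [assumption|]; intros x Hx.
  set (p := Rmin r q).
  assert (Hp : (0 < p)%R) by now apply Rmin_pos.
  assert (p1 : (p <= r)%R) by apply Rmin_l.
  assert (p2 : (p <= q)%R) by apply Rmin_r.
  assert (Z : forall k, c k = 0%R).
  { intros k; apply (pseries_zero_right p k Hp).
    - intros y Hy; exists (f y); apply Hc; lra.
    - intros y Hy; rewrite (is_pseries_unique c y (f y)).
      + apply Hf; lra.
      + apply Hc; rewrite Rabs_pos_eq; lra. }
  rewrite <- (is_pseries_unique _ _ _ (Hc x Hx)).
  transitivity (PSeries (fun _ => 0%R) x); [now apply PSeries_ext|apply PSeries_const_0].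
Qed.

Definition analyticC_0 (F : R -> C) : Prop :=
  analytic_0 (fun x => Re (F x)) /\ analytic_0 (fun x => Im (F x)).

Lemma analyticC_0_plus (F G : R -> C) :
  analyticC_0 F -> analyticC_0 G -> analyticC_0 (fun x => F x + G x).
Proof.
  intros [F1 F2] [G1 G2]; split;
    [exact (analytic_0_plus _ _ F1 G1)|exact (analytic_0_plus _ _ F2 G2)].
Qed.

Lemma analyticC_0_opp (F : R -> C) : analyticC_0 F -> analyticC_0 (fun x => - F x).
Proof.
  intros [F1 F2]; split; [exact (analytic_0_opp _ F1)|exact (analytic_0_opp _ F2)].
Qed.

Lemma analyticC_0_mult (F G : R -> C) :
  analyticC_0 F -> analyticC_0 G -> analyticC_0 (fun x => F x * G x).
Proof.
  intros [F1 F2] [G1 G2]; split.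
  - exact (analytic_0_plus _ _ (analytic_0_mult _ _ F1 G1)
             (analytic_0_opp _ (analytic_0_mult _ _ F2 G2))).
  - exact (analytic_0_plus _ _ (analytic_0_mult _ _ F1 G2) (analytic_0_mult _ _ F2 G1)).
Qed.

Lemma Re_Im_sum_n (f : nat -> C) (n : nat) :
  Re (@sum_n C_AbelianGroup f n) = sum_n (fun k => Re (f k)) n /\
  Im (@sum_n C_AbelianGroup f n) = sum_n (fun k => Im (f k)) n.
Proof.
  induction n as [|n [IH1 IH2]].
  - rewrite !sum_n_C_0, !sum_O; auto.
  - rewrite sum_n_C_S, !sum_Sn, <- IH1, <- IH2; split; reflexivity.
Qed.

Lemma is_pseries_eps (c : nat -> R) (x l : R) :
  (forall eps, (0 < eps)%R -> exists N, forall n, (N <= n)%nat ->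
     (Rabs (sum_n (fun k => x ^ k * c k) n - l) < eps)%R) -> is_pseries c x l.
Proof.
  intros H; apply is_series_ext with (a := fun k => (x ^ k * c k)%R).
  { intros k; exact (f_equal (fun y => y * c k)%R (eq_sym (pow_n_pow x k))). }
  unfold is_series; apply (proj2 (@filterlim_locally_ball_norm R_AbsRing nat R_NormedModule eventually _ _ _)).
  intros eps; destruct (H eps (cond_pos eps)) as [N HN].
  exists N; intros n Hn; exact (HN n Hn).
Qed.

Lemma analyticC_0_intro (F : R -> C) (c : nat -> C) (r : R) : (0 < r)%R ->
  (forall x, (Rabs x < r)%R -> forall eps, (0 < eps)%R -> exists N, forall n, (N <= n)%nat ->
     (Cmod (@sum_n C_AbelianGroup (fun k => RtoC (x ^ k) * c k)%C n - F x) < eps)%R) ->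
  analyticC_0 F.
Proof.
  intros Hr H; split.
  - exists (fun k => Re (c k)), r; split; [assumption|].
    intros x Hx; apply is_pseries_eps; intros eps He.
    destruct (H x Hx eps He) as [N HN]; exists N; intros n Hn.
    apply Rle_lt_trans with (2 := HN n Hn), Rle_trans with (2 := Re_le_Cmod _).
    rewrite (sum_n_ext _ (fun k => Re (RtoC (x ^ k) * c k)%C))
      by (intros k; simpl; unfold Re, Im; ring).
    rewrite <- (proj1 (Re_Im_sum_n _ n)); apply Rle_refl.
  - exists (fun k => Im (c k)), r; split; [assumption|].
    intros x Hx; apply is_pseries_eps; intros eps He.
    destruct (H x Hx eps He) as [N HN]; exists N; intros n Hn.
    apply Rle_lt_trans with (2 := HN n Hn), Rle_trans with (2 := Im_le_Cmod _).
    rewrite (sum_n_ext _ (fun k => Im (RtoC (x ^ k) * c k)%C))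
      by (intros k; simpl; unfold Re, Im; ring).
    rewrite <- (proj2 (Re_Im_sum_n _ n)); apply Rle_refl.
Qed.

Lemma analyticC_0_geometric (F : R -> C) (c : nat -> C) (r K : R) : (0 < r)%R ->
  (forall x n, (Rabs x < r)%R ->
     (Cmod (F x - @sum_n C_AbelianGroup (fun k => RtoC (x ^ k) * c k)%C n) <= K * (1 / 2) ^ n)%R) ->
  analyticC_0 F.
Proof.
  intros Hr H; apply analyticC_0_intro with c r; [assumption|].
  intros x Hx eps He.
  assert (K0 : (0 < 1 + Rabs K)%R) by (generalize (Rabs_pos K); lra).
  destruct (pow_lt_1_zero (1 / 2)) with (y := (eps / (1 + Rabs K))%R) as [N HN].
  - rewrite Rabs_pos_eq; lra.
  - now apply Rdiv_lt_0_compat.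
  - exists N; intros n Hn; specialize (HN n Hn).
    assert (P : (0 < (1 / 2) ^ n)%R) by (apply pow_lt; lra).
    rewrite Rabs_pos_eq in HN by lra.
    replace (_ - _) with (- (F x - @sum_n C_AbelianGroup (fun k => RtoC (x ^ k) * c k) n)) by ring.
    rewrite Cmod_opp; apply Rle_lt_trans with (1 := H x n Hx).
    apply Rle_lt_trans with ((1 + Rabs K) * (1 / 2) ^ n)%R.
    + apply Rmult_le_compat_r; [lra|generalize (Rle_abs K); lra].
    + replace eps with ((1 + Rabs K) * (eps / (1 + Rabs K)))%R by (field; lra).
      now apply Rmult_lt_compat_l.
Qed.

Lemma pow_n_C (z : C) (k : nat) : @pow_n C_Ring z k = z ^ k.
Proof. induction k as [|k IH]; [reflexivity|]; simpl; rewrite IH; reflexivity. Qed.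

Lemma RtoC_pow (x : R) (k : nat) : RtoC (x ^ k) = RtoC x ^ k.
Proof. induction k as [|k IH]; [reflexivity|]; simpl; rewrite RtoC_mult, IH; reflexivity. Qed.

Lemma Cpow_mult_distr (z w : C) (k : nat) : (z * w) ^ k = z ^ k * w ^ k.
Proof. induction k as [|k IH]; simpl; [ring|rewrite IH; ring]. Qed.

Lemma analytic_at_ray (f : C -> C) (z0 v : C) : analytic_at f z0 ->
  analyticC_0 (fun x => f (z0 + RtoC x * v)).
Proof.
  intros (c & r & Hr & H).
  (* The summand 1 keeps the radius r / (|v| + 1) meaningful for v = 0. *)
  assert (V : (0 < Cmod v + 1)%R) by (generalize (Cmod_ge_0 v); lra).
  apply analyticC_0_intro with (c := fun k => v ^ k * c k) (r := (r / (Cmod v + 1))%R);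
    [now apply Rdiv_lt_0_compat|].
  intros x Hx.
  set (z := z0 + RtoC x * v).
  assert (E : z - z0 = RtoC x * v) by (unfold z; ring).
  assert (B : (Cmod (z - z0) < r)%R).
  { rewrite E, Cmod_mult, Cmod_R.
    replace r with (r / (Cmod v + 1) * (Cmod v + 1))%R by (field; lra).
    assert (A := Rabs_pos x); assert (A' := Cmod_ge_0 v).
    apply Rle_lt_trans with (Rabs x * (Cmod v + 1))%R; [nra|].
    now apply Rmult_lt_compat_r. }
  specialize (H z B); rewrite E in H.
  intros eps He; destruct (proj1 (is_series_C_eps _ _) H eps He) as [N HN].
  exists N; intros n Hn; specialize (HN n Hn).
  rewrite (@sum_n_ext C_AbelianGroup _ (fun k => RtoC (x ^ k) * (v ^ k * c k))) in HN;
    [exact HN|].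
  intros k; rewrite pow_n_C, Cpow_mult_distr, RtoC_pow.
  change (RtoC x ^ k * v ^ k * c k = RtoC x ^ k * (v ^ k * c k)); ring.
Qed.

(** Let m be the supremum of the points x >= 0 where H is nonzero. H vanishes to the right of m,
    hence on a whole neighbourhood of m, so a smaller number is already an upper bound. *)
Lemma analytic_continuation (H : R -> C) :
  (forall x0, (0 <= x0)%R -> analyticC_0 (fun x => H (x0 + x)%R)) ->
  (forall x, (1 < x)%R -> H x = 0) -> H 0%R = 0.
Proof.
  intros Ha Hz.
  destruct (Ceq_dec (H 0%R) 0) as [|N]; [assumption|exfalso].
  destruct (completeness (fun x => (0 <= x)%R /\ H x <> 0)) as [m [ub lub]].
  - exists 1%R; intros x [X1 X2]; destruct (Rle_lt_dec x 1); [assumption|].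
    exfalso; now apply X2, Hz.
  - exists 0%R; split; [lra|assumption].
  - assert (m0 : (0 <= m)%R) by (apply ub; split; [lra|assumption]).
    assert (R0 : forall x, (0 < x)%R -> H (m + x)%R = 0).
    { intros x Hx; destruct (Ceq_dec (H (m + x)%R) 0) as [|N']; [assumption|exfalso].
      assert (m + x <= m)%R by (apply ub; split; [lra|assumption]); lra. }
    destruct (Ha m m0) as [A1 A2].
    destruct (analytic_0_zero_left _ 1 A1 Rlt_0_1) as (r1 & r10 & Z1);
      [intros x Hx; now rewrite R0|].
    destruct (analytic_0_zero_left _ 1 A2 Rlt_0_1) as (r2 & r20 & Z2);
      [intros x Hx; now rewrite R0|].
    set (r := Rmin r1 r2).
    assert (r0 : (0 < r)%R) by now apply Rmin_pos.
    assert (r1' : (r <= r1)%R) by apply Rmin_l.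
    assert (r2' : (r <= r2)%R) by apply Rmin_r.
    assert (m <= m - r)%R; [|lra].
    apply lub; intros x [X1 X2].
    destruct (Rle_lt_dec x (m - r)) as [|X3]; [assumption|exfalso].
    apply X2.
    assert (X4 : (x <= m)%R) by (apply ub; split; assumption).
    assert (X5 : (Rabs (x - m) < r)%R) by (apply Rabs_def1; lra).
    replace x with (m + (x - m))%R by ring.
    apply C_ext; [apply Z1|apply Z2]; lra.
Qed.

(** The Taylor remainder exp w minus the terms of degree below n. Each remainder is the derivative
    of the next, which drives the induction in its estimate. *)
Fixpoint Cexp_tail (n : nat) (w : C) : C :=
  match n with
  | O => Cexp w
  | S n => Cexp_tail n w - RtoC (/ INR (fact n)) * w ^ n
  end.

Lemma holo_Cpow (n : nat) (z : C) : holo (fun w => w ^ S n) z (RtoC (INR (S n)) * z ^ n).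
Proof.
  induction n as [|n IH].
  - apply holo_ext with (phi := fun w => w); [intros w; simpl; ring|].
    apply holo_eq with (1 := holo_id z); simpl; ring.
  - apply holo_eq with (1 := holo_mult _ _ _ _ _ (holo_id z) IH).
    rewrite (S_INR (S n)), RtoC_plus; simpl; ring.
Qed.

Lemma holo_Cexp_tail (n : nat) (z : C) : holo (Cexp_tail (S n)) z (Cexp_tail n z).
Proof.
  induction n as [|n IH].
  - apply holo_ext with (phi := fun w => Cexp w + - (1)).
    { intros w; simpl; rewrite Rinv_1; ring. }
    apply holo_eq with (1 := holo_plus _ _ _ _ _ (holo_Cexp z) (holo_const _ z)); simpl; ring.
  - apply holo_ext with
      (phi := fun w => Cexp_tail (S n) w + - (RtoC (/ INR (fact (S n))) * w ^ S n));
      [reflexivity|].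
    apply holo_eq with (1 := holo_plus _ _ _ _ _ IH
      (holo_opp _ _ _ (holo_scal (RtoC (/ INR (fact (S n)))) _ _ _ (holo_Cpow n z)))).
    change (Cexp_tail (S n) z) with (Cexp_tail n z - RtoC (/ INR (fact n)) * z ^ n).
    rewrite Cmult_assoc, <- RtoC_mult.
    replace (/ INR (fact (S n)) * INR (S n))%R with (/ INR (fact n))%R; [reflexivity|].
    rewrite fact_simpl, mult_INR.
    assert (INR (fact n) <> 0)%R by apply INR_fact_neq_0.
    assert (INR (S n) <> 0)%R by (apply not_0_INR; lia).
    field; auto.
Qed.

Lemma Cexp_tail_0 (n : nat) : Cexp_tail (S n) 0 = 0.
Proof.
  induction n as [|n IH].
  - simpl; rewrite Cexp_0, Rinv_1; ring.
  - change (Cexp_tail (S n) 0 - RtoC (/ INR (fact (S n))) * 0 ^ S n = 0).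
    rewrite IH; simpl; ring.
Qed.

Lemma Cmod_Cexp_le (w : C) : (Cmod (Cexp w) <= exp (Cmod w))%R.
Proof.
  rewrite Cmod_Cexp; apply exp_le_mono, Rle_trans with (2 := Re_le_Cmod w), Rle_abs.
Qed.

(* Integrating [t |-> w * Cexp_tail n (t w)] over [0, 1] turns the bound for [n] into
   the one for [n + 1]; the factor 2 in the exponent is what yields the gain 1/2. *)
Lemma Cmod_Cexp_tail (n : nat) (w : C) :
  (Cmod (Cexp_tail n w) <= (1 / 2) ^ n * exp (2 * Cmod w))%R.
Proof.
  revert w; induction n as [|n IH]; intros w.
  - simpl pow; rewrite Rmult_1_l; apply Rle_trans with (1 := Cmod_Cexp_le w).
    apply exp_le_mono; generalize (Cmod_ge_0 w); lra.
  - assert (Q : (0 < (1 / 2) ^ n)%R) by (apply pow_lt; lra).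
    replace (Cexp_tail (S n) w)
      with (Cexp_tail (S n) (0 + RtoC 1 * w) - Cexp_tail (S n) (0 + RtoC 0 * w)).
    2:{ replace (0 + RtoC 0 * w) with (RtoC 0) by ring.
        replace (0 + RtoC 1 * w) with w by ring.
        rewrite Cexp_tail_0; ring. }
    set (m := fun t => ((1 / 2) ^ S n * exp (2 * t * Cmod w))%R).
    apply Rle_trans with (m 1%R - m 0%R)%R.
    + apply (path_MVT_majorant (fun t => Cexp_tail (S n) (0 + RtoC t * w))
        (fun t => Cexp_tail n (0 + RtoC t * w) * w) m
        (fun t => (1 / 2) ^ n * exp (2 * t * Cmod w) * Cmod w)%R); [lra| | |].
      * intros t _; apply (holo_Cexp_tail n (0 + RtoC t * w)); [|reflexivity].
        apply path_derive_affine.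
      * intros t _; unfold m; simpl pow; auto_derive; auto; field.
      * intros t Ht; rewrite Cmod_mult; apply Rmult_le_compat_r; [apply Cmod_ge_0|].
        rewrite Cplus_0_l; apply Rle_trans with (1 := IH _).
        rewrite Cmod_mult, Cmod_R, Rabs_pos_eq by lra.
        right; do 2 f_equal; ring.
    + unfold m; rewrite Rmult_1_r.
      assert (0 < (1 / 2) ^ S n * exp (2 * 0 * Cmod w))%R; [|lra].
      apply Rmult_lt_0_compat; [apply pow_lt; lra|apply exp_pos].
Qed.

Lemma Cexp_tail_sum (n : nat) (w : C) :
  Cexp w - @sum_n C_AbelianGroup (fun k => RtoC (/ INR (fact k)) * w ^ k) n = Cexp_tail (S n) w.
Proof.
  induction n as [|n IH].
  - rewrite sum_n_C_0; reflexivity.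
  - rewrite sum_n_C_S.
    change (Cexp_tail (S (S n)) w)
      with (Cexp_tail (S n) w - RtoC (/ INR (fact (S n))) * w ^ S n).
    rewrite <- IH; ring.
Qed.

Lemma analyticC_0_Cexp (alpha beta : C) : analyticC_0 (fun x => Cexp (alpha + RtoC x * beta)).
Proof.
  apply analyticC_0_geometric with (c := fun k => Cexp alpha * RtoC (/ INR (fact k)) * beta ^ k)
    (r := 1%R) (K := (Cmod (Cexp alpha) * exp (2 * Cmod beta))%R); [lra|].
  intros x n Hx.
  rewrite (@sum_n_ext C_AbelianGroup _
    (fun k => Cexp alpha * (RtoC (/ INR (fact k)) * (RtoC x * beta) ^ k))).
  - rewrite sum_n_C_mult, Cexp_plus.
    replace (_ - _) with (Cexp alpha * Cexp_tail (S n) (RtoC x * beta))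
      by (rewrite <- Cexp_tail_sum; ring).
    rewrite Cmod_mult, Rmult_assoc; apply Rmult_le_compat_l; [apply Cmod_ge_0|].
    apply Rle_trans with (1 := Cmod_Cexp_tail _ _).
    rewrite Rmult_comm; apply Rmult_le_compat.
    + left; apply exp_pos.
    + left; apply pow_lt; lra.
    + apply exp_le_mono; rewrite Cmod_mult, Cmod_R.
      generalize (Cmod_ge_0 beta) (Rabs_pos x); nra.
    + simpl; assert (0 < (1 / 2) ^ n)%R by (apply pow_lt; lra); lra.
  - intros k; rewrite Cpow_mult_distr, RtoC_pow.
    change (RtoC x ^ k * (Cexp alpha * RtoC (/ INR (fact k)) * beta ^ k)
      = Cexp alpha * (RtoC (/ INR (fact k)) * (RtoC x ^ k * beta ^ k))); ring.
Qed.

(** On z = a + it, this is what remains of z^(-(s+y)) after the first n terms of its expansion in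
    powers of y. *)
Definition vline_tail (a s : C) (n : nat) (y : C) (t : R) : C :=
  Cpower (a + (0, t)%R) (- s) * Cexp_tail n (- y * Clog (a + (0, t)%R)).

Lemma vline_tail_0 (a s y : C) (t : R) : vline_tail a s 0 y t = vline a (s + y) t.
Proof.
  unfold vline_tail, vline, Cpower; simpl Cexp_tail; rewrite <- Cexp_plus; f_equal; ring.
Qed.

(** A constant uniform in n and in |y| <= 1/2: the exponential comes from [vline_tail_growth], and
    the factor in front covers both terms of the product rule. *)
Definition vline_tail_sup (a s : C) : R :=
  (2 * (Cmod s + 1) * exp ((2 + Re s) * Rabs (ln (Re a)) + 2 * Rabs (Im s) + 2))%R.

(** Up to a constant, exp (2 |y log z|) grows like |z|^(2|y|) on the line, which the factor 1/z from
    the derivative absorbs as long as |y| <= 1/2. *)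
Lemma vline_tail_growth (a s y z : C) : (0 < Re a <= Re z)%R -> (0 <= Re s)%R ->
  (Cmod y <= 1 / 2)%R ->
  (Cmod (/ z) * Cmod (Cpower z (- s)) * exp (2 * Cmod (- y * Clog z))
   <= exp ((2 + Re s) * Rabs (ln (Re a)) + 2 * Rabs (Im s) + 2))%R.
Proof.
  intros Hz Hs Hy.
  assert (z0 : z <> 0) by (apply Re_pos_neq_0; lra).
  assert (lz := ln_Cmod_ge z (Re a) Hz).
  destruct (Im_Clog_bound z ltac:(lra)) as [H2 H3].
  assert (H4 : (Rabs (Im (Clog z)) <= 2)%R) by (apply Rabs_le; generalize PI_4; lra).
  assert (H5 : (Im s * Im (Clog z) <= Rabs (Im s) * 2)%R).
  { apply Rle_trans with (1 := Rle_abs _); rewrite Rabs_mult.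
    apply Rmult_le_compat_l; [apply Rabs_pos|assumption]. }
  assert (H6 := Cmod_le_abs (Clog z)).
  rewrite Cmod_inv, Cmod_Cpower by assumption.
  rewrite Re_Clog in *.
  rewrite <- (exp_ln (Cmod z)) at 1 by now apply Cmod_gt_0.
  rewrite <- exp_Ropp, <- !exp_plus, Cmod_mult, Cmod_opp.
  apply exp_le_mono.
  change (Re (- s)) with (- Re s)%R; change (Im (- s)) with (- Im s)%R.
  set (la := ln (Cmod z)) in *; set (l0 := ln (Re a)) in *.
  assert (H7 : (2 * (Cmod y * Cmod (Clog z)) <= Rabs la + 2)%R)
    by (generalize (Cmod_ge_0 y) (Cmod_ge_0 (Clog z)); nra).
  enough (- la - Re s * la + Rabs la <= (2 + Re s) * Rabs l0)%R by lra.
  assert (A := Rabs_pos l0).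
  (* If |z| < 1 then ln (Re a) <= ln |z| < 0 bounds everything; otherwise -la and |la| cancel and
     -Re s * la <= 0 remains. *)
  unfold Rabs at 1; destruct (Rcase_abs la).
  - assert (- la <= Rabs l0)%R by (rewrite <- Rabs_Ropp; apply Rle_trans with (2 := Rle_abs _); lra).
    nra.
  - nra.
Qed.

Lemma vline_tail_bounded_slope (a s y : C) (n : nat) : (0 < Re a)%R -> (0 <= Re s)%R ->
  (Cmod y <= 1 / 2)%R ->
  bounded_slope (vline_tail a s n y) (vline_tail_sup a s * (1 / 2) ^ n).
Proof.
  intros Ha Hs Hy.
  set (phi := fun z => Cpower z (- s) * Cexp_tail n (- y * Clog z)).
  set (phi' := fun z => - s * / z * Cpower z (- s) * Cexp_tail n (- y * Clog z)
      (* For n = 0 the remainder is the exponential, its own derivative, so [pred 0 = 0] is the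
         right index. *)
      + Cpower z (- s) * (Cexp_tail (pred n) (- y * Clog z) * (- y * / z))).
  exists (fun t => phi' (a + (0, t)%R) * Ci); intros t.
  set (z := a + (0, t)%R).
  assert (P : Re z = Re a) by (unfold z; simpl; unfold Re; ring).
  split.
  - assert (Hh : holo phi z (phi' z)).
    { apply (holo_mult (fun z => Cpower z (- s)) (fun z => Cexp_tail n (- y * Clog z)));
        [apply holo_Cpower; lra|].
      apply (holo_comp (Cexp_tail n) (fun z => - y * Clog z)).
      - apply holo_scal, holo_Clog; lra.
      - destruct n; [apply holo_Cexp|apply holo_Cexp_tail]. }
    apply (Hh (fun t => a + (0, t)%R)); [|reflexivity].
    split; simpl; auto_derive; auto.
  - rewrite Cmod_mult, Cmod_Ci, Rmult_1_r; unfold phi'.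
    eapply Rle_trans; [apply Cmod_triangle|].
    rewrite !Cmod_mult, !Cmod_opp.
    assert (G := vline_tail_growth a s y z ltac:(lra) Hs Hy).
    set (M := exp ((2 + Re s) * Rabs (ln (Re a)) + 2 * Rabs (Im s) + 2)) in *.
    set (E := exp (2 * Cmod (- y * Clog z))) in *.
    assert (T1 := Cmod_Cexp_tail n (- y * Clog z)).
    assert (T2 := Cmod_Cexp_tail (pred n) (- y * Clog z)).
    fold E in T1, T2.
    set (q := ((1 / 2) ^ n)%R) in *.
    assert (q0 : (0 < q)%R) by (apply pow_lt; lra).
    (* Lowering the order by one costs a factor 2, which |y| <= 1/2 makes up for. *)
    assert (T2' : (Cmod (Cexp_tail (pred n) (- y * Clog z)) <= 2 * q * E)%R).
    { apply Rle_trans with (1 := T2); apply Rmult_le_compat_r; [left; apply exp_pos|].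
      unfold q; destruct n; simpl; lra. }
    set (A := Cmod (/ z)) in *; set (B := Cmod (Cpower z (- s))) in *.
    assert (A0 : (0 <= A)%R) by apply Cmod_ge_0.
    assert (B0 : (0 <= B)%R) by apply Cmod_ge_0.
    assert (AB : (0 <= A * B)%R) by now apply Rmult_le_pos.
    assert (s0 := Cmod_ge_0 s); assert (y0 := Cmod_ge_0 y).
    set (t1 := Cmod (Cexp_tail n (- y * Clog z))) in *.
    set (t2 := Cmod (Cexp_tail (pred n) (- y * Clog z))) in *.
    assert (t20 : (0 <= t2)%R) by apply Cmod_ge_0.
    assert (U1 : (A * B * t1 <= q * M)%R).
    { apply Rle_trans with (A * B * (q * E))%R; [now apply Rmult_le_compat_l|].
      replace (A * B * (q * E))%R with (q * (A * B * E))%R by ring.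
      apply Rmult_le_compat_l; lra. }
    assert (U2 : (A * B * t2 <= 2 * q * M)%R).
    { apply Rle_trans with (A * B * (2 * q * E))%R; [now apply Rmult_le_compat_l|].
      replace (A * B * (2 * q * E))%R with (2 * q * (A * B * E))%R by ring.
      apply Rmult_le_compat_l; lra. }
    unfold vline_tail_sup; fold M.
    apply Rle_trans with (Cmod s * (A * B * t1) + Cmod y * (A * B * t2))%R; [right; ring|].
    assert (M0 : (0 < M)%R) by apply exp_pos.
    assert (0 <= q * M)%R by nra.
    assert (Cmod s * (A * B * t1) <= Cmod s * (q * M))%R by now apply Rmult_le_compat_l.
    assert (Cmod y * (A * B * t2) <= 1 / 2 * (2 * q * M))%R.
    { apply Rmult_le_compat; try assumption; now apply Rmult_le_pos. }
    nra.
Qed.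

(** Lambda is applied to the expansion of z^(-s-xv) term by term. The error is Lambda of a
    remainder, which the slope estimate makes geometrically small; |v| <= 2 and |x| < 1/4 give the
    required |y| <= 1/2. *)
Lemma Lambda_vline_analytic (a s v : C) : (0 < Re a)%R -> (0 <= Re s)%R -> (Cmod v <= 2)%R ->
  analyticC_0 (fun x => Lambda (vline a (s + RtoC x * v))).
Proof.
  intros Ha Hs Hv.
  assert (Y : forall x, (Rabs x <= 1 / 4)%R -> (Cmod (RtoC x * v) <= 1 / 2)%R).
  { intros x Hx; rewrite Cmod_mult, Cmod_R; generalize (Rabs_pos x) (Cmod_ge_0 v); nra. }
  assert (slope := fun n x (Hx : (Rabs x <= 1 / 4)%R) =>
            vline_tail_bounded_slope a s (RtoC x * v) n Ha Hs (Y x Hx)).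
  set (d := fun k t => RtoC (/ INR (fact k)) * (Cpower (a + (0, t)%R) (- s)
                         * (- v * Clog (a + (0, t)%R)) ^ k)).
  assert (S : forall k x t, vline_tail a s (S k) (RtoC x * v) t
            = vline_tail a s k (RtoC x * v) t + - RtoC (x ^ k) * d k t).
  { intros k x t; unfold vline_tail, d; simpl Cexp_tail.
    replace (- (RtoC x * v) * Clog (a + (0, t)%R))
      with (RtoC x * (- v * Clog (a + (0, t)%R))) by ring.
    rewrite Cpow_mult_distr, RtoC_pow; ring. }
  assert (q4 : (Rabs (1 / 4) <= 1 / 4)%R) by (rewrite Rabs_pos_eq; lra).
  (* The k-th coefficient function is the difference of two consecutive remainders at x = 1/4,
     divided by (1/4)^k, and so inherits its slope bound from theirs. *)
  assert (dslope : forall k, exists L, bounded_slope (d k) L).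
  { intros k; eexists.
    eapply bounded_slope_ext; [|apply (bounded_slope_scal (RtoC (/ (1 / 4) ^ k))),
      (bounded_slope_plus _ _ _ _ (slope k (1 / 4)%R q4)
        (bounded_slope_scal (- (1)) _ _ (slope (Datatypes.S k) (1 / 4)%R q4)))].
    intros t; cbv beta; rewrite S.
    transitivity (RtoC (/ (1 / 4) ^ k) * RtoC ((1 / 4) ^ k) * d k t); [ring|].
    rewrite <- RtoC_mult, Rinv_l by (apply pow_nonzero; lra); ring. }
  apply analyticC_0_geometric with (c := fun k => Lambda (d k)) (r := (1 / 4)%R)
    (K := vline_tail_sup a s); [lra|].
  intros x n Hx.
  assert (Hx' : (Rabs x <= 1 / 4)%R) by lra.
  assert (E : Lambda (vline a (s + RtoC x * v))
      - @sum_n C_AbelianGroup (fun k => RtoC (x ^ k) * Lambda (d k)) n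
      = Lambda (vline_tail a s (Datatypes.S n) (RtoC x * v))).
  { assert (step : forall k, Lambda (vline_tail a s (Datatypes.S k) (RtoC x * v))
        = Lambda (vline_tail a s k (RtoC x * v)) - RtoC (x ^ k) * Lambda (d k)).
    { intros k; destruct (dslope k) as [L HL].
      rewrite (Lambda_ext _ _ _ (slope (Datatypes.S k) x Hx') (S k x)).
      rewrite (Lambda_plus _ _ _ _ (slope k x Hx') (bounded_slope_scal (- RtoC (x ^ k)) _ _ HL)).
      rewrite (Lambda_scal _ _ _ HL); ring. }
    assert (step0 : Lambda (vline a (s + RtoC x * v)) = Lambda (vline_tail a s 0 (RtoC x * v))).
    { symmetry; apply (Lambda_ext _ _ _ (slope 0%nat x Hx')), vline_tail_0. }
    rewrite step0; induction n as [|n IH].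
    - rewrite sum_n_C_0, step; reflexivity.
    - rewrite sum_n_C_S, (step (Datatypes.S n)), <- IH; ring. }
  change (Cmod (Lambda (vline a (s + RtoC x * v))
      - @sum_n C_AbelianGroup (fun k => (RtoC (x ^ k) * Lambda (d k))%C) n)
      <= vline_tail_sup a s * (1 / 2) ^ n)%R.
  rewrite E.
  destruct (Lambda_spec _ _ (slope (Datatypes.S n) x Hx')) as (_ & B & _).
  apply Rle_trans with (1 := B); apply Rmult_le_compat_l.
  - unfold vline_tail_sup; apply Rmult_le_pos; [|left; apply exp_pos].
    generalize (Cmod_ge_0 s); lra.
  - simpl; assert (0 < (1 / 2) ^ n)%R by (apply pow_lt; lra); lra.
Qed.

(** * Comparison of both sides for Re s > 0 *)

Lemma analyticC_0_ext (F G : R -> C) :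
  (forall x, F x = G x) -> analyticC_0 F -> analyticC_0 G.
Proof.
  intros E [(c & r & Hr & H1) (d & q & Hq & H2)]; split.
  - exists c, r; split; [assumption|]; intros x Hx; rewrite <- E; now apply H1.
  - exists d, q; split; [assumption|]; intros x Hx; rewrite <- E; now apply H2.
Qed.

Lemma P2_formula_analytic (zeta : C -> C -> C) (Hzeta : is_hurwitz_zeta zeta) (a s v : C) :
  (0 < Re a)%R -> s <> 1 -> analyticC_0 (fun x => P2_formula zeta a (s + RtoC x * v)).
Proof.
  intros Ha Hs.
  assert (Ha2 : (0 < Re (a / 2))%R)
    by (replace (Re (a / 2)) with (Re a / 2)%R by (simpl; unfold Re; field); lra).
  assert (const : forall w : C, analyticC_0 (fun _ => w)).
  { intros w; apply analyticC_0_geometric with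
      (c := fun k => match k with O => w | _ => 0 end) (r := 1%R) (K := 0%R); [lra|].
    intros x n _.
    replace (@sum_n C_AbelianGroup _ n) with w.
    - replace (w - w) with (RtoC 0) by ring; rewrite Cmod_0; lra.
    - induction n as [|n IH]; [rewrite sum_n_C_0; simpl; ring|].
      rewrite sum_n_C_S, <- IH; ring. }
  apply analyticC_0_plus; [apply analyticC_0_plus|apply analyticC_0_opp].
  - apply analyticC_0_mult.
    + apply analyticC_0_ext with (2 := analyticC_0_Cexp ((2 - s) * Clog 2) (- v * Clog 2)).
      intros x; unfold Cpower; f_equal; ring.
    + exact (analytic_at_ray _ s v (proj2 (Hzeta (a / 2) Ha2) s Hs)).
  - apply analyticC_0_opp, analyticC_0_mult; [apply const|].
    exact (analytic_at_ray _ s v (proj2 (Hzeta a Ha) s Hs)).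
  - apply analyticC_0_ext with (2 := analyticC_0_Cexp (- s * Clog a) (- v * Clog a)).
    intros x; unfold Cpower; f_equal; ring.
Qed.

Lemma P2_formula_eq_Lambda_continued (zeta : C -> C -> C) (Hzeta : is_hurwitz_zeta zeta) (a s : C) :
  (0 < Re a)%R -> (0 < Re s)%R -> s <> 1 -> P2_formula zeta a s = 2 * Lambda (vline a s).
Proof.
  intros Ha Hs Hs1.
  (* The direction 1 + i or 1 - i, chosen by the sign of Im s, leads away from the real axis, so
     only the starting point could be 1. Its real part 1 ensures Re > 1 once x > 1. *)
  assert (ray : exists v : C, Re v = 1%R /\ (Cmod v <= 2)%R /\
            forall x, (0 <= x)%R -> s + RtoC x * v <> 1).
  { assert (B : forall e, (Rabs e <= 1)%R -> (Cmod (1%R, e) <= 2)%R).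
    { intros e He; apply Rle_trans with (1 := Cmod_le_abs _); simpl; rewrite Rabs_R1; lra. }
    destruct (Rle_lt_dec 0 (Im s)) as [I|I].
    - exists (1, 1)%R; split; [reflexivity|split; [apply B; rewrite Rabs_R1; lra|]].
      intros x Hx E; assert (E2 := f_equal snd E); simpl in E2; unfold Im in I.
      assert (x0 : x = 0%R) by lra.
      apply Hs1; rewrite <- E, x0; ring.
    - exists (1, - (1))%R; split; [reflexivity|split; [apply B; rewrite Rabs_Ropp, Rabs_R1; lra|]].
      intros x Hx E; assert (E2 := f_equal snd E); simpl in E2; unfold Im in I; lra. }
  destruct ray as (v & v1 & v2 & v3).
  assert (Rv : forall x, Re (s + RtoC x * v) = (Re s + x)%R).
  { intros x; transitivity (Re s + x * Re v)%R; [|rewrite v1; ring].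
    simpl; unfold Re; ring. }
  set (H := fun x => P2_formula zeta a (s + RtoC x * v) + - (2 * Lambda (vline a (s + RtoC x * v)))).
  enough (E : H 0%R = 0).
  { unfold H in E; rewrite Cmult_0_l, Cplus_0_r in E.
    rewrite <- (Cplus_0_r (2 * _)), <- E; ring. }
  apply analytic_continuation.
  - intros x0 Hx0.
    set (s0 := s + RtoC x0 * v).
    assert (Es : forall x, s0 + RtoC x * v = s + RtoC (x0 + x) * v)
      by (intros x; unfold s0; rewrite RtoC_plus; ring).
    apply analyticC_0_ext with (F := fun x => P2_formula zeta a (s0 + RtoC x * v)
       + - (Lambda (vline a (s0 + RtoC x * v)) + Lambda (vline a (s0 + RtoC x * v)))).
    { intros x; unfold H; rewrite Es; ring. }
    assert (AL : analyticC_0 (fun x => Lambda (vline a (s0 + RtoC x * v))))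
      by (apply Lambda_vline_analytic; [assumption|unfold s0; rewrite Rv; lra|assumption]).
    apply analyticC_0_plus; [apply P2_formula_analytic; [assumption|assumption|now apply v3]|].
    apply analyticC_0_opp; now apply analyticC_0_plus.
  - intros x Hx; unfold H.
    rewrite (P2_formula_eq_Lambda zeta Hzeta); [ring|assumption|rewrite Rv; lra].
Qed.

Lemma P2_eq_Lambda (zeta : C -> C -> C) (Hzeta : is_hurwitz_zeta zeta) (a s : C) :
  (0 < Re a)%R -> (0 < Re s)%R -> P2 zeta a s = 2 * Lambda (vline a s).
Proof.
  intros Ha Hs; unfold P2; destruct (Ceq_dec s 1) as [->|Hs1];
    [|now apply P2_formula_eq_Lambda_continued].
  (* [C_lim] takes its limits along the horizontal line through 1. On that line h is continuous at 1
     and agrees with the formula near 1 except at 1 itself. *)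
  set (h := fun x : R => 2 * Lambda (vline a (x, 0)%R)).
  assert (A : analyticC_0 (fun x => h (x + 1)%R)).
  { assert (AL := Lambda_vline_analytic a 1 1 Ha ltac:(simpl; lra)
                    ltac:(rewrite Cmod_1; lra)).
    apply analyticC_0_ext with (2 := analyticC_0_plus _ _ AL AL).
    intros x; unfold h.
    replace (((x + 1)%R, 0%R) : C) with (1 + RtoC x * 1) by (apply C_ext; simpl; ring).
    ring. }
  assert (near : Rbar_locally' 1 (fun x => h x = P2_formula zeta a (x, 0)%R)).
  { exists (mkposreal 1 Rlt_0_1); intros x Hx Hx1.
    change (Rabs (x - 1) < 1)%R in Hx; apply Rabs_def2 in Hx.
    symmetry; apply P2_formula_eq_Lambda_continued; [assumption|assumption|simpl; lra|].
    intros E; apply Hx1; exact (f_equal fst E). }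
  assert (lim : forall p : C -> R, (p = Re \/ p = Im) ->
            real (Lim (fun x => p (P2_formula zeta a (x, 0)%R)) 1) = p (h 1%R)).
  { intros p Hp.
    rewrite (is_lim_unique _ _ (p (h 1%R))); [reflexivity|].
    apply is_lim_ext_loc with (f := fun x => p (h x)).
    - apply filter_imp with (2 := near); intros x E; now rewrite E.
    - apply is_lim_continuity, continuity_pt_filterlim.
      apply (continuous_ext (fun x => p (h ((x - 1) + 1)%R))).
      { intros x; do 2 f_equal; ring. }
      apply (continuous_comp (fun x => x - 1)%R (fun x => p (h (x + 1)%R))).
      + apply @ex_derive_continuous; auto_derive; auto.
      + replace (1 - 1)%R with 0%R by ring.
        destruct A as [A1 A2]; destruct Hp as [-> | ->]; now apply analytic_0_continuous. }
  unfold C_lim; change (snd (RtoC 1)) with 0%R; change (fst (RtoC 1)) with 1%R.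
  apply C_ext; simpl.
  - exact (lim Re (or_introl eq_refl)).
  - exact (lim Im (or_intror eq_refl)).
Qed.

(** * The integral SH_n *)

Lemma binomial_C_one_plus (u : C) (n : nat) :
  @sum_n C_AbelianGroup (fun m => RtoC (Binomial.C n m) * u ^ m) n = (1 + u) ^ n.
Proof.
  assert (C0 : forall k, Binomial.C k 0 = 1%R).
  { intros k; unfold Binomial.C; rewrite Nat.sub_0_r; simpl (fact 0).
    change (INR 1) with 1%R; field; apply INR_fact_neq_0. }
  assert (Cn : forall k, Binomial.C k k = 1%R).
  { intros k; unfold Binomial.C; rewrite Nat.sub_diag; simpl (fact 0).
    change (INR 1) with 1%R; field; apply INR_fact_neq_0. }
  induction n as [|n IH].
  - rewrite sum_n_C_0, C0; simpl; ring.
  - set (A := @sum_n C_AbelianGroup (fun m => RtoC (Binomial.C (S n) m) * u ^ m)).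
    set (B := @sum_n C_AbelianGroup (fun m => RtoC (Binomial.C n m) * u ^ m)) in *.
    assert (A0 : A 0%nat = RtoC 1) by (unfold A; rewrite sum_n_C_0, C0; simpl; ring).
    assert (B0 : B 0%nat = RtoC 1) by (unfold B; rewrite sum_n_C_0, C0; simpl; ring).
    assert (AS : forall k, A (S k) = A k + RtoC (Binomial.C (S n) (S k)) * u ^ S k)
      by (intros k; exact (sum_n_C_S _ k)).
    assert (BS : forall k, B (S k) = B k + RtoC (Binomial.C n (S k)) * u ^ S k)
      by (intros k; exact (sum_n_C_S _ k)).
    (* Pascal's rule summed up to k + 1: multiplication by 1 + u adds a shifted copy of the partial
       sums. The top term is treated separately. *)
    assert (step : forall k, (S k <= n)%nat -> A (S k) = B (S k) + u * B k).
    { induction k as [|k IHk]; intros Hk; rewrite AS, BS, <- (pascal n _ Hk), RtoC_plus.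
      - rewrite A0, B0, C0; simpl; ring.
      - rewrite IHk, (BS k) by lia; simpl; ring. }
    simpl Cpow; rewrite <- IH, AS, Cn.
    destruct n as [|n].
    + rewrite A0, B0; simpl; ring.
    + rewrite (step n) by lia.
      rewrite (BS n), Cn; simpl; ring.
Qed.

(** With z = a + it, the binomial theorem is applied to (it / z)^(2n) = (1 - a/z)^(2n); multiplying
    back, each z^(2n-m) lowers the exponent s to m + s - 2n. *)
Lemma vline_binomial (n : nat) (a s : C) (t : R) : (0 < Re a)%R ->
  @sum_n C_AbelianGroup (fun m => RtoC ((-1) ^ (m + n)) * RtoC (Binomial.C (2 * n) m) * a ^ m
     * vline a (RtoC (INR m) + s - RtoC (INR (2 * n))) t) (2 * n)
  = RtoC (t ^ (2 * n)) * vline a s t.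
Proof.
  intros Ha; unfold vline.
  set (z := a + (0, t)%R).
  assert (Pz : (0 < Re z)%R) by (unfold z; simpl; unfold Re in Ha; lra).
  assert (z0 := Re_pos_neq_0 z Pz).
  rewrite (@sum_n_ext C_AbelianGroup _ (fun m => RtoC ((-1) ^ n) * z ^ (2 * n) * Cpower z (- s)
     * (RtoC (Binomial.C (2 * n) m) * (- a / z) ^ m))).
  - rewrite sum_n_C_mult, binomial_C_one_plus.
    match goal with |- ?l = ?r => change (@eq C l r) end.
    transitivity (RtoC ((-1) ^ n) * (z * (1 + - a / z)) ^ (2 * n) * Cpower z (- s)).
    { rewrite Cpow_mult_distr; ring. }
    replace (z * (1 + - a / z)) with (Ci * RtoC t)
      by (transitivity (z - a); [unfold z; apply C_ext; simpl; ring|field; assumption]).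
    assert (S : forall k, RtoC ((-1) ^ k) * (Ci * RtoC t) ^ (2 * k) = RtoC (t ^ (2 * k))).
    { intros k; rewrite !RtoC_pow.
      induction k as [|k IHk]; [simpl; ring|].
      replace (2 * S k)%nat with (S (S (2 * k))) by lia.
      simpl Cpow in *; rewrite <- IHk.
      transitivity (- (Ci * Ci) * RtoC t * RtoC t * (RtoC (-1) ^ k * (Ci * RtoC t) ^ (k + (k + 0)))).
      - replace (RtoC (-1)) with (- RtoC 1) at 1 by (apply C_ext; simpl; ring); ring.
      - replace (Ci * Ci) with (- RtoC 1) by (apply C_ext; simpl; ring); ring. }
    rewrite S; reflexivity.
  - intros m.
    replace (- (RtoC (INR m) + s - RtoC (INR (2 * n))))
      with (RtoC (INR (2 * n)) + (- s + - RtoC (INR m))) by ring.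
    rewrite !Cpower_plus, (Cpower_INR z (2 * n)) by assumption.
    replace (Cpower z (- RtoC (INR m))) with (/ z ^ m).
    2:{ rewrite <- (Cpower_INR z m) by assumption; unfold Cpower; rewrite <- Cexp_opp.
        f_equal; ring. }
    replace (- a / z) with (RtoC (-1) * (a * / z)).
    2:{ replace (RtoC (-1)) with (- RtoC 1) by (apply C_ext; simpl; ring); field; assumption. }
    rewrite !Cpow_mult_distr, Rdef_pow_add, RtoC_mult, !RtoC_pow.
    replace ((/ z) ^ m) with (/ z ^ m).
    + match goal with |- ?l = ?r => change (@eq C l r) end; ring.
    + induction m as [|m IHm]; simpl; [field; intros E; apply RtoC_inj in E; lra|].
      rewrite <- IHm; field; split; [|assumption].
      clear IHm; induction m; simpl; [intros E; apply RtoC_inj in E; lra|].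
      now apply Cmult_neq_0.
Qed.

(** The principal branches agree: 1 + it/a and 1 - it/a are quotients of points of the right
    half-plane, so log a cancels in [Catan], and a^2 + t^2 = (a + it)(a - it) has the sum of the two
    logarithms. *)
Lemma SH_integrand_odd_kernel (n : nat) (a s : C) (t : R) : (0 < Re a)%R -> (0 < t)%R ->
  SH_integrand n a s t = RtoC (t ^ (2 * n)) * odd_kernel (vline a s) t.
Proof.
  intros Ha Ht.
  set (zp := a + (0, t)%R); set (zm := a + (0, - t)%R).
  assert (Pp : (0 < Re zp)%R) by (unfold zp; simpl; unfold Re in Ha; lra).
  assert (Pm : (0 < Re zm)%R) by (unfold zm; simpl; unfold Re in Ha; lra).
  assert (a0 := Re_pos_neq_0 a Ha).
  assert (Ep : zp = a + Ci * RtoC t) by (apply C_ext; simpl; ring).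
  assert (Em : zm = a - Ci * RtoC t) by (apply C_ext; simpl; ring).
  assert (S0 : RtoC (sinh (PI * t)) <> 0).
  { intros K; apply RtoC_inj in K.
    assert (0 < sinh (PI * t))%R by (apply sinh_pos; generalize PI_RGT_0; nra); lra. }
  assert (I0 := Ci_neq_0).
  assert (CC : Ci * Ci = - RtoC 1) by (apply C_ext; simpl; ring).
  assert (At : Catan (RtoC t / a) = (Clog zp - Clog zm) / (2 * Ci)).
  { unfold Catan.
    replace (1 + Ci * (RtoC t / a)) with (zp / a) by (rewrite Ep; field; assumption).
    replace (1 - Ci * (RtoC t / a)) with (zm / a) by (rewrite Em; field; assumption).
    rewrite !Clog_div by assumption; f_equal; ring. }
  assert (Lg : Clog (a * a + RtoC t * RtoC t) = Clog zp + Clog zm).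
  { rewrite <- Clog_mult by assumption; f_equal.
    rewrite Ep, Em; transitivity (a * a - (Ci * Ci) * (RtoC t * RtoC t)); [rewrite CC|]; ring. }
  unfold SH_integrand, odd_kernel, vline; fold zp zm.
  rewrite At; unfold Cpower; rewrite Lg; unfold Csin.
  replace (Ci * (s * ((Clog zp - Clog zm) / (2 * Ci))))
    with (s / 2 * Clog zp + - (s / 2 * Clog zm)) by (field; assumption).
  replace (- (s / 2 * Clog zp + - (s / 2 * Clog zm)))
    with (- (s / 2 * Clog zp) + s / 2 * Clog zm) by ring.
  replace (s / 2 * (Clog zp + Clog zm)) with (s / 2 * Clog zp + s / 2 * Clog zm) by ring.
  replace (- s * Clog zp) with (- (s / 2 * Clog zp) + - (s / 2 * Clog zp)) by field.
  replace (- s * Clog zm) with (- (s / 2 * Clog zm) + - (s / 2 * Clog zm)) by field.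
  rewrite !Cexp_plus, !Cexp_opp.
  assert (E1 := Cexp_neq_0 (s / 2 * Clog zp)); assert (E2 := Cexp_neq_0 (s / 2 * Clog zm)).
  field; repeat split; assumption.
Qed.

(** The slope bound is carried along with the equality because additivity at the next step needs
    it. *)
Lemma Lambda_sum (c : nat -> C) (psi : nat -> R -> C) (N : nat) :
  (forall m, (m <= N)%nat -> exists L, bounded_slope (psi m) L) ->
  (exists L, bounded_slope (fun t => @sum_n C_AbelianGroup (fun m => c m * psi m t) N) L) /\
  Lambda (fun t => @sum_n C_AbelianGroup (fun m => c m * psi m t) N)
  = @sum_n C_AbelianGroup (fun m => c m * Lambda (psi m)) N.
Proof.
  induction N as [|N IH]; intros H.
  - destruct (H 0%nat ltac:(lia)) as [L HL].
    assert (K := bounded_slope_scal (c 0%nat) _ _ HL).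
    assert (E : forall t, c 0%nat * psi 0%nat t
              = @sum_n C_AbelianGroup (fun m => c m * psi m t) 0)
      by (intros t; now rewrite sum_n_C_0).
    split; [eexists; exact (bounded_slope_ext _ _ _ E K)|].
    rewrite sum_n_C_0, <- (Lambda_scal _ _ _ HL); symmetry; exact (Lambda_ext _ _ _ K E).
  - destruct (IH (fun m Hm => H m ltac:(lia))) as [[L1 H1] IH'].
    destruct (H (S N) ltac:(lia)) as [L HL].
    assert (K := bounded_slope_scal (c (S N)) _ _ HL).
    assert (K2 := bounded_slope_plus _ _ _ _ H1 K).
    assert (E : forall t, @sum_n C_AbelianGroup (fun m => c m * psi m t) N + c (S N) * psi (S N) t
              = @sum_n C_AbelianGroup (fun m => c m * psi m t) (S N))
      by (intros t; now rewrite sum_n_C_S).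
    split; [eexists; exact (bounded_slope_ext _ _ _ E K2)|].
    rewrite sum_n_C_S, <- IH', <- (Lambda_scal _ _ _ HL), <- (Lambda_plus _ _ _ _ H1 K).
    symmetry; exact (Lambda_ext _ _ _ K2 E).
Qed.

Theorem theorem3p1 (zeta : C -> C -> C) (Hzeta : is_hurwitz_zeta zeta)
  (n : nat) (a s : C) (Ha : (0 < Re a)%R)
  (Hs : (0 <= INR (2 * n) < Re s)%R) :
  ex_SH n a s /\
  SH n a s =
    / 2 * @sum_n C_AbelianGroup (fun m : nat =>
              RtoC ((-1) ^ (m + n)) * RtoC (Binomial.C (2 * n) m) * a ^ m *
              P2 zeta a (RtoC (INR m) + s - RtoC (INR (2 * n))))
            (2 * n).
Proof.
  set (sm := fun m => RtoC (INR m) + s - RtoC (INR (2 * n))).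
  set (c := fun m => RtoC ((-1) ^ (m + n)) * RtoC (Binomial.C (2 * n) m) * a ^ m).
  (* This is where 2n < Re s enters: every exponent m + s - 2n has positive real part. *)
  assert (Psm : forall m, (0 < Re (sm m))%R).
  { intros m; replace (Re (sm m)) with (INR m + Re s - INR (2 * n))%R by reflexivity.
    generalize (pos_INR m); lra. }
  set (psi := fun t => @sum_n C_AbelianGroup (fun m => c m * vline a (sm m) t) (2 * n)).
  destruct (Lambda_sum c (fun m => vline a (sm m)) (2 * n)) as [[L HL] HS].
  { intros m _; eexists; apply (vline_bounded_slope a a); [lra|left; apply Psm]. }
  fold psi in HL, HS.
  assert (G : @is_RInt_gen C_R_NormedModule (SH_integrand n a s) (at_right 0)
                (Rbar_locally p_infty) (Lambda psi)).
  { destruct (Lambda_spec psi L HL) as [G _].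
    apply (@is_RInt_gen_ext C_R_NormedModule _ _ _ _ (odd_kernel psi)) with (2 := G).
    apply filter_imp with (2 := filter_prod_small_large 1 1 Rlt_0_1).
    intros [x y] [Hx Hy] t Ht; simpl in *; rewrite Rmin_left in Ht by lra.
    rewrite SH_integrand_odd_kernel by (assumption || lra).
    unfold odd_kernel, psi, c, sm; rewrite !vline_binomial by assumption.
    (* The exponent is even, so t^(2n) factors out of the difference between the values at -t and
       t. *)
    replace ((- t) ^ (2 * n))%R with (t ^ (2 * n))%R by (rewrite !pow_mult; f_equal; ring).
    ring. }
  split; [now exists (Lambda psi)|].
  unfold SH; rewrite (@is_RInt_gen_unique C_R_CompleteNormedModule _ _ _ _ _ _ G).
  rewrite HS, <- sum_n_C_mult; apply (@sum_n_ext C_AbelianGroup); intros m.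
  change (c m * Lambda (vline a (sm m)) = / 2 * (c m * P2 zeta a (sm m))).
  rewrite (P2_eq_Lambda zeta Hzeta a (sm m) Ha (Psm m)); field.
Qed.
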